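(* Let $m>0$ and let $\sigma\in M^{2m}_{\rho,\Lambda}(\mathbb{T}\times\mathbb{Z})$ be a strongly ($M$-)elliptic symbol. Then for all $f\in L^2(\mathbb{T})$ there exists a real number $\lambda_0$ such that for all $\lambda\ge\lambda_0$ the pseudo-differential equation $(T_\sigma+\lambda I)u=f$ on $\mathbb{T}$ has a unique strong solution $u$ in $L^2(\mathbb{T})$, where $I$ is the identity operator on $L^2(\mathbb{T})$.
   Context: $\mathbb{N}_0=\{0,1,2,\dots\}$, and $\mathbb{T}=\mathbb{R}/2\pi\mathbb{Z}$ is the one-dimensional torus. For a function $a$ of $k\in\mathbb{Z}$, $\Delta_k a(k)=a(k+1)-a(k)$ and $\Delta_k^\alpha$ is its $\alpha$-th iterate. Weight function: $\Lambda:\mathbb{Z}\to(0,\infty)$ is a fixed function for which there are positive constants $\mu_0\le\mu_1$, $C_0,C_1$ with $C_0(1+|k|)^{\mu_0}\le\Lambda(k)\le C_1(1+|k|)^{\mu_1}$ for all $k\in\mathbb{Z}$. Moreover there is a real constant $\mu\ge\mu_1$ such that for all $\alpha\in\mathbb{N}_0$ and $\gamma\in\{0,1\}$ there is $C_{\alpha,\gamma}>0$ with $|k^\gamma\Delta_k^{\alpha+\gamma}\Lambda(k)|\le C_{\alpha,\gamma}\Lambda(k)^{1-\alpha/\mu}$ for all $k\in\mathbb{Z}$. Fix $\rho\in(0,1/\mu]$. Symbol classes: for $r\in\mathbb{R}$, $S^r_{\rho,\Lambda}(\mathbb{T}\times\mathbb{Z})$ is the set of functions $\sigma:\mathbb{T}\times\mathbb{Z}\to\mathbb{C}$,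 smooth in $x$ for every $k\in\mathbb{Z}$, such that for all $\alpha,\beta\in\mathbb{N}_0$ there is $C_{\alpha,\beta}>0$ with $|\Delta_k^\alpha\partial_x^\beta\sigma(x,k)|\le C_{\alpha,\beta}\Lambda(k)^{r-\rho\alpha}$ for all $(x,k)\in\mathbb{T}\times\mathbb{Z}$. $M^r_{\rho,\Lambda}(\mathbb{T}\times\mathbb{Z})$ is the set of functions $\sigma:\mathbb{T}\times\mathbb{Z}\to\mathbb{C}$, smooth in $x$ for every $k$, such that $k^\gamma\Delta_k^\gamma\sigma(x,k)\in S^r_{\rho,\Lambda}(\mathbb{T}\times\mathbb{Z})$ for each $\gamma\in\{0,1\}$. A symbol $\sigma\in M^r_{\rho,\Lambda}(\mathbb{T}\times\mathbb{Z})$ is strongly ($M$-)elliptic (of order $r$) if there are positive constants $C,R$ with $\operatorname{Re}\sigma(x,k)\ge C\Lambda(k)^r$ for all $x\in\mathbb{T}$ and all $k\in\mathbb{Z}$ with $|k|\ge R$; here $r=2m$. The pseudo-differential operator with symbol $\sigma$ is $$T_\sigma f(x)=(2\pi)^{-1}\sum_{k\in\mathbb{Z}}\int_{\mathbb{T}}e^{i(x-y)k}\sigma(x,k)f(y)\,dy,\quad x\in\mathbb{T},\ f\in C^\infty(\mathbb{T}).$$ The minimal operator $T_{\sigma,0}$ on $L^2(\mathbb{T})$ is the closure (smallest closed extension) in $L^2(\mathbb{T})$ of $T_\sigma$ with domain $C^\infty(\mathbb{T})$, with domain denoted $\mathcal{D}(T_{\sigma,0})$. A function $u\in L^2(\mathbb{T})$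 is a strong solution of $T_\sigma u=f$, $f\in L^2(\mathbb{T})$, if $u\in\mathcal{D}(T_{\sigma,0})$ and $T_{\sigma,0}u=f$. For the equation $(T_\sigma+\lambda I)u=f$ this is applied to the symbol $\sigma+\lambda$, since $T_\sigma+\lambda I=T_{\sigma+\lambda}$. *)

(* Defs.v *)
From HB Require Import structures.
From mathcomp Require Import all_boot all_order all_algebra.
From mathcomp Require Import all_classical all_reals all_analysis.
From mathcomp Require Import complex.

Set Implicit Arguments.
Unset Strict Implicit.
Unset Printing Implicit Defensive.

Import Order.TTheory GRing.Theory Num.Theory.
Import numFieldNormedType.Exports.

Local Open Scope classical_set_scope.
Local Open Scope ring_scope.
Local Open Scope complex_scope.

(* Functions on the torus R/2piZ are represented by 2pi-periodic functions on
   R, and functions into C by functions into R[i].  The derivatives, integrals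
   and sums of complex-valued functions are taken componentwise. *)
Section Defs.
Context {R : realType}.

Definition cabs (z : R[i]) : R := Normc.normc z.

Definition cis (t : R) : R[i] := cos t +i* sin t.

Definition torus_fun (f : R -> R[i]) : Prop := periodic f (2 * pi).

Definition torus : set R := `[0, 2 * pi].

Definition smooth (f : R -> R[i]) : Prop :=
  forall n x, derivable (derive1n n (fun y => complex.Re (f y))) x 1 /\
              derivable (derive1n n (fun y => complex.Im (f y))) x 1.

Definition cderive (n : nat) (f : R -> R[i]) (x : R) : R[i] :=
  derive1n n (fun y => complex.Re (f y)) x +i*
  derive1n n (fun y => complex.Im (f y)) x.

Definition smooth_torus (f : R -> R[i]) : Prop := torus_fun f /\ smooth f.

Definition torus_int (f : R -> R[i]) : R[i] :=
  (\int[lebesgue_measure]_(y in torus) complex.Re (f y)) +i*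
  (\int[lebesgue_measure]_(y in torus) complex.Im (f y)).

(* Limit of the symmetric partial sums over -N <= k <= N. *)
Definition sumZ (a : int -> R[i]) : R[i] :=
  limn (fun N => complex.Re (\sum_(i < N.*2.+1) a (i%:Z - N%:Z))) +i*
  limn (fun N => complex.Im (\sum_(i < N.*2.+1) a (i%:Z - N%:Z))).

Definition fdiff (V : zmodType) (a : int -> V) : int -> V :=
  fun k => a (k + 1) - a k.

Definition weight_function (mu : R) (Lam : int -> R) : Prop :=
  (forall k, 0 < Lam k) /\
  exists mu0 mu1 C0 C1 : R,
    [/\ [/\ 0 < mu0, mu0 <= mu1, 0 < C0 & 0 < C1],
        forall k : int,
          C0 * (1 + `|k%:~R|) `^ mu0 <= Lam k <= C1 * (1 + `|k%:~R|) `^ mu1,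
        mu1 <= mu
      & forall alpha gamma : nat, (gamma <= 1)%N ->
          exists2 C : R, 0 < C &
            forall k : int,
              `|k%:~R ^+ gamma * iter (alpha + gamma) (@fdiff R) Lam k|
                <= C * Lam k `^ (1 - alpha%:R / mu)].

Definition symbol : Type := R -> int -> R[i].

Definition S_class (rho : R) (Lam : int -> R) (r : R) (sigma : symbol) : Prop :=
  (forall k, smooth_torus (sigma^~ k)) /\
  forall alpha beta : nat, exists2 C : R, 0 < C &
    forall (x : R) (k : int),
      cabs (iter alpha (@fdiff R[i])
                 (fun j => cderive beta (sigma^~ j) x) k)
        <= C * Lam k `^ (r - rho * alpha%:R).

Definition M_class (rho : R) (Lam : int -> R) (r : R) (sigma : symbol) : Prop :=
  (forall k, smooth_torus (sigma^~ k)) /\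
  forall gamma : nat, (gamma <= 1)%N ->
    S_class rho Lam r
      (fun x k => k%:~R ^+ gamma * iter gamma (@fdiff R[i]) (sigma x) k).

Definition strongly_elliptic (Lam : int -> R) (r : R) (sigma : symbol) : Prop :=
  exists C K : R, [/\ 0 < C, 0 < K &
    forall (x : R) (k : int), K <= `|k%:~R| ->
      C * Lam k `^ r <= complex.Re (sigma x k)].

(* Only meant for smooth_torus f, for which the sum and integrals converge. *)
Definition psdo (sigma : symbol) (f : R -> R[i]) : R -> R[i] := fun x =>
  ((2 * pi)^-1)%:C *
  sumZ (fun k => torus_int (fun y => cis ((x - y) * k%:~R) * sigma x k * f y)).

(* Elements of L^2 of the torus are represented by square-integrable functions,
   to be compared with ae_equal. *)
Definition L2_sqnorm (u : R -> R[i]) : \bar R :=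
  (\int[lebesgue_measure]_(x in torus) ((cabs (u x)) ^+ 2)%:E)%E.

Definition L2 (u : R -> R[i]) : Prop :=
  [/\ torus_fun u,
      measurable_fun setT (fun x => complex.Re (u x)),
      measurable_fun setT (fun x => complex.Im (u x))
    & (L2_sqnorm u < +oo)%E].

Definition ae_equal (u v : R -> R[i]) : Prop :=
  {ae lebesgue_measure, forall x : R, u x = v x}.

Definition L2_cvg (u_ : nat -> R -> R[i]) (u : R -> R[i]) : Prop :=
  L2_sqnorm (fun x => u_ n x - u x) @[n --> \oo] --> (0 : \bar R).

(* An unbounded operator A on L^2 is given by its graph: A u f means that
   u is in the domain of A and A u = f. *)
Definition op_graph : Type := (R -> R[i]) -> (R -> R[i]) -> Prop.

Definition linear_operator (A : op_graph) : Prop :=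
  [/\ forall u f, A u f -> L2 u /\ L2 f,
      forall u f u' f', A u f -> L2 u' -> L2 f' ->
        ae_equal u u' -> ae_equal f f' -> A u' f',
      forall u f f', A u f -> A u f' -> ae_equal f f',
      A (fun=> 0) (fun=> 0)
    & forall (c : R[i]) u f v g, A u f -> A v g ->
        A (fun x => c * u x + v x) (fun x => c * f x + g x)].

Definition closed_operator (A : op_graph) : Prop :=
  linear_operator A /\
  forall u_ f_ u f, (forall n, A (u_ n) (f_ n)) -> L2 u -> L2 f ->
    L2_cvg u_ u -> L2_cvg f_ f -> A u f.

Definition extends_psdo (sigma : symbol) (A : op_graph) : Prop :=
  forall phi, smooth_torus phi -> A phi (psdo sigma phi).

Definition minimal_operator (sigma : symbol) (A : op_graph) : Prop :=
  [/\ closed_operator A, extends_psdo sigma A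
    & forall B, closed_operator B -> extends_psdo sigma B ->
        forall u f, A u f -> B u f].

(* The minimal operator is unique as a graph, so it does not matter which
   witness A is used; its existence is part of the assertion. *)
Definition strong_solution (sigma : symbol) (f u : R -> R[i]) : Prop :=
  exists2 A : op_graph, minimal_operator sigma A & A u f.

End Defs.

(* Main.v *)
Require Import Defs.
From HB Require Import structures.
From mathcomp Require Import all_boot all_order all_algebra.
From mathcomp Require Import all_classical all_reals all_analysis.
From mathcomp Require Import measurable_realfun complex ring lra zify.
Import Order.TTheory GRing.Theory Num.Theory.
Import numFieldNormedType.Exports.

(** Fourier coefficients turn T_sigma + lam into the infinite matrix
    P l k = a (l - k) k, where a p k is the p-th Fourier coefficient of
    sigma(., k) + lam.  For large lam strong ellipticity gives
    |sigma(x, k) + lam| >= c W k with W = Lam^(2m) + lam, uniformly in lam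
    (elliptic_lower), so the Fourier coefficients b p k of the reciprocal
    symbol define a second matrix Q l k = b (l - k) k, of size W^-1.  The
    theorem holds because Q inverts P up to an error that is small in lam.

    If the frequency were frozen, that is, if sum_j a (l - j) j * b (j - k) k
    were replaced by sum_j a (l - j) k * b (j - k) k, then the product would be
    exactly the identity: this is the convolution theorem for a symbol times its
    reciprocal.  So P Q - I and Q P - I come only from moving the frequency from
    j to k (freeze_kernel).  Each unit step in the frequency replaces Lam^(2m)
    by V = Lam^(2m - rho), and the quotient V / W is at most any prescribed d
    once lam is large (lower_order_small).  The number of steps is |j - k|, and
    along them the weights vary at most polynomially: by the differential
    inequality for Lam, a suitable root of Lam is Lipschitz, hence Lam satisfies
    Peetre's inequality (weight_peetre).  The polynomial factors are absorbed by
    the decay of Fourier coefficients away from the diagonal, which is of any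
    order because the symbol is smooth in x (fcoef_decay).  Therefore P Q = I + R
    and Q P = I + R', where R and R' have kernels bounded by a small multiple of
    (1 + |l - k|)^-2.  By Schur's test I + R is onto square-summable sequences
    and I + R' is injective, so P is bijective from the sequences u with W u
    square summable onto the square-summable ones (parametrix,
    elliptic_invertible).  The bound on lam does not depend on f.

    It remains to go back to functions and to the minimal operator.  Integrable
    functions with the same Fourier coefficients agree almost everywhere
    (fcoef_ae0), every square-summable family is a family of Fourier coefficients
    (riesz_fischer), and the L^2 norm is controlled by the coefficients
    (parseval_le).  The operator acting by the matrix P on all of its natural
    domain in L^2 is a closed extension of T_sigma + lam (max_op_closed,
    psdo_max).  Hence the intersection of all closed extensions is the minimal
    operator (min_op_minimal), and it lies inside the maximal one, where
    solutions are already unique because P is injective.  Conversely the solution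
    u of the matrix equation has W u square summable.  This is what makes the
    truncated Fourier series of u converge to u in the graph norm, so u belongs
    to the domain of the minimal operator and is a strong solution
    (min_op_of_coef). *)

Set Implicit Arguments.
Unset Strict Implicit.
Unset Printing Implicit Defensive.

Local Open Scope classical_set_scope.
Local Open Scope ring_scope.
Local Open Scope complex_scope.

(** * Complex numbers and limits with explicit rates *)

Section Complex.
Context {R : realType}.
Implicit Types z w : R[i].

Lemma cabs_ge0 z : 0 <= cabs z.
Proof. by case: z => a b; exact: sqrtr_ge0. Qed.

Lemma cabs0 : cabs (0 : R[i]) = 0.
Proof. exact: Normc.normc0. Qed.

Lemma cabs1 : cabs (1 : R[i]) = 1.
Proof. exact: Normc.normc1. Qed.

Lemma cabsM z w : cabs (z * w) = cabs z * cabs w.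
Proof. exact: Normc.normcM. Qed.

Lemma cabsD z w : cabs (z + w) <= cabs z + cabs w.
Proof. exact: le_normcD. Qed.

Lemma cabsN z : cabs (- z) = cabs z.
Proof. exact: normcN. Qed.

Lemma cabsB z w : cabs (z - w) <= cabs z + cabs w.
Proof. by rewrite -(cabsN w) cabsD. Qed.

Lemma cabsC z w : cabs (z - w) = cabs (w - z).
Proof. by rewrite -cabsN opprB. Qed.

Lemma cabsV z : cabs z^-1 = (cabs z)^-1.
Proof. exact: Normc.normcV. Qed.

Lemma cabs_eq0 z : cabs z <= 0 -> z = 0.
Proof.
by move=> h; apply: Normc.eq0_normc; apply/eqP; rewrite eq_le h cabs_ge0.
Qed.

Lemma cabs_real (x : R) : cabs x%:C = `|x|.
Proof. by rewrite /cabs /Normc.normc /= expr0n /= addr0 sqrtr_sqr. Qed.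

Lemma cabs_sqr z : cabs z ^+ 2 = complex.Re z ^+ 2 + complex.Im z ^+ 2.
Proof. by case: z => a b /=; rewrite sqr_sqrtr // addr_ge0 ?sqr_ge0. Qed.

Lemma normRe_le z : `|complex.Re z| <= cabs z.
Proof.
rewrite -(ler_pXn2r (ltn0Sn 1)) ?nnegrE ?cabs_ge0 // real_normK ?num_real //.
by rewrite cabs_sqr lerDl sqr_ge0.
Qed.

Lemma normIm_le z : `|complex.Im z| <= cabs z.
Proof.
rewrite -(ler_pXn2r (ltn0Sn 1)) ?nnegrE ?cabs_ge0 // real_normK ?num_real //.
by rewrite cabs_sqr lerDr sqr_ge0.
Qed.

Lemma cabs_le z : cabs z <= `|complex.Re z| + `|complex.Im z|.
Proof.
rewrite -(ler_pXn2r (ltn0Sn 1)) ?nnegrE ?cabs_ge0 ?addr_ge0 //.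
rewrite cabs_sqr sqrrD !real_normK ?num_real // -addrA lerD2l lerDr.
by rewrite mulrn_wge0 // mulr_ge0.
Qed.

Lemma cReD z w : complex.Re (z + w) = complex.Re z + complex.Re w.
Proof. by case: z w => [a b] [c d]. Qed.
Lemma cImD z w : complex.Im (z + w) = complex.Im z + complex.Im w.
Proof. by case: z w => [a b] [c d]. Qed.
Lemma cReN z : complex.Re (- z) = - complex.Re z.
Proof. by case: z. Qed.
Lemma cImN z : complex.Im (- z) = - complex.Im z.
Proof. by case: z. Qed.
Lemma cReM z w : complex.Re (z * w) =
  complex.Re z * complex.Re w - complex.Im z * complex.Im w.
Proof. by case: z w => [a b] [c d]. Qed.
Lemma cImM z w : complex.Im (z * w) =
  complex.Re z * complex.Im w + complex.Im z * complex.Re w.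
Proof. by case: z w => [a b] [c d]. Qed.

Lemma complex_eq z w :
  complex.Re z = complex.Re w -> complex.Im z = complex.Im w -> z = w.
Proof. by case: z w => [a b] [c d] /= -> ->. Qed.

Lemma cabs_sum (I : Type) (s : seq I) (F : I -> R[i]) :
  cabs (\sum_(i <- s) F i) <= \sum_(i <- s) cabs (F i).
Proof.
elim/big_ind2: _ => //; first by rewrite cabs0.
move=> x1 x2 y1 y2 h1 h2.
by apply: le_trans (cabsD _ _) _; exact: lerD.
Qed.

Lemma cabs_cis (t : R) : cabs (cis t) = 1.
Proof.
by apply/eqP; rewrite -sqrp_eq1 ?cabs_ge0 // cabs_sqr /= cos2Dsin2.
Qed.

Lemma cisD (s t : R) : cis (s + t) = cis s * cis t.
Proof.
by apply: complex_eq; rewrite /= ?cosD ?sinD // addrC.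
Qed.

Lemma cis0 : cis (0 : R) = 1.
Proof. by rewrite /cis cos0 sin0. Qed.

(** Limits are replaced throughout by bounds c / (N + 1) valid for every N; such
    a bound with a fixed c is as good as a limit. *)
Lemma archi0 (x c : R) : (forall N : nat, x <= c / N.+1%:R) -> x <= 0.
Proof.
move=> h; rewrite leNgt; apply/negP => x0.
have c0 : 0 < c by have := h 0%N; rewrite divr1; apply: lt_le_trans.
have := h (Num.bound (c / x)); rewrite ler_pdivlMr ?ltr0n //.
apply/negP; rewrite -ltNge mulrC -ltr_pdivrMr //.
have := @Num.Theory.archi_boundP _ (c / x) (ltW (divr_gt0 c0 x0)).
by move=> hh; apply: lt_le_trans hh _; rewrite ler_nat leqnSn.
Qed.

Lemma eq_archi (z w : R[i]) (c : R) :
  (forall N : nat, cabs (z - w) <= c / N.+1%:R) -> z = w.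
Proof. by move=> /archi0 /cabs_eq0 /eqP; rewrite subr_eq0 => /eqP. Qed.

Lemma cauchy_lim (u : nat -> R) (c : R) :
  (forall n m : nat, (n <= m)%N -> `|u m - u n| <= c / n.+1%:R) -> cvgn u.
Proof.
move=> hu.
have c0 : 0 <= c by have := hu 0%N 0%N (leqnn _); rewrite divr1 subrr normr0.
apply: cauchy_cvg; apply/cauchy_ballP => e e0.
pose K := Num.bound (2 * c / e).
have hK : forall n, (K <= n)%N -> `|u n - u K| < e / 2.
  move=> n Kn; apply: le_lt_trans (hu _ _ Kn) _.
  rewrite ltr_pdivrMr ?ltr0n // mulrAC ltr_pdivlMr ?ltr0n //.
  rewrite -ltr_pdivrMl //.
  apply: (@lt_le_trans _ _ K%:R); last by rewrite ler_nat.
  have -> : e^-1 * (c * 2) = 2 * c / e by ring.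
  by apply: archi_boundP; rewrite divr_ge0 ?mulr_ge0 // ltW.
exists ([set x | exists2 n, (K <= n)%N & x = u n],
        [set x | exists2 n, (K <= n)%N & x = u n]) => /=.
  by split; exists K => // n /= Kn; exists n.
move=> [x y] /= [[n Kn ->] [m Km ->]].
rewrite /ball /=.
have -> : u n - u m = (u n - u K) - (u m - u K) by ring.
apply: le_lt_trans (ler_normB _ _) _; rewrite (splitr e).
by apply: ltrD; apply: hK.
Qed.

Lemma cauchy_limP (u : nat -> R) (c : R) :
  (forall n m : nat, (n <= m)%N -> `|u m - u n| <= c / n.+1%:R) ->
  forall n, `|u n - limn u| <= c / n.+1%:R.
Proof.
move=> hu n; have cu := cauchy_lim hu.
apply/ler_addgt0Pr => e e0.
have /cvgrPdist_lt/(_ _ e0) [K _ hK] := cu.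
pose m := maxn n K.
have -> : u n - limn u = - (u m - u n) - (limn u - u m) by ring.
apply: le_trans (ler_normB _ _) _; rewrite normrN lerD //.
  by apply: hu; rewrite leq_maxl.
by apply/ltW/hK; rewrite /= leq_maxr.
Qed.

(** The sum over the integers takes limits of real and imaginary parts
    separately; each obeys the rate of the sequence, whence the factor 2. *)
Lemma ccauchy_lim (u : nat -> R[i]) (c : R) :
  (forall n m : nat, (n <= m)%N -> cabs (u m - u n) <= c / n.+1%:R) ->
  forall n, cabs (u n - (limn (fun n => complex.Re (u n)) +i*
                         limn (fun n => complex.Im (u n)))) <= 2 * c / n.+1%:R.
Proof.
move=> hu n.
have h1 : `|complex.Re (u n) - limn (fun n => complex.Re (u n))|
   <= c / n.+1%:R.
  apply: (@cauchy_limP (fun n => complex.Re (u n)) c) => p q nm.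
  apply: le_trans (hu p q nm); rewrite -cReN -cReD; exact: normRe_le.
have h2 : `|complex.Im (u n) - limn (fun n => complex.Im (u n))|
   <= c / n.+1%:R.
  apply: (@cauchy_limP (fun n => complex.Im (u n)) c) => p q nm.
  apply: le_trans (hu p q nm); rewrite -cImN -cImD; exact: normIm_le.
apply: le_trans (cabs_le _) _.
rewrite cReD cImD cReN cImN /=.
have -> : 2 * c / n.+1%:R = c / n.+1%:R + c / n.+1%:R by ring.
exact: lerD.
Qed.
End Complex.

(** * Absolutely convergent sums over the integers *)

Section Sums.
Context {R : realType}.
Implicit Types (k l j : int) (N M : nat).

(** The Japanese bracket, in the form 1 + |k| instead of (1 + k^2)^(1/2). *)
Definition jap k : R := 1 + `|k%:~R|.
(** The model summable weight: every series and every matrix row below is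
    compared with a multiple of it. *)
Definition wt k : R := (jap k) ^- 2.

Lemma jap_ge1 k : 1 <= jap k.
Proof. by rewrite lerDl. Qed.
Lemma jap_gt0 k : 0 < jap k.
Proof. exact: lt_le_trans ltr01 (jap_ge1 k). Qed.
Lemma jap_ge0 k : 0 <= jap k.
Proof. exact/ltW/jap_gt0. Qed.
Lemma jap_neq0 k : jap k != 0.
Proof. exact/lt0r_neq0/jap_gt0. Qed.
Lemma japN k : jap (- k) = jap k.
Proof. by rewrite /jap mulrNz normrN. Qed.
Lemma japC k l : jap (k - l) = jap (l - k).
Proof. by rewrite -japN opprB. Qed.
Lemma japD k l : jap (k + l) <= jap k * jap l.
Proof.
rewrite /jap mulrDl mul1r mulrDr mulr1 -!addrA lerD2l.
rewrite intrD; apply: le_trans (ler_normD _ _) _.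
rewrite [leRHS]addrCA lerD2l lerDl; exact: mulr_ge0.
Qed.
Lemma jap_trans k l j : jap (k - j) <= jap (k - l) * jap (l - j).
Proof. by have := japD (k - l) (l - j); rewrite addrA subrK. Qed.

Lemma wt_gt0 k : 0 < wt k.
Proof. by rewrite /wt invr_gt0 exprn_gt0 // jap_gt0. Qed.
Lemma wt_ge0 k : 0 <= wt k.
Proof. exact/ltW/wt_gt0. Qed.
Lemma wtC k l : wt (k - l) = wt (l - k).
Proof. by rewrite /wt japC. Qed.
Lemma wtN k : wt (- k) = wt k.
Proof. by rewrite /wt japN. Qed.
Lemma wt_le1 k : wt k <= 1.
Proof. by rewrite /wt invf_le1 ?exprn_gt0 ?jap_gt0 // exprn_ege1 // jap_ge1. Qed.
Lemma wt_shift k l : wt (k - l) <= jap l ^+ 2 * wt k.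
Proof.
rewrite /wt -lef_pV2 ?posrE ?mulr_gt0 ?invr_gt0 ?exprn_gt0 ?jap_gt0 //.
rewrite invfM !invrK mulrC ler_pdivrMr ?exprn_gt0 ?jap_gt0 // -exprMn.
rewrite lerXn2r ?nnegrE ?mulr_ge0 ?jap_ge0 //.
by have := jap_trans k l 0; rewrite !subr0.
Qed.

Definition zrange N : seq int := [seq i%:Z - N%:Z | i <- iota 0 N.*2.+1].

Lemma sum_zrangeE (V : nmodType) (a : int -> V) N :
  \sum_(k <- zrange N) a k = \sum_(i < N.*2.+1) a (i%:Z - N%:Z).
Proof. by rewrite big_map -{1}[N.*2.+1]subn0 -/(index_iota _ _) big_mkord. Qed.

Lemma zrange_uniq N : uniq (zrange N).
Proof.
rewrite map_inj_uniq ?iota_uniq // => i j /eqP.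
by rewrite (inj_eq (addIr _)) => /eqP [].
Qed.

Lemma mem_zrange N k : (k \in zrange N) = (`|k|%N <= N)%N.
Proof.
apply/mapP/idP => [[i iN0 ->]|kN].
  move: iN0; rewrite mem_iota add0n /= => iN; lia.
exists (absz (k + N%:Z)%R); last by lia.
by rewrite mem_iota add0n /=; lia.
Qed.

Lemma sum_zrangeS (V : zmodType) (a : int -> V) N :
  \sum_(k <- zrange N.+1) a k =
  a (- N.+1%:Z) + \sum_(k <- zrange N) a k + a N.+1%:Z.
Proof.
rewrite !sum_zrangeE doubleS big_ord_recl big_ord_recr /= addrA.
congr (_ + _ + _); first by rewrite sub0r.
  by apply: eq_bigr => i _; congr a; rewrite /bump /=; lia.
by congr a; rewrite /bump /=; lia.
Qed.

(** A bounded increasing function on the integers; its increments are of the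
    size of wt, so that translates of wt can be summed by telescoping. *)
Definition squash k : R := k%:~R / jap k.

Lemma squash_le1 k : `|squash k| <= 1.
Proof.
rewrite /squash normrM normfV (ger0_norm (jap_ge0 k)).
by rewrite ler_pdivrMr ?jap_gt0 // mul1r lerDr.
Qed.

(** The increment is 1 / ((1 + |k|)(2 + |k|)) for k >= 0 and 1 / ((1 + |k|)|k|)
    for k < 0. *)
Lemma wt_le_squash k : wt k <= 2 * (squash (k + 1) - squash k).
Proof.
rewrite /wt /squash /jap intrD; set x : R := k%:~R.
have [x0|x0] : 0 <= x \/ x <= -1.
  have [k0|k0] := leP 0 k; [left|right].
    by rewrite /x ler0z.
  by rewrite /x -[-1 in X in _ <= X]/((-1)%:~R) ler_int; lia.
- rewrite !ger0_norm ?addr_ge0 //.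
  have -> : (x + 1%:~R) / (1 + (x + 1%:~R)) - x / (1 + x) =
     ((1 + x) * (2 + x))^-1 by field; rewrite !lt0r_neq0 //; lra.
  rewrite -[2 in leRHS]invrK -invfM lef_pV2 ?posrE; first [nra
    | by rewrite exprn_gt0 //; lra | by rewrite !mulr_gt0 //; lra].
- rewrite !ler0_norm ?addr_ge0 //; try lra.
  have -> : (x + 1%:~R) / (1 - (x + 1%:~R)) - x / (1 - x) =
     ((1 - x) * (- x))^-1.
    field; rewrite -/x; apply/and3P; split; apply/eqP; lra.
  rewrite -[2 in leRHS]invrK -invfM lef_pV2 ?posrE; first [nra
    | by rewrite exprn_gt0 //; lra | by rewrite !mulr_gt0 //; lra].
Qed.

(** Telescoping gives a bound that does not see the translation l; this
    uniformity is what Schur's test needs. *)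
Lemma sum_wt_shift N l : \sum_(k <- zrange N) wt (k - l) <= 4.
Proof.
rewrite sum_zrangeE.
apply: (@le_trans _ _ (\sum_(i < N.*2.+1)
   2 * (squash (i.+1%:Z - N%:Z - l) - squash (i%:Z - N%:Z - l)))).
  apply: ler_sum => i _; apply: le_trans (wt_le_squash _) _.
  by rewrite le_eqVlt (_ : _ + 1 = i.+1%:Z - N%:Z - l) ?eqxx //; lia.
rewrite -mulr_sumr -(big_mkord predT
  (fun i => squash (i.+1%:Z - N%:Z - l) - squash (i%:Z - N%:Z - l))).
rewrite telescope_sumr //.
have := squash_le1 (N.*2.+1%:Z - N%:Z - l); have := squash_le1 (0%:Z - N%:Z - l).
by rewrite !ler_norml => /andP[h1 h2] /andP[h3 h4]; lra.
Qed.

Lemma sum_wt_shift' N l : \sum_(k <- zrange N) wt (l - k) <= 4.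
Proof. by under eq_bigr => k _ do rewrite wtC; exact: sum_wt_shift. Qed.

Lemma wt_nat N : wt N.+1%:Z <= N.+1%:R^-1 - N.+2%:R^-1.
Proof.
rewrite /wt /jap /= -[N.+1%:~R]/(N.+1%:R) ger0_norm ?ler0n //.
rewrite -[N.+2%:R]natr1; set x : R := N.+1%:R; have x0 : 0 < x by rewrite ltr0n.
have -> : x^-1 - (x + 1)^-1 = (x * (x + 1))^-1.
  by field; rewrite !lt0r_neq0 //; lra.
by rewrite lef_pV2 ?posrE ?exprn_gt0 ?mulr_gt0 //; first [nra | lra].
Qed.

Lemma sum_wt_tail N M : (N <= M)%N ->
  \sum_(k <- zrange M) wt k - \sum_(k <- zrange N) wt k
    <= 2 * (N.+1%:R^-1 - M.+1%:R^-1).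
Proof.
elim: M => [|M IH]; first by rewrite leqn0 => /eqP->; rewrite !subrr mulr0.
rewrite leq_eqVlt => /predU1P[->|]; first by rewrite !subrr mulr0.
rewrite ltnS => /IH h; rewrite sum_zrangeS wtN; move: h (wt_nat M).
move: (wt _) (\sum_(k <- zrange M) _) (\sum_(k <- zrange N) _) => x1 x2 x3.
move: (M.+1%:R^-1) (M.+2%:R^-1) (N.+1%:R^-1) => x4 x5 x6; lra.
Qed.
End Sums.

Section SumZ.
Context {R : realType}.
Implicit Types (a b : int -> R[i]) (C : R).

Definition psum (a : int -> R[i]) (N : nat) := \sum_(k <- zrange N) a k.

(** Domination by the model weight, the only form of absolute convergence that
    occurs. *)
Definition domw C a := forall k, cabs (a k) <= C * wt k.

Lemma domw_ge0 C a : domw C a -> 0 <= C.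
Proof.
by move=> /(_ 0); rewrite /wt /jap normr0 addr0 expr1n invr1 mulr1; apply/le_trans/cabs_ge0.
Qed.

Lemma psum_diff C a N M : domw C a -> (N <= M)%N ->
  cabs (psum a M - psum a N)
    <= C * (\sum_(k <- zrange M) wt k - \sum_(k <- zrange N) wt k).
Proof.
move=> ha; elim: M => [|M IH].
  by rewrite leqn0 => /eqP->; rewrite !subrr mulr0 cabs0.
rewrite leq_eqVlt => /predU1P[->|]; first by rewrite !subrr mulr0 cabs0.
rewrite ltnS => /IH h; rewrite /psum !sum_zrangeS -/(psum a M) -/(psum a N).
have -> : a (- M.+1%:Z) + psum a M + a M.+1 - psum a N =
  a (- M.+1%:Z) + a M.+1 + (psum a M - psum a N) by ring.
apply: le_trans (cabsD _ _) _.
apply: le_trans (lerD (cabsD _ _) h) _.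
by have := ha (- M.+1%:Z); have := ha M.+1; nra.
Qed.

Lemma psum_cauchy C a N M : domw C a -> (N <= M)%N ->
  cabs (psum a M - psum a N) <= 2 * C / N.+1%:R.
Proof.
move=> ha NM; apply: le_trans (psum_diff ha NM) _.
have C0 := domw_ge0 ha.
apply: le_trans (ler_wpM2l C0 (sum_wt_tail NM)) _.
have : 0 <= M.+1%:R^-1 :> R by rewrite invr_ge0.
by set x := M.+1%:R^-1; set y := N.+1%:R^-1; nra.
Qed.

(** Every series dominated by wt converges with rate 1 / N, at a speed that
    depends on the dominating constant only. *)
Lemma sumZ_tail C a N : domw C a -> cabs (psum a N - sumZ a) <= 4 * C / N.+1%:R.
Proof.
move=> ha; have := ccauchy_lim (fun n m => @psum_cauchy C a n m ha) N.
have e : psum a = fun n => \sum_(i < n.*2.+1) a (i%:Z - n%:Z).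
  by apply/funext => n; rewrite /psum sum_zrangeE.
by rewrite /sumZ e mulrA -natrM.
Qed.

Lemma sumZ_unique C c a s : domw C a ->
  (forall N : nat, cabs (psum a N - s) <= c / N.+1%:R) -> sumZ a = s.
Proof.
move=> ha hs; apply: (@eq_archi _ _ _ (c + 4 * C)) => N.
have -> : sumZ a - s = (psum a N - s) - (psum a N - sumZ a) by ring.
apply: le_trans (cabsB _ _) _; rewrite mulrDl; apply: lerD => //.
exact: sumZ_tail.
Qed.

Lemma domwD C D a b : domw C a -> domw D b -> domw (C + D) (fun k => a k + b k).
Proof.
by move=> ha hb k; apply: le_trans (cabsD _ _) _; rewrite mulrDl lerD.
Qed.

Lemma domwZ C (c : R[i]) a : domw C a -> domw (cabs c * C) (fun k => c * a k).
Proof. by move=> ha k; rewrite cabsM -mulrA ler_wpM2l ?cabs_ge0. Qed.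

Lemma domwN C a : domw C a -> domw C (fun k => - a k).
Proof. by move=> ha k; rewrite cabsN. Qed.

Lemma sumZD C D a b : domw C a -> domw D b ->
  sumZ (fun k => a k + b k) = sumZ a + sumZ b.
Proof.
move=> ha hb; apply: (@sumZ_unique _ (4 * C + 4 * D) _ _ (domwD ha hb)) => N.
rewrite /psum big_split /=.
rewrite opprD addrACA; apply: le_trans (cabsD _ _) _.
by rewrite mulrDl lerD //; exact: sumZ_tail.
Qed.

Lemma sumZZ C (c : R[i]) a : domw C a -> sumZ (fun k => c * a k) = c * sumZ a.
Proof.
move=> ha; apply: (@sumZ_unique _ (cabs c * (4 * C)) _ _ (domwZ c ha)) => N.
rewrite /psum -mulr_sumr -mulrBr cabsM -mulrA ler_wpM2l ?cabs_ge0 //.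
exact: sumZ_tail.
Qed.

Lemma sumZN C a : domw C a -> sumZ (fun k => - a k) = - sumZ a.
Proof.
move=> ha; have := sumZZ (-1) ha; rewrite mulN1r => <-; congr sumZ.
by apply/funext => k; rewrite mulN1r.
Qed.

Lemma sumZB C D a b : domw C a -> domw D b ->
  sumZ (fun k => a k - b k) = sumZ a - sumZ b.
Proof. by move=> ha hb; rewrite (sumZD ha (domwN hb)) (sumZN hb). Qed.

Lemma sumZ_fin a N : (forall k, (N < `|k|%N)%N -> a k = 0) -> sumZ a = psum a N.
Proof.
move=> h0.
have st M : (N <= M)%N -> psum a M = psum a N.
  elim: M => [|M IH]; first by rewrite leqn0 => /eqP->.
  rewrite leq_eqVlt => /predU1P[->//|]; rewrite ltnS => NM.
  rewrite /psum sum_zrangeS -/(psum a M) (IH NM) !h0 ?add0r ?addr0 //; lia.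
have [C hC] : exists C, domw C a.
  exists (\sum_(k <- zrange N) cabs (a k) / wt k) => k.
  have [kN|kN] := leqP `|k|%N N; last first.
    rewrite h0 // cabs0 mulr_ge0 ?wt_ge0 ?sumr_ge0 // => j _.
    by rewrite divr_ge0 ?wt_ge0 ?cabs_ge0.
  rewrite -ler_pdivrMr ?wt_gt0 // (big_rem k) ?mem_zrange //= lerDl sumr_ge0 // => j _.
  by rewrite divr_ge0 ?wt_ge0 ?cabs_ge0.
pose c := \sum_(M < N) cabs (psum a M - psum a N) * M.+1%:R.
apply: (@sumZ_unique _ c _ _ hC) => M; have [NM|MN] := leqP N M.
  rewrite st // subrr cabs0 divr_ge0 // sumr_ge0 // => j _.
  by rewrite mulr_ge0 ?cabs_ge0.
rewrite ler_pdivlMr ?ltr0n // /c (bigD1 (Ordinal MN)) //= lerDl sumr_ge0 // => j _.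
by rewrite mulr_ge0 ?cabs_ge0.
Qed.

Lemma sumZ_le C l a : (forall k, cabs (a k) <= C * wt (k - l)) ->
  cabs (sumZ a) <= 4 * C.
Proof.
move=> h; have C0 : 0 <= C.
  have := h l; rewrite subrr /wt /jap normr0 addr0 expr1n invr1 mulr1.
  exact/le_trans/cabs_ge0.
have hd : domw (C * jap l ^+ 2) a.
  move=> k; apply: le_trans (h k) _; rewrite -mulrA ler_wpM2l //.
  exact: wt_shift.
rewrite -subr_le0; apply: (@archi0 _ _ (4 * (C * jap l ^+ 2))) => N.
apply: le_trans (sumZ_tail N hd).
have : cabs (psum a N) <= 4 * C.
  apply: le_trans (cabs_sum _ _) _.
  apply: (@le_trans _ _ (\sum_(k <- zrange N) C * wt (k - l))).
    by apply: ler_sum => k _.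
  by rewrite -mulr_sumr mulrC ler_wpM2r // sum_wt_shift.
have := cabsB (psum a N) (psum a N - sumZ a); rewrite opprB addrC subrK.
by move=> h1 h2; lra.
Qed.

Lemma sumZ_le_dom C a : domw C a -> cabs (sumZ a) <= 4 * C.
Proof. by move=> h; apply: (@sumZ_le _ 0) => k; rewrite subr0. Qed.

Lemma psum_le_dom C a N : domw C a -> cabs (psum a N) <= 4 * C.
Proof.
move=> h; apply: le_trans (cabs_sum _ _) _.
apply: (@le_trans _ _ (\sum_(k <- zrange N) C * wt (k - 0))).
  by apply: ler_sum => k _; rewrite subr0.
by rewrite -mulr_sumr mulrC ler_wpM2r ?(domw_ge0 h) // sum_wt_shift.
Qed.

(** Both iterated sums are within O(1 / N) of the same finite double sum over a
    square, where the order of summation does not matter. *)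
Lemma fubiniZ C (x : int -> int -> R[i]) :
  (forall j k, cabs (x j k) <= C * wt j * wt k) ->
  sumZ (fun j => sumZ (x j)) = sumZ (fun k => sumZ (x^~ k)).
Proof.
have half (y : int -> int -> R[i]) N :
  (forall j k, cabs (y j k) <= C * wt j * wt k) ->
  cabs (psum (fun j => psum (y j) N) N - sumZ (fun j => sumZ (y j)))
    <= 32 * C / N.+1%:R.
  move=> hy; have C0 : 0 <= C.
    have := hy 0 0; rewrite /wt /jap normr0 addr0 expr1n invr1 !mulr1.
    exact/le_trans/cabs_ge0.
  have d1 : domw (4 * C) (fun j => sumZ (y j)).
    by move=> j; rewrite -mulrA; apply: sumZ_le_dom => k; exact: hy.
  have h1 := sumZ_tail N d1.
  have h2 : cabs (psum (fun j => psum (y j) N) N - psum (fun j => sumZ (y j)) N)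
      <= 4 * (4 * C / N.+1%:R).
    rewrite /psum -sumrB; apply: psum_le_dom => j.
    rewrite mulrAC -(mulrA 4); apply: sumZ_tail => k; exact: hy.
  rewrite -[X in cabs X](subrKA (psum (fun j => sumZ (y j)) N)).
  apply: le_trans (cabsD _ _) _.
  by apply: le_trans (lerD h2 h1) _; move: (N.+1%:R^-1) => t; lra.
move=> hx; apply: (@eq_archi _ _ _ (64 * C)) => N.
have h1 := half x N hx.
have h2 : cabs (psum (fun j => psum (x^~ j) N) N - sumZ (fun k => sumZ (x^~ k)))
    <= 32 * C / N.+1%:R.
  by apply: (half (fun k j => x j k)) => j k; rewrite mulrAC.
have e : psum (fun j => psum (x j) N) N = psum (fun k => psum (x^~ k) N) N.
  by rewrite /psum exchange_big.
rewrite -e in h2.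
rewrite -[X in cabs X](subrKA (psum (fun j => psum (x j) N) N)) addrC.
apply: le_trans (cabsD _ _) _; rewrite [X in _ + X]cabsC.
by apply: le_trans (lerD h2 h1) _; move: (N.+1%:R^-1) => t; lra.
Qed.
End SumZ.

(** * Square-summable sequences and kernels of convolution type *)

Section Kernels.
Context {R : realType}.
Implicit Types (g v : int -> R[i]) (A P Q : int -> int -> R[i]) (B C : R).

(** The square-summable sequences, with an explicit bound on the squared norm;
    the sum is never formed. *)
Definition l2_le B g := forall N, \sum_(k <- zrange N) cabs (g k) ^+ 2 <= B.

Lemma l2_le_coef B g k : l2_le B g -> cabs (g k) ^+ 2 <= B.
Proof.
move=> /(_ `|k|%N); apply: le_trans.
by rewrite (big_rem k) ?mem_zrange //= lerDl sumr_ge0 // => j _; rewrite sqr_ge0.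
Qed.

Lemma l2_le_ge0 B g : l2_le B g -> 0 <= B.
Proof. by move=> /(l2_le_coef 0); apply/le_trans/sqr_ge0. Qed.

Lemma l2_le_bounded B g k : l2_le B g -> cabs (g k) <= 1 + B.
Proof. by move=> /(l2_le_coef k) h; have := cabs_ge0 (g k); nra. Qed.

Lemma cabsD_sqr (x y : R[i]) :
  cabs (x + y) ^+ 2 <= 2 * cabs x ^+ 2 + 2 * cabs y ^+ 2.
Proof.
have := cabsD x y; have := cabs_ge0 (x + y).
have := cabs_ge0 x; have := cabs_ge0 y.
move: (cabs _) (cabs x) (cabs y) => a b c *.
have : a ^+ 2 <= (b + c) ^+ 2 by rewrite lerXn2r ?nnegrE ?addr_ge0.
have := sqr_ge0 (b - c); rewrite sqrrB sqrrD !mulr2n; lra.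
Qed.

Lemma l2_leD B C f g : l2_le B f -> l2_le C g ->
  l2_le (2 * B + 2 * C) (fun k => f k + g k).
Proof.
move=> hf hg N; apply: (@le_trans _ _ (\sum_(k <- zrange N)
  (2 * cabs (f k) ^+ 2 + 2 * cabs (g k) ^+ 2))).
  by apply: ler_sum => k _; exact: cabsD_sqr.
by rewrite big_split /= -!mulr_sumr lerD // ler_wpM2l.
Qed.

Lemma l2_leN B g : l2_le B g -> l2_le B (fun k => - g k).
Proof. by move=> h N; under eq_bigr do rewrite cabsN. Qed.

Lemma l2_le_le B f g : (forall k, cabs (f k) <= cabs (g k)) -> l2_le B g -> l2_le B f.
Proof.
move=> h hg N; apply: le_trans (hg N); apply: ler_sum => k _.
by rewrite lerXn2r ?nnegrE ?cabs_ge0.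
Qed.

Lemma l2_leZ B (c : R) f g : 0 <= c -> (forall k, cabs (f k) <= c * cabs (g k)) ->
  l2_le B g -> l2_le (c ^+ 2 * B) f.
Proof.
move=> c0 h hg N; apply: le_trans (ler_wpM2l (sqr_ge0 c) (hg N)).
rewrite mulr_sumr; apply: ler_sum => k _; rewrite -exprMn.
by rewrite lerXn2r ?nnegrE ?mulr_ge0 ?cabs_ge0.
Qed.

(** The factor 2 comes from |g|^2 <= 2 |gn|^2 + 2 |g - gn|^2, which avoids
    passing to the limit in the squares.  Partial sums of the n-th
    approximation are needed up to n only, since n may be taken large. *)
Lemma l2_le_lim B (c : int -> R) (gn : nat -> int -> R[i]) g :
  (forall n N, (N <= n)%N -> \sum_(k <- zrange N) cabs (gn n k) ^+ 2 <= B) ->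
  (forall n k, cabs (gn n k - g k) <= c k / n.+1%:R) -> l2_le (2 * B) g.
Proof.
move=> hB hc N; rewrite -subr_le0.
apply: (@archi0 _ _ (\sum_(k <- zrange N) 2 * N.+1%:R * c k ^+ 2)) => n0.
pose n := maxn n0 N; have nN : (N <= n)%N by rewrite leq_maxr.
have hk k : cabs (g k) ^+ 2 <= 2 * cabs (gn n k) ^+ 2 + 2 * c k ^+ 2 / n0.+1%:R.
  have -> : g k = gn n k + (g k - gn n k) by ring.
  apply: le_trans (cabsD_sqr _ _) _; rewrite lerD2l -mulrA ler_wpM2l // cabsC.
  have c0 : 0 <= c k.
    by have := hc 0%N k; rewrite divr1; apply/le_trans/cabs_ge0.
  apply: (@le_trans _ _ ((c k / n.+1%:R) ^+ 2)).
    by rewrite lerXn2r ?nnegrE ?divr_ge0 ?cabs_ge0.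
  rewrite expr_div_n ler_wpM2l ?sqr_ge0 // lef_pV2 ?posrE ?exprn_gt0 ?ltr0n //.
  rewrite -natrX ler_nat; apply: (@leq_trans n.+1); first by rewrite ltnS leq_maxl.
  by rewrite -{1}(expn1 n.+1) leq_pexp2l.
rewrite lerBlDr mulr_suml.
apply: (@le_trans _ _ (\sum_(k <- zrange N)
   (2 * cabs (gn n k) ^+ 2 + 2 * c k ^+ 2 / n0.+1%:R))).
  by apply: ler_sum => k _.
rewrite big_split /= -mulr_sumr addrC lerD //.
  apply: ler_sum => k _; rewrite ler_wpM2r // ler_wpM2r ?sqr_ge0 //.
  by rewrite ler_peMr // ler1n.
by rewrite ler_wpM2l // hB.
Qed.

(** Matrices dominated by a summable convolution kernel: they act boundedly on
    bounded and on square-summable sequences. *)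
Definition conv_kernel C A := forall l k, cabs (A l k) <= C * wt (l - k).
Definition kapp A g : int -> R[i] := fun l => sumZ (fun k => A l k * g k).

Lemma wt_rowshift l k : wt (l - k) <= jap l ^+ 2 * wt k :> R.
Proof. by rewrite wtC wt_shift. Qed.

Lemma row_dom C M l (a : int -> R[i]) g :
  (forall k, cabs (a k) <= C * wt (l - k)) -> (forall k, cabs (g k) <= M) ->
  domw (C * M * jap l ^+ 2) (fun k => a k * g k).
Proof.
move=> ha hg k; rewrite cabsM -mulrA.
have M0 : 0 <= M by apply: le_trans (hg 0); exact: cabs_ge0.
have C0 : 0 <= C.
  by have := ha l; rewrite subrr /wt /jap normr0 addr0 expr1n invr1 mulr1; apply/le_trans/cabs_ge0.
apply: (@le_trans _ _ (C * wt (l - k) * M)).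
  by apply: ler_pM; rewrite ?cabs_ge0.
by rewrite mulrAC ler_wpM2l ?mulr_ge0 // wt_rowshift.
Qed.

Lemma row_le C M l (a : int -> R[i]) g :
  (forall k, cabs (a k) <= C * wt (l - k)) -> (forall k, cabs (g k) <= M) ->
  cabs (sumZ (fun k => a k * g k)) <= 4 * C * M.
Proof.
move=> ha hg; rewrite -mulrA; apply: (@sumZ_le _ _ l) => k.
rewrite cabsM mulrAC wtC; apply: ler_pM; rewrite ?cabs_ge0 //.
Qed.

(** Expand sum_i w_i (x_i - T / 4)^2 >= 0, where T is the weighted sum. *)
Lemma weighted_CS (I : Type) (s : seq I) (w x : I -> R) :
  (forall i, 0 <= w i) -> \sum_(i <- s) w i <= 4 ->
  (\sum_(i <- s) w i * x i) ^+ 2 <= 4 * \sum_(i <- s) w i * x i ^+ 2.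
Proof.
move=> w0 w4; set T := \sum_(i <- s) w i * x i.
have : 0 <= \sum_(i <- s) w i * (x i - T / 4) ^+ 2.
  by apply: sumr_ge0 => i _; rewrite mulr_ge0 ?sqr_ge0.
have -> : \sum_(i <- s) w i * (x i - T / 4) ^+ 2 =
  \sum_(i <- s) w i * x i ^+ 2 - T / 2 * T + T ^+ 2 / 16 * \sum_(i <- s) w i.
  rewrite {3}/T !mulr_sumr -sumrB -big_split /=; apply: eq_bigr => i _. by field.
by have := sqr_ge0 T; nra.
Qed.

(** Schur's test: the rows and the columns of wt (l - k) have sum at most 4.
    One factor 4 comes from Cauchy-Schwarz in each row, the other from
    summing over the columns, and the 2 from the limit of partial sums. *)
Lemma schur C A B g : conv_kernel C A -> l2_le B g -> l2_le (2 * (16 * C ^+ 2 * B)) (kapp A g).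
Proof.
move=> hA hg.
have C0 : 0 <= C.
  by have := hA 0 0; rewrite subrr /wt /jap normr0 addr0 expr1n invr1 mulr1; apply/le_trans/cabs_ge0.
have hd l : domw (C * (1 + B) * jap l ^+ 2) (fun k => A l k * g k).
  by apply: row_dom => [k|k]; [exact: hA|exact: l2_le_bounded].
apply: (@l2_le_lim _ (fun l => 4 * (C * (1 + B) * jap l ^+ 2))
  (fun n l => psum (fun k => A l k * g k) n)); last first.
  by move=> n l; exact: sumZ_tail.
move=> n N Nn.
apply: (@le_trans _ _ (\sum_(l <- zrange N)
   C ^+ 2 * (4 * \sum_(k <- zrange n) wt (l - k) * cabs (g k) ^+ 2))).
  apply: ler_sum => l _.
  have : cabs (psum (fun k => A l k * g k) n) <=
     C * \sum_(k <- zrange n) wt (l - k) * cabs (g k).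
    apply: le_trans (cabs_sum _ _) _; rewrite mulr_sumr; apply: ler_sum => k _.
    by rewrite cabsM mulrA ler_wpM2r ?cabs_ge0.
  move=> h; apply: (@le_trans _ _ ((C * \sum_(k <- zrange n) wt (l - k) * cabs (g k)) ^+ 2)).
    rewrite lerXn2r ?nnegrE ?cabs_ge0 ?mulr_ge0 ?sumr_ge0 // => k _.
    by rewrite mulr_ge0 ?wt_ge0 ?cabs_ge0.
  rewrite exprMn ler_wpM2l ?sqr_ge0 // weighted_CS ?sum_wt_shift' // => k.
  exact: wt_ge0.
rewrite -!mulr_sumr exchange_big /=.
have h : \sum_(k <- zrange n) \sum_(l <- zrange N) wt (l - k) * cabs (g k) ^+ 2 <= 4 * B.
  apply: (@le_trans _ _ (\sum_(k <- zrange n) 4 * cabs (g k) ^+ 2)).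
    by apply: ler_sum => k _; rewrite -mulr_suml ler_wpM2r ?sqr_ge0 // sum_wt_shift.
  by rewrite -mulr_sumr ler_wpM2l.
apply: (@le_trans _ _ (C ^+ 2 * (4 * (4 * B)))).
  by rewrite ler_wpM2l ?sqr_ge0 // ler_wpM2l.
by rewrite le_eqVlt; apply/orP; left; apply/eqP; ring.
Qed.

(** Associativity, by exchanging the two sums.  The square on wt (l - j) leaves
    one factor to sum over j after the other has been used to bring wt (j -
    k) back to wt k. *)
Lemma kapp_comp C (c : int -> R) M P Q v :
  (forall l j k, cabs (P l j * Q j k) <= C * wt (l - j) ^+ 2 * wt (j - k)) ->
  (forall j k, cabs (Q j k) <= c j * wt (j - k)) ->
  (forall k, cabs (v k) <= M) ->
  forall l, kapp P (kapp Q v) l = kapp (fun l k => sumZ (fun j => P l j * Q j k)) v l.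
Proof.
move=> hPQ hQ hv l; rewrite /kapp.
have M0 : 0 <= M by apply: le_trans (hv 0); exact: cabs_ge0.
have C0 : 0 <= C.
  by have := hPQ 0 0 0; rewrite !subrr /wt /jap normr0 addr0 expr1n invr1 expr1n !mulr1; apply/le_trans/cabs_ge0.
have hjk j k : wt (l - j) ^+ 2 * wt (j - k) <= jap l ^+ 4 * wt j * wt k :> R.
  apply: (@le_trans _ _ ((jap l ^+ 2 * wt j) ^+ 2 * (jap j ^+ 2 * wt k))).
    apply: ler_pM; rewrite ?exprn_ge0 ?wt_ge0 //; last exact: wt_rowshift.
    by rewrite lerXn2r ?nnegrE ?mulr_ge0 ?exprn_ge0 ?jap_ge0 ?wt_ge0 // wt_rowshift.
  rewrite le_eqVlt; apply/orP; left; apply/eqP.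
  rewrite /wt; field; rewrite ?jap_neq0 //.
transitivity (sumZ (fun j => sumZ (fun k => P l j * (Q j k * v k)))).
  congr sumZ; apply/funext => j.
  by rewrite (sumZZ _ (row_dom (hQ j) hv)).
transitivity (sumZ (fun k => sumZ (fun j => P l j * (Q j k * v k)))).
  apply: (@fubiniZ _ (C * jap l ^+ 4 * M) (fun j k => P l j * (Q j k * v k))) => j k.
  rewrite mulrA cabsM; apply: (@le_trans _ _ (C * wt (l - j) ^+ 2 * wt (j - k) * M)).
    by apply: ler_pM; rewrite ?cabs_ge0.
  rewrite -(mulrA C); apply: (@le_trans _ _ (C * (jap l ^+ 4 * wt j * wt k) * M)).
    by rewrite ler_wpM2r // ler_wpM2l.
  by rewrite le_eqVlt; apply/orP; left; apply/eqP; ring.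
congr sumZ; apply/funext => k.
have hd : domw (C * jap l ^+ 4) (fun j => P l j * Q j k).
  move=> j; apply: le_trans (hPQ _ _ _) _; rewrite -mulrA.
  apply: (@le_trans _ _ (C * (jap l ^+ 4 * wt j * wt k))); first by rewrite ler_wpM2l.
  rewrite !mulrA ler_piMr ?wt_le1 // !mulr_ge0 ?wt_ge0 ?exprn_ge0 ?jap_ge0 //.
under eq_fun => j do rewrite mulrA mulrC.
by rewrite (sumZZ _ hd) mulrC.
Qed.

Lemma pow2_archi (n : nat) : (2%:R ^+ n)^-1 <= n.+1%:R^-1 :> R.
Proof.
by rewrite lef_pV2 ?posrE ?exprn_gt0 ?ltr0n // -natrX ler_nat ltn_expl.
Qed.

(** The equation v = - A v halves any uniform bound on v, since A has norm at
    most 1/2 on bounded sequences. *)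
Lemma small_kernel_inj C A M v : conv_kernel C A -> C <= 8%:R^-1 ->
  (forall k, cabs (v k) <= M) -> (forall l, v l + kapp A v l = 0) ->
  forall k, v k = 0.
Proof.
move=> hA C8 hv h.
have hn n k : cabs (v k) <= M / 2 ^+ n.
  elim: n k => [|n IH] k; first by rewrite expr0 divr1.
  have /eqP := h k; rewrite addr_eq0 => /eqP ->; rewrite cabsN.
  apply: le_trans (row_le (hA k) IH) _.
  have : 0 <= M / 2 ^+ n by apply: le_trans (IH 0); exact: cabs_ge0.
  rewrite exprSr invfM (mulrA M); move: (M / 2 ^+ n) => x x0; nra.
move=> k; apply: cabs_eq0; apply: (@archi0 _ _ M) => N.
apply: le_trans (hn N k) _; rewrite ler_wpM2l ?pow2_archi //.
by apply: le_trans (hv 0); exact: cabs_ge0.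
Qed.

(** Iterating v := f - A v converges uniformly and geometrically.  Schur's test
    keeps the squared norms of the iterates below 4 B, and the bound passes
    to the limit. *)
Lemma small_kernel_solve C A B f : conv_kernel C A -> C <= 16%:R^-1 -> l2_le B f ->
  exists2 v, l2_le (8 * B) v & forall l, v l + kapp A v l = f l.
Proof.
move=> hA C16 hf.
have C0 : 0 <= C.
  by have := hA 0 0; rewrite subrr /wt /jap normr0 addr0 expr1n invr1 mulr1; apply/le_trans/cabs_ge0.
have B0 := l2_le_ge0 hf.
have CC : C ^+ 2 * B <= 256%:R^-1 * B.
  by rewrite ler_wpM2r //; have := C16; nra.
pose vs := fix vs n := if n is n'.+1 then (fun l => f l - kapp A (vs n') l) else f.
have hl2 n : l2_le (4 * B) (vs n).
  elim: n => [|n IH]; first by move=> N; apply: le_trans (hf N) _; rewrite ler_peMl // ler1n.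
  move=> N; apply: le_trans (l2_leD hf (l2_leN (schur hA IH)) N) _; nra.
pose M := 1 + 4 * B.
have hvM n k : cabs (vs n k) <= M by exact: l2_le_bounded.
have appB u w M' : (forall k, cabs (u k) <= M) -> (forall k, cabs (w k) <= M) ->
    (forall k, cabs (u k - w k) <= M') ->
    forall l, cabs (kapp A u l - kapp A w l) <= 4 * C * M'.
  move=> hu hw huw l; rewrite /kapp.
  rewrite -(sumZB (row_dom (hA l) hu) (row_dom (hA l) hw)).
  under eq_fun => k do rewrite -mulrBr.
  exact: row_le.
have M0 : 0 <= M by rewrite /M; lra.
have step n k : cabs (vs n.+1 k - vs n k) <= M / 2 ^+ n.+1.
  elim: n k => [|n IH] k.
    rewrite /= addrAC subrr add0r cabsN expr1.
    by apply: le_trans (row_le (hA k) (hvM 0%N)) _; nra.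
  rewrite [vs n.+2]/= [in X in _ - X]/= opprD addrACA subrr add0r opprK addrC.
  apply: le_trans (appB (vs n) (vs n.+1) (M / 2 ^+ n.+1) _ _ _ k) _ => //.
    by move=> j; rewrite cabsC.
  rewrite [in leRHS]exprSr invfM (mulrA M).
  have : 0 <= M / 2 ^+ n.+1 by rewrite divr_ge0 // exprn_ge0.
  move: (M / _) => x; nra.
have cau k n m : (n <= m)%N -> cabs (vs m k - vs n k) <= M / n.+1%:R.
  move=> nm; have : cabs (vs m k - vs n k) <= M * ((2 ^+ n)^-1 - (2 ^+ m)^-1).
    elim: m nm => [|m IH]; first by rewrite leqn0 => /eqP->; rewrite !subrr mulr0 cabs0.
    rewrite leq_eqVlt => /predU1P[->|]; first by rewrite !subrr mulr0 cabs0.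
    rewrite ltnS => /IH h; rewrite -(subrKA (vs m k)) addrC.
    apply: le_trans (cabsD _ _) _; rewrite addrC.
    apply: le_trans (lerD (step m k) h) _; rewrite exprSr invfM.
    by move: ((2 ^+ m)^-1) ((2 ^+ n)^-1) => x y; lra.
  move=> h; apply: le_trans h _; rewrite ler_wpM2l //.
  apply: le_trans (pow2_archi n); rewrite lerBlDr lerDl invr_ge0.
  by rewrite exprn_ge0.
pose v k := limn (fun n => complex.Re (vs n k)) +i* limn (fun n => complex.Im (vs n k)).
have hlim n k : cabs (vs n k - v k) <= 2 * M / n.+1%:R.
  exact: (ccauchy_lim (cau k)).
have hvl2 : l2_le (2 * (4 * B)) v.
  apply: (@l2_le_lim _ (fun=> 2 * M) vs) => // n N _; exact: hl2.
exists v; first by move=> N; rewrite (_ : 8 * B = 2 * (4 * B)) //; ring.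
pose M2 := 1 + 2 * (4 * B).
have hv2 k : cabs (v k) <= M2 by exact: l2_le_bounded.
move=> l; apply: (@eq_archi _ _ _ (4 * M)) => n.
have -> : v l + kapp A v l - f l =
   (kapp A v l - kapp A (vs n) l) - (vs n.+1 l - v l) by rewrite /=; ring.
apply: le_trans (cabsB _ _) _.
have h1 : cabs (vs n.+1 l - v l) <= 2 * M / n.+1%:R.
  apply: le_trans (hlim _ _) _; rewrite ler_wpM2l ?mulr_ge0 //.
  by rewrite lef_pV2 ?posrE ?ltr0n // ler_nat.
have h2 : cabs (kapp A v l - kapp A (vs n) l) <= 4 * C * (2 * M / n.+1%:R).
  rewrite /kapp -(sumZB (row_dom (hA l) hv2) (row_dom (hA l) (hvM n))).
  under eq_fun => k do rewrite -mulrBr.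
  by apply: row_le (hA l) _ => k; rewrite cabsC.
apply: le_trans (lerD h2 h1) _.
have : 0 <= M / n.+1%:R by rewrite divr_ge0.
rewrite -!(mulrA _ M); move: (M / _) => x x0; nra.
Qed.
End Kernels.

(** * Weights satisfying Peetre's inequality *)

Section Peetre.
Context {R : realType}.
Implicit Types (W V : int -> R) (K C : R) (M : nat).

(** Peetre's inequality: the weight varies at most polynomially under
    translation. *)
Definition peetre K M W := forall k j, W k <= K * W j * jap (k - j) ^+ M.

Lemma peetre_ge1 K M W : (forall k, 0 < W k) -> peetre K M W -> 1 <= K.
Proof.
move=> W0 /(_ 0 0); rewrite subrr /jap normr0 addr0 expr1n mulr1.
by rewrite -{1}(mul1r (W 0)) ler_pM2r.
Qed.

Lemma peetreW K M K' M' W : (forall k, 0 < W k) -> K <= K' -> (M <= M')%N ->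
  peetre K M W -> peetre K' M' W.
Proof.
move=> W0 KK MM h k j; apply: le_trans (h k j) _.
have K1 := peetre_ge1 W0 h; have K0 : 0 <= K by lra.
have Wj := ltW (W0 j).
apply: ler_pM; rewrite ?mulr_ge0 ?exprn_ge0 ?jap_ge0 //.
  by rewrite ler_wpM2r.
by rewrite ler_weXn2l // jap_ge1.
Qed.

Lemma peetreM K M K' M' W V : (forall k, 0 < W k) -> (forall k, 0 < V k) ->
  peetre K M W -> peetre K' M' V -> peetre (K * K') (M + M') (fun k => W k * V k).
Proof.
move=> W0 V0 hW hV k j; apply: le_trans (ler_pM _ _ (hW k j) (hV k j)) _; try exact: ltW.
by rewrite exprD le_eqVlt; apply/orP; left; apply/eqP; ring.
Qed.

Lemma peetreV K M W : (forall k, 0 < W k) ->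
  peetre K M W -> peetre K M (fun k => (W k)^-1).
Proof.
move=> W0 h k j; have Wk := W0 k; have Wj := W0 j.
rewrite -(ler_pM2r Wk) mulVf ?gt_eqF // -(ler_pM2r Wj) mul1r.
apply: le_trans (h j k) _; rewrite japC le_eqVlt; apply/orP; left; apply/eqP.
by field; rewrite gt_eqF.
Qed.

Lemma peetreD_cst K M W (c : R) : (forall k, 0 < W k) -> 0 <= c ->
  peetre K M W -> peetre K M (fun k => W k + c).
Proof.
move=> W0 c0 h k j; have K1 := peetre_ge1 W0 h.
rewrite mulrDr mulrDl lerD //.
have : 1 <= K * jap (k - j) ^+ M.
  by rewrite mulr_ege1 // exprn_ege1 // jap_ge1.
by rewrite mulrAC; move=> h1; rewrite ler_peMl.
Qed.

Lemma peetre_pow K M W (s : R) : (forall k, 0 < W k) ->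
  peetre K M W -> exists K' M', peetre K' M' (fun k => W k `^ s).
Proof.
move=> W0.
wlog s0 : s / 0 <= s.
  move=> H h; have [s0|s0] := leP 0 s; first exact: H.
  have [|K' [M' h']] := H (- s) _ h; first by rewrite oppr_ge0 ltW.
  exists K', M' => k j; have := peetreV (fun k => powR_gt0 (- s) (W0 k)) h' k j.
  by rewrite -!powRN opprK.
move=> h; have K1 := peetre_ge1 W0 h; have K0 : 0 <= K by lra.
have Wj k := ltW (W0 k).
(* The exponent has to be an integer again, so the real power of the bracket
   is rounded up. *)
pose M' := Num.bound (M%:R * s).
exists (K `^ s), M' => k j.
apply: (@le_trans _ _ ((K * W j * jap (k - j) ^+ M) `^ s)).
  by rewrite ge0_ler_powR ?nnegrE // ?mulr_ge0 ?exprn_ge0 ?jap_ge0.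
rewrite !powRM ?mulr_ge0 ?exprn_ge0 ?jap_ge0 //.
rewrite ler_wpM2l ?mulr_ge0 ?powR_ge0 //.
rewrite -powR_mulrn ?jap_ge0 // -powRrM -powR_mulrn ?jap_ge0 //.
apply: ler_powR; first exact: jap_ge1.
by apply/ltW/archi_boundP; rewrite mulr_ge0.
Qed.

(** Keep one term of the factorization of x^(n+1) - y^(n+1).  It turns a bound
    on the increments of a power into one on those of the root. *)
Lemma subrXX_ge (x y : R) n : 0 <= x -> 0 <= y ->
  `|x - y| * y ^+ n <= `|x ^+ n.+1 - y ^+ n.+1|.
Proof.
move=> x0 y0; rewrite subrXX normrM ler_wpM2l //.
apply: le_trans (ler_norm _); rewrite (bigD1 ord_max) //= ?subSS subnn expr0 mul1r.
by rewrite lerDl sumr_ge0 // => i _; rewrite mulr_ge0 ?exprn_ge0.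
Qed.

Lemma weight_lower mu (Lam : int -> R) : weight_function mu Lam ->
  exists2 c, 0 < c & forall k, c <= Lam k.
Proof.
move=> [_ [mu0 [mu1 [C0 [C1 [[h1 h2 h3 h4] h5 _ _]]]]]].
exists C0 => // k; have /andP[h _] := h5 k; apply: le_trans h.
rewrite ler_peMr ?(ltW h3) // -[leLHS](powRr0 (1 + `|k%:~R|)).
by apply: ler_powR (ltW h1); exact: jap_ge1.
Qed.

Lemma int_lip (L : int -> R) C : 0 <= C ->
  (forall k, `|L (k + 1) - L k| <= C) -> forall k j, `|L k - L j| <= C * `|(k - j)%:~R|.
Proof.
move=> C0 h.
have hn n j : `|L (j + n%:Z) - L j| <= C * n%:R.
  elim: n => [|n IH]; first by rewrite addr0 subrr normr0 mulr0.
  have -> : j + n.+1%:Z = j + n%:Z + 1 by lia.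
  rewrite -(subrKA (L (j + n%:Z))).
  apply: le_trans (ler_normD _ _) _; rewrite -natr1 mulrDr mulr1 addrC.
  by apply: lerD => //; exact: h.
move=> k j; have [jk|kj] := leP j k.
  have -> : k = j + `|k - j|%N%:Z by lia.
  by rewrite addrAC subrr add0r normr_nat.
have -> : j = k + `|j - k|%N%:Z by lia.
by rewrite distrC opprD addNKr rmorphN normrN normr_nat.
Qed.

(** Take an integer q >= mu.  The hypothesis |Lam (k + 1) - Lam k| <= C Lam^(1 -
    1/mu) makes the increments of L = Lam^(1/q) bounded, so L is Lipschitz
    with some constant C'; as L is bounded below by some d > 0, L k <= (1 +
    C'/d) L j (1 + |k - j|), and the q-th power of this is Peetre's
    inequality. *)
Lemma weight_peetre mu (Lam : int -> R) : weight_function mu Lam ->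
  exists K M, peetre K M Lam.
Proof.
move=> hw; have [c c0 hc] := weight_lower hw.
case: hw => L0 [mu0 [mu1 [C0 [C1 [[h1 h2 h3 h4] h5 hmu1 hder]]]]].
have mu_gt0 : 0 < mu by apply: lt_le_trans hmu1; exact: lt_le_trans h2.
have [C Cgt0 hC] := hder 1%N 0%N isT.
(* The exponent q is an integer so that the factorization of a difference of
   powers applies. *)
pose n := Num.bound mu; pose q : R := n.+1%:R.
have q0 : 0 < q by rewrite ltr0n.
have muq : mu <= q.
  apply: le_trans (ltW (archi_boundP (ltW mu_gt0))) _; by rewrite ler_nat.
pose L k := Lam k `^ q^-1.
have Lpos k : 0 < L k by exact: powR_gt0.
have LX k : L k ^+ n.+1 = Lam k.
  by rewrite -powR_mulrn ?powR_ge0 // -powRrM mulVf ?gt_eqF // powRr1 // ltW.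
have LXn k : L k ^+ n = Lam k `^ (1 - q^-1).
  rewrite -powR_mulrn ?powR_ge0 // -powRrM; congr (_ `^ _).
  by rewrite /q; field; rewrite -/q gt_eqF.
pose C' := C * c `^ (q^-1 - mu^-1).
have hL k : `|L (k + 1) - L k| <= C'.
  have : `|L (k + 1) - L k| * L k ^+ n <= C' * L k ^+ n.
    apply: le_trans (subrXX_ge n (ltW (Lpos _)) (ltW (Lpos _))) _.
    have := hC k; rewrite expr0 mul1r /= /fdiff !LX => h; apply: le_trans h _.
    rewrite /C' -mulrA (ler_wpM2l (ltW Cgt0)) // LXn [leRHS]mulrC.
    have -> : 1 - 1%:R / mu = (1 - q^-1) + (q^-1 - mu^-1) by ring.
    rewrite powRD; last by rewrite (gt_eqF (L0 k)) implybT.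
    rewrite ler_wpM2l ?powR_ge0 //.
    have e0 : 0 <= mu^-1 - q^-1 by rewrite subr_ge0 lef_pV2.
    rewrite -[q^-1 - mu^-1]opprB !powRN lef_pV2 ?posrE ?powR_gt0 //.
    by rewrite ge0_ler_powR ?nnegrE ?(ltW c0) ?(ltW (L0 _)).
  by rewrite ler_pM2r // exprn_gt0.
have C'0 : 0 <= C' by rewrite mulr_ge0 ?powR_ge0 // (ltW Cgt0).
pose d := c `^ q^-1; have d0 : 0 < d by exact: powR_gt0.
have dL k : d <= L k by rewrite ge0_ler_powR ?nnegrE ?invr_ge0 ?(ltW c0) ?(ltW (L0 _)) ?(ltW q0).
exists ((1 + C' / d) ^+ n.+1), n.+1 => k j.
rewrite -!LX -!exprMn lerXn2r ?nnegrE ?mulr_ge0 ?jap_ge0 ?addr_ge0 ?divr_ge0 ?(ltW d0) ?(ltW (Lpos _)) //.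
have h := int_lip C'0 hL k j.
have {}h : L k <= L j + C' * `|(k - j)%:~R|.
  by rewrite -lerBlDl; apply: le_trans h; exact: ler_norm.
apply: le_trans h _; rewrite /jap; move: (`|_|) (normr_ge0 ((k - j)%:~R : R)) => x x0.
have hd : C' <= C' / d * L j.
  by rewrite -mulrA ler_peMr // mulrC ler_pdivlMr // mul1r.
have hd0 : 0 <= C' / d * L j by apply: le_trans hd.
have h8 := Lpos j.
set y := C' / d in hd hd0 *. set z := L j in hd hd0 h8 *. nra.
Qed.
End Peetre.

(** * The parametrix as an infinite matrix *)

Section Parametrix.
Context {R : realType}.
Implicit Types (p q a b : int -> int -> R[i]) (W V : int -> R) (K C : R) (M N : nat).

(** The matrix of the pseudo-differential operator in the basis of exponentials,
    a p k being the p-th Fourier coefficient of the symbol at the frequency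
    k. *)
Definition symb_mx a : int -> int -> R[i] := fun l k => a (l - k) k.

Definition decay C N W a := forall n k, cabs (a n k) <= C * W k * jap n ^- N.

(** Steps are bounded only in the window where the path from k to j stays,
    because the bound on one step grows with the distance to k. *)
Lemma lipschitz_steps (u : int -> R[i]) k d E : 0 <= E ->
  (forall i, (`|i - k|%N <= d)%N -> cabs (u (i + 1) - u i) <= E) ->
  forall j, (`|j - k|%N <= d)%N -> cabs (u j - u k) <= E * `|(j - k)%:~R|.
Proof.
move=> E0 h.
have hn n i : (`|i - k|%N <= d)%N -> (absz (i + n%:Z - k)%R <= d)%N ->
    cabs (u (i + n%:Z) - u i) <= E * n%:R.
  elim: n => [|n IH] hi hj; first by rewrite addr0 subrr cabs0 mulr0.
  have hin : (absz (i + n%:Z - k)%R <= d)%N by lia.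
  have -> : i + n.+1%:Z = i + n%:Z + 1 by lia.
  rewrite -(subrKA (u (i + n%:Z))).
  apply: le_trans (cabsD _ _) _; rewrite -natr1 mulrDr mulr1 addrC.
  by apply: lerD; [exact: IH|exact: h].
move=> j hj; have [jk|kj] := leP k j.
  have e : j = k + `|j - k|%N%:Z by lia.
  rewrite [in X in _ <= X]e addrAC subrr add0r normr_nat {1}e.
  by apply: hn; lia.
have e : k = j + `|k - j|%N%:Z by lia.
rewrite cabsC -normrN -rmorphN opprB [in X in _ <= X]e addrAC subrr add0r normr_nat {1}e.
by apply: hn; lia.
Qed.

Lemma decay_conv_kernel M N C W a : (forall k, 0 < W k) -> 0 <= C -> (M + 4 <= N)%N ->
  decay C N W a -> conv_kernel C (fun l k => symb_mx a l k / (W k)%:C).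
Proof.
move=> W0 C0 MN ha l k; rewrite cabsM cabsV cabs_real (gtr0_norm (W0 k)).
rewrite ler_pdivrMr //; apply: le_trans (ha _ _) _; rewrite mulrAC.
rewrite ler_wpM2r ?(ltW (W0 k)) // ler_wpM2l // /wt.
rewrite lef_pV2 ?posrE ?exprn_gt0 ?jap_gt0 //.
rewrite ler_weXn2l ?jap_ge1 //; lia.
Qed.

Lemma jap_split M N n : (M + 4 <= N)%N -> jap n ^+ M * jap n ^- N <= wt n ^+ 2 :> R.
Proof.
move=> MN; have -> : wt n ^+ 2 = (jap n ^+ 4)^-1 :> R by rewrite /wt exprVn -exprM.
rewrite ler_pdivrMr ?exprn_gt0 ?jap_gt0 // mulrC ler_pdivlMr ?exprn_gt0 ?jap_gt0 //.
by rewrite -exprD ler_weXn2l ?jap_ge1.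
Qed.

(** With the frequency frozen at k the composition is the identity, so the error
    is the sum over j of (p (l - j) j - p (l - j) k) q (j - k) k.  The
    difference costs |j - k| steps of size V1, by Peetre's inequality a
    polynomial factor in j - k, which the decay of q absorbs.  What is left
    is V1 k * V2 k <= d. *)
Lemma freeze_kernel K M N C1 C2 Cp d V1 V2 W1 p q :
  (forall k, 0 < V1 k) -> (forall k, 0 < V2 k) -> (forall k, 0 < W1 k) ->
  0 <= C1 -> 0 <= C2 -> 0 <= Cp -> (M + 5 <= N)%N ->
  peetre K M V1 -> peetre K M W1 ->
  decay Cp N W1 p ->
  (forall n k, cabs (p n (k + 1) - p n k) <= C1 * V1 k * jap n ^- N) ->
  decay C2 N V2 q ->
  (forall k, V1 k * V2 k <= d) ->
  (forall l k, sumZ (fun j => p (l - j) k * q (j - k) k) = (l == k)%:R) ->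
  conv_kernel (4 * (C1 * C2 * K * d))
    (fun l k => sumZ (fun j => symb_mx p l j * symb_mx q j k) - (l == k)%:R).
Proof.
move=> V10 V20 W10 C10 C20 Cp0 MN hV1 hW1 hp hdp hq hd hconv l k.
have K0 : 0 <= K by have := peetre_ge1 V10 hV1; lra.
have hV1' := fun k => ltW (V10 k); have hV2' := fun k => ltW (V20 k).
have hW1' := fun k => ltW (W10 k).
(* The two decays, to the left and to the right of j, combine into decay in l
   - k, with one factor left to sum over j. *)
have wsplit (j : int) : wt (l - j) * wt (j - k) <= wt (l - k) :> R.
  rewrite /wt -invfM -exprMn lef_pV2 ?posrE ?exprn_gt0 ?mulr_gt0 ?jap_gt0 //.
  by rewrite lerXn2r ?nnegrE ?mulr_ge0 ?jap_ge0 // jap_trans.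
have japV (n : int) m : 0 <= jap n ^- m :> R by rewrite invr_ge0 exprn_ge0 ?jap_ge0.
have japX (n : int) m : 0 <= jap n ^+ m :> R by rewrite exprn_ge0 ?jap_ge0.
(* Move the frequency from k to j in unit steps, each bounded through Peetre's
   inequality by its value at k. *)
have hdiff j : cabs (p (l - j) j - p (l - j) k) <=
    C1 * K * V1 k * jap (j - k) ^+ M.+1 * jap (l - j) ^- N.
  pose E := C1 * (K * V1 k * jap (j - k) ^+ M) * jap (l - j) ^- N.
  have E0 : 0 <= E by rewrite /E !mulr_ge0.
  apply: (@le_trans _ _ (E * `|(j - k)%:~R|)).
    apply: (@lipschitz_steps (p (l - j)) k `|j - k|%N) => // i hi.
    apply: le_trans (hdp _ _) _; rewrite /E ler_wpM2r // ler_wpM2l //.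
    apply: le_trans (hV1 i k) _; rewrite ler_wpM2l ?mulr_ge0 //.
    rewrite lerXn2r ?nnegrE ?jap_ge0 // /jap lerD2l.
    by rewrite -!intr_norm ler_int -!abszE.
  have -> : C1 * K * V1 k * jap (j - k) ^+ M.+1 * jap (l - j) ^- N = E * jap (j - k).
    by rewrite /E exprSr; ring.
  by rewrite ler_wpM2l // /jap lerDr.
have hterm j : cabs ((p (l - j) j - p (l - j) k) * q (j - k) k) <=
    C1 * C2 * K * d * wt (l - k) * wt (j - k).
  rewrite cabsM; apply: le_trans (ler_pM (cabs_ge0 _) (cabs_ge0 _) (hdiff j) (hq _ _)) _.
  have -> : C1 * K * V1 k * jap (j - k) ^+ M.+1 * jap (l - j) ^- N *
     (C2 * V2 k * jap (j - k) ^- N) =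
     C1 * C2 * K * ((V1 k * V2 k) * ((jap (l - j) ^+ 0 * jap (l - j) ^- N)
       * (jap (j - k) ^+ M.+1 * jap (j - k) ^- N))) by rewrite expr0; ring.
  rewrite -(mulrA _ (wt _)) -(mulrA _ d) ler_wpM2l ?mulr_ge0 //.
  apply: ler_pM; rewrite ?mulr_ge0 // ?hd //.
  apply: (@le_trans _ _ (wt (l - j) ^+ 2 * wt (j - k) ^+ 2)).
    by apply: ler_pM; rewrite ?mulr_ge0 // jap_split //; lia.
  have := wsplit j; have := @wt_gt0 R (l - j); have := @wt_gt0 R (j - k).
  have := @wt_le1 R (l - j); have := @wt_le1 R (j - k); have := @wt_gt0 R (l - k).
  move: (wt (l - j)) (wt (j - k)) (wt (l - k)) => x y z z0 y1 x1 y0 x0 h.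
  have -> : x ^+ 2 * y ^+ 2 = (x * y) * (x * y) by ring.
  have xy0 : 0 <= x * y by exact: (mulr_ge0 (ltW x0) (ltW y0)).
  by apply: ler_pM => //; rewrite -[leRHS]mul1r (ler_wpM2r (ltW y0)).
have domq (c : R) (u : int -> R[i]) : 0 <= c ->
   (forall j, cabs (u j) <= c * jap (j - k) ^+ M) ->
   domw (c * (C2 * V2 k * jap k ^+ 2)) (fun j => u j * q (j - k) k).
  move=> c0 hu j; rewrite cabsM.
  apply: le_trans (ler_pM (cabs_ge0 _) (cabs_ge0 _) (hu j) (hq _ _)) _.
  have -> : c * jap (j - k) ^+ M * (C2 * V2 k * jap (j - k) ^- N) =
    c * (C2 * V2 k) * (jap (j - k) ^+ M * jap (j - k) ^- N) by ring.
  rewrite -(mulrA c) -(mulrA c) -(mulrA (C2 * V2 k)).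
  rewrite ler_wpM2l // ler_wpM2l ?mulr_ge0 //.
  apply: le_trans (jap_split _ _) _; first by lia.
  apply: le_trans (wt_shift j k); rewrite expr2 ler_piMr ?wt_le1 ?wt_ge0 //.
have d1 : domw (Cp * K * W1 k * (C2 * V2 k * jap k ^+ 2)) (fun j => symb_mx p l j * symb_mx q j k).
  apply: domq => [|j]; first by rewrite !mulr_ge0.
  apply: le_trans (hp _ _) _; rewrite -(mulrA _ K) -!mulrA ler_wpM2l //.
  apply: (@le_trans _ _ (W1 j)); last by rewrite !mulrA; exact: hW1.
  by rewrite ler_piMr // invf_le1 ?exprn_gt0 ?jap_gt0 // exprn_ege1 // jap_ge1.
have d2 : domw (Cp * W1 k * (C2 * V2 k * jap k ^+ 2)) (fun j => p (l - j) k * q (j - k) k).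
  apply: domq => [|j]; first by rewrite !mulr_ge0.
  apply: le_trans (hp _ _) _; rewrite ler_wpM2l ?mulr_ge0 //.
  apply: (@le_trans _ _ 1); last by rewrite exprn_ege1 // jap_ge1.
  by rewrite invf_le1 ?exprn_gt0 ?jap_gt0 // exprn_ege1 // jap_ge1.
rewrite -hconv -(sumZB d1 d2) -mulrA.
under eq_fun => j do rewrite -mulrBl.
exact: (@sumZ_le _ _ k).
Qed.

Lemma decay_row K M N C W a : (forall k, 0 < W k) -> 0 <= C -> (M + 4 <= N)%N ->
  peetre K M W -> decay C N W a ->
  forall l k, cabs (symb_mx a l k) <= C * K * W l * wt (l - k) ^+ 2.
Proof.
move=> W0 C0 MN hW ha l k; apply: le_trans (ha _ _) _.
have K0 : 0 <= K by have := peetre_ge1 W0 hW; lra.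
have Wl := ltW (W0 l).
apply: (@le_trans _ _ (C * (K * W l * jap (l - k) ^+ M) * jap (l - k) ^- N)).
  rewrite ler_wpM2r ?invr_ge0 ?exprn_ge0 ?jap_ge0 // ler_wpM2l //.
  by rewrite japC; exact: hW.
have -> : C * (K * W l * jap (l - k) ^+ M) * jap (l - k) ^- N =
  C * K * W l * (jap (l - k) ^+ M * jap (l - k) ^- N) by ring.
by rewrite ler_wpM2l ?mulr_ge0 // jap_split.
Qed.

Lemma wt_sqr_le n : wt n ^+ 2 <= wt n :> R.
Proof. by rewrite expr2 ler_piMr ?wt_le1 ?wt_ge0. Qed.

Lemma decay_mul K M N C V1 V2 p q :
  (forall k, 0 < V1 k) -> (forall k, 0 < V2 k) -> 0 <= C -> 0 <= K ->
  (M + 4 <= N)%N ->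
  (forall j k, V1 j * V2 k <= K * jap (j - k) ^+ M) ->
  decay C N V1 p -> decay C N V2 q ->
  forall l j k, cabs (symb_mx p l j * symb_mx q j k) <=
    C * C * K * wt (l - j) ^+ 2 * wt (j - k).
Proof.
move=> V10 V20 C0 K0 MN hV hp hq l j k; rewrite cabsM.
have japV (n : int) m : 0 <= jap n ^- m :> R by rewrite invr_ge0 exprn_ge0 ?jap_ge0.
have japX (n : int) m : 0 <= jap n ^+ m :> R by rewrite exprn_ge0 ?jap_ge0.
have hV1' := fun k => ltW (V10 k); have hV2' := fun k => ltW (V20 k).
apply: le_trans (ler_pM (cabs_ge0 _) (cabs_ge0 _) (hp _ _) (hq _ _)) _.
have -> : C * V1 j * jap (l - j) ^- N * (C * V2 k * jap (j - k) ^- N) =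
  C * C * (V1 j * V2 k) * (jap (l - j) ^+ 0 * jap (l - j) ^- N) * jap (j - k) ^- N.
  by rewrite expr0; ring.
apply: (@le_trans _ _ (C * C * (K * jap (j - k) ^+ M) *
  (jap (l - j) ^+ 0 * jap (l - j) ^- N) * jap (j - k) ^- N)).
  by rewrite !ler_wpM2r ?mulr_ge0 // ler_wpM2l ?mulr_ge0.
have -> : C * C * (K * jap (j - k) ^+ M) *
  (jap (l - j) ^+ 0 * jap (l - j) ^- N) * jap (j - k) ^- N =
  C * C * K * (jap (l - j) ^+ 0 * jap (l - j) ^- N) *
     (jap (j - k) ^+ M * jap (j - k) ^- N) by ring.
apply: ler_pM; rewrite ?mulr_ge0 //.
  by rewrite ler_wpM2l ?mulr_ge0 // jap_split //; lia.
by apply: le_trans (wt_sqr_le _); exact: jap_split.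
Qed.

Lemma sumZ_delta l (g : int -> R[i]) :
  sumZ (fun k => (l == k)%:R * g k) = g l.
Proof.
rewrite (@sumZ_fin _ _ `|l|%N); last first.
  move=> k kl; case: eqP => [lk|_]; last by rewrite mul0r.
  by rewrite lk ltnn in kl.
rewrite /psum (bigD1_seq l) ?mem_zrange ?zrange_uniq //= eqxx mul1r.
rewrite big1 ?addr0 // => k; rewrite eq_sym => /negPf->; exact: mul0r.
Qed.

Lemma kapp_sub_id (c : int -> R) Bd A (g : int -> R[i]) :
  (forall l k, cabs (A l k) <= c l * wt (l - k)) ->
  (forall k, cabs (g k) <= Bd) ->
  forall l, kapp A g l = g l + kapp (fun l k => A l k - (l == k)%:R) g l.
Proof.
move=> hA hg l; rewrite -[in X in _ = X + _](sumZ_delta l g) /kapp.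
have h1 := row_dom (hA l) hg.
have h2 : domw (1 * Bd * jap l ^+ 2) (fun k => (l == k)%:R * g k).
  apply: row_dom hg => k; rewrite mul1r; case: eqP => [->|_].
    by rewrite cabs1 subrr /wt /jap normr0 addr0 expr1n invr1.
  by rewrite cabs0 wt_ge0.
under [in X in _ = _ + X]eq_fun => k do rewrite mulrBl.
by rewrite (sumZB h1 h2) addrC subrK.
Qed.

(** A matrix of order W is bounded from the sequences with W g square summable
    to the square-summable ones: divide the columns by W and apply Schur's
    test. *)
Lemma decay_kapp_l2 M N C B W a (g : int -> R[i]) :
  (forall k, 0 < W k) -> 0 <= C -> (M + 4 <= N)%N -> decay C N W a ->
  l2_le B (fun k => (W k)%:C * g k) -> l2_le (2 * (16 * C ^+ 2 * B)) (kapp (symb_mx a) g).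
Proof.
move=> W0 C0 MN ha hg; have := schur (decay_conv_kernel W0 C0 MN ha) hg.
apply: l2_le_le => l; rewrite le_eqVlt; apply/orP; left; apply/eqP; congr cabs.
congr sumZ; apply/funext => k; rewrite -[RHS]mulrA; congr (_ * _).
rewrite mulrA mulVf ?mul1r //; apply/eqP => /complexI /eqP.
by rewrite gt_eqF.
Qed.

(** Composing with the parametrix on the left gives injectivity, composing on
    the right gives solvability.  The gain of the solution, W u square
    summable, is that of the parametrix, which has order W^-1. *)
Lemma parametrix K M N C d c W V a b :
  (forall k, 0 < W k) -> (forall k, 0 < V k) -> 0 <= C -> (3 * M + 5 <= N)%N ->
  0 < c -> (forall k, c <= W k) ->
  peetre K M W -> peetre K M V ->
  decay C N W a -> decay C N (fun k => (W k)^-1) b ->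
  (forall n k, cabs (a n (k + 1) - a n k) <= C * V k * jap n ^- N) ->
  (forall n k, cabs (b n (k + 1) - b n k) <=
     C * (V k * ((W k)^-1 * (W k)^-1)) * jap n ^- N) ->
  (forall k, V k * (W k)^-1 <= d) ->
  4 * (C * C * (K * (K * K)) * d) <= 16%:R^-1 ->
  (forall l k, sumZ (fun j => a (l - j) k * b (j - k) k) = (l == k)%:R) ->
  (forall l k, sumZ (fun j => b (l - j) k * a (j - k) k) = (l == k)%:R) ->
  (forall B u, l2_le B u -> (forall l, kapp (symb_mx a) u l = 0) -> forall k, u k = 0) /\
  (forall B f, l2_le B f -> exists u, exists2 B',
     l2_le B' (fun k => (W k)%:C * u k) & forall l, kapp (symb_mx a) u l = f l).
Proof.
move=> W0 V0 C0 MN c0 cW hW hV ha hb hda hdb hd small hab hba.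
have K1 := peetre_ge1 W0 hW; have K0 : 0 <= K by lra.
have Wi k : 0 < (W k)^-1 by rewrite invr_gt0.
have W'0 := fun k => ltW (W0 k).
have hWi := peetreV W0 hW.
have hWi2 := peetreM Wi Wi hWi hWi.
have Wi2 k : 0 < (W k)^-1 * (W k)^-1 by rewrite mulr_gt0.
have hVW := peetreM V0 Wi2 hV hWi2.
have VW0 k : 0 < V k * ((W k)^-1 * (W k)^-1) by rewrite mulr_gt0.
have K1' : K <= K * (K * K) by rewrite ler_peMr // mulr_ege1.
have M1 : (M <= M + (M + M))%N by lia.
have MN1 : (M + (M + M) + 5 <= N)%N by lia.
have MN4 : (M + 4 <= N)%N by lia.
have Rab := freeze_kernel V0 Wi W0 C0 C0 C0 MN1 (peetreW V0 K1' M1 hV)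
  (peetreW W0 K1' M1 hW) ha hda hb hd hab.
have Rba : conv_kernel (4 * (C * C * (K * (K * K)) * d))
    (fun l k => sumZ (fun j => symb_mx b l j * symb_mx a j k) - (l == k)%:R).
  apply: (freeze_kernel VW0 W0 Wi C0 C0 C0 MN1 hVW (peetreW Wi K1' M1 hWi) hb hdb ha) hba.
  move=> k; apply: le_trans (hd k); rewrite le_eqVlt; apply/orP; left; apply/eqP.
  by field; rewrite gt_eqF.
have WW j k : W j * (W k)^-1 <= K * jap (j - k) ^+ M.
  by rewrite ler_pdivrMr // mulrAC; exact: hW.
have WW' j k : (W j)^-1 * W k <= K * jap (j - k) ^+ M.
  by rewrite mulrC japC; exact: WW.
have mab := decay_mul W0 Wi C0 K0 MN4 WW ha hb.
have mba := decay_mul Wi W0 C0 K0 MN4 WW' hb ha.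
have row K2 M2 W2 a2 : (forall k, 0 < W2 k) -> (M2 + 4 <= N)%N -> peetre K2 M2 W2 ->
    decay C N W2 a2 -> forall l k, cabs (symb_mx a2 l k) <= C * K2 * W2 l * wt (l - k).
  move=> h1 h2 h3 h4 l k; apply: le_trans (decay_row h1 C0 h2 h3 h4 l k) _.
  have K20 : 0 <= K2 by have := peetre_ge1 h1 h3; lra.
  by rewrite ler_wpM2l ?wt_sqr_le // !mulr_ge0 // ltW.
have rowa := row _ _ _ _ W0 MN4 hW ha.
have rowb := row _ _ _ _ Wi MN4 hWi hb.
have rowc (D D' : R) A : 0 <= D' -> conv_kernel D (fun l k => A l k - (l == k)%:R) ->
    D <= D' -> forall l k, cabs (A l k) <= (1 + D') * wt (l - k).
  move=> D0 h DD l k; rewrite -(subrK (l == k)%:R (A l k)) mulrDl mul1r addrC.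
  apply: le_trans (cabsD _ _) _; apply: lerD.
    case: eqP => [->|_]; last by rewrite cabs0 wt_ge0.
    by rewrite cabs1 subrr /wt /jap normr0 addr0 expr1n invr1.
  by apply: le_trans (h l k) _; rewrite ler_wpM2r ?wt_ge0.
split=> [B u hu h0|B f hf].
  have hub := fun k => l2_le_bounded k hu.
  apply: (@small_kernel_inj _ _ _ (1 + B) u Rba) => // [|l].
    by apply: le_trans small _; rewrite lef_pV2 ?posrE ?ler_nat.
  rewrite -(kapp_sub_id (c := fun=> 1 + 16%:R^-1)
    (rowc _ _ (fun l k => sumZ (fun j => symb_mx b l j * symb_mx a j k)) _ Rba small) hub) ?invr_ge0 //.
  rewrite -(kapp_comp mba rowa hub).
  have -> : kapp (symb_mx a) u = fun=> 0 by apply/funext.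
  rewrite /kapp; under eq_fun => k do rewrite mulr0.
  rewrite (@sumZ_fin _ _ 0) //; by rewrite /psum big1_eq.
have [v hv hvf] := small_kernel_solve Rab small hf.
have hvb := fun k => l2_le_bounded k hv.
exists (kapp (symb_mx b) v).
exists (2 * (16 * (C * K) ^+ 2 * (8 * B))).
  have hk : conv_kernel (C * K) (fun l k => (W l)%:C * symb_mx b l k).
    move=> l k; rewrite cabsM cabs_real (gtr0_norm (W0 l)).
    apply: le_trans (ler_wpM2l (W'0 l) (rowb l k)) _.
    rewrite le_eqVlt; apply/orP; left; apply/eqP; field.
    by rewrite gt_eqF.
  have := schur hk hv; apply: l2_le_le => l; rewrite /kapp.
  under [in X in _ <= X]eq_fun => k do rewrite -mulrA.
  by rewrite (sumZZ _ (row_dom (rowb l) hvb)).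
move=> l; rewrite (kapp_comp mab rowb hvb).
rewrite (kapp_sub_id (c := fun=> 1 + 16%:R^-1)
    (rowc _ _ (fun l k => sumZ (fun j => symb_mx a l j * symb_mx b j k)) _ Rab small) hvb) ?invr_ge0 //.
Qed.
End Parametrix.

(** * Calculus of complex-valued functions *)

Section Calculus.
Context {R : realType}.
Implicit Types (f g h F G : R -> R[i]) (x t : R).

Definition is_cderiv F x (d : R[i]) :=
  is_derive x 1 (fun y => complex.Re (F y)) (complex.Re d) /\
  is_derive x 1 (fun y => complex.Im (F y)) (complex.Im d).

Lemma is_derive_eq1 (f : R -> R) x (d e : R) : is_derive x 1 f d -> d = e -> is_derive x 1 f e.
Proof. by move=> h <-. Qed.

Lemma is_cderivD F G x d e : is_cderiv F x d -> is_cderiv G x e ->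
  is_cderiv (fun y => F y + G y) x (d + e).
Proof.
move=> [F1 F2] [G1 G2]; split; rewrite ?cReD ?cImD.
  by under eq_fun do rewrite cReD; exact: is_deriveD.
by under eq_fun do rewrite cImD; exact: is_deriveD.
Qed.

Lemma is_cderivM F G x d e : is_cderiv F x d -> is_cderiv G x e ->
  is_cderiv (fun y => F y * G y) x (d * G x + F x * e).
Proof.
move=> [F1 F2] [G1 G2]; split.
  under eq_fun do rewrite cReM.
  apply: (is_derive_eq1 (is_deriveB (is_deriveM F1 G1) (is_deriveM F2 G2))).
  by rewrite cReD !cReM /GRing.scale /=; ring.
under eq_fun do rewrite cImM.
apply: (is_derive_eq1 (is_deriveD (is_deriveM F1 G2) (is_deriveM F2 G1))).
by rewrite cImD !cImM /GRing.scale /=; ring.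
Qed.

Lemma is_cderiv_cst (c : R[i]) x : is_cderiv (fun=> c) x 0.
Proof. by split; exact: is_derive_cst. Qed.

Lemma is_cderivZ (c : R[i]) F x d : is_cderiv F x d -> is_cderiv (fun y => c * F y) x (c * d).
Proof.
by move=> h; have := is_cderivM (is_cderiv_cst c x) h; rewrite mul0r add0r.
Qed.

Lemma is_cderivB F G x d e : is_cderiv F x d -> is_cderiv G x e ->
  is_cderiv (fun y => F y - G y) x (d - e).
Proof.
move=> hF hG; have := is_cderivD hF (is_cderivZ (-1) hG).
by under eq_fun do rewrite mulN1r; rewrite mulN1r.
Qed.

Lemma is_cderiv_cis (a : R) x : is_cderiv (fun y => cis (y * a)) x ((0 +i* a) * cis (x * a)).
Proof.
have ha : is_derive x 1 (fun y : R => y * a) a.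
  have := @is_deriveM _ _ id (cst a) x 1 1 0 (is_derive_id _ _) (is_derive_cst _ _ _).
  by move=> h; apply: (is_derive_eq1 h); rewrite /GRing.scale /= mulr0 mulr1 add0r.
split; rewrite /cis /=.
  apply: (is_derive_eq1 (@is_derive1_comp _ cos _ x _ _ (is_derive_cos _) ha)); ring.
apply: (is_derive_eq1 (@is_derive1_comp _ sin _ x _ _ (is_derive_sin _) ha)); ring.
Qed.

(** The inverse is computed in components as (Re F - i Im F) / |F|^2. *)
Lemma is_cderiv_inv F x d : F x != 0 -> is_cderiv F x d ->
  is_cderiv (fun y => (F y)^-1) x (- (d * (F x)^-1 * (F x)^-1)).
Proof.
move=> Fx0 [h1 h2].
set a := fun y => complex.Re (F y) in h1; set b := fun y => complex.Im (F y) in h2.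
have n0 : a x * a x + b x * b x != 0.
  rewrite /a /b -!expr2 -cabs_sqr expf_eq0 /=; apply: contra Fx0 => /eqP e.
  by apply/eqP/cabs_eq0; rewrite e.
have hN := is_deriveD (is_deriveM h1 h1) (is_deriveM h2 h2).
have hV := @is_deriveV R (a * a + b * b) x _ 1 n0 hN.
have e1 : (fun y => complex.Re (F y)^-1) = a * (fun y => ((a * a + b * b) y)^-1).
  by apply/funext => y; rewrite /a /b /= !fctE; case: (F y) => p q /=.
have e2 : (fun y => complex.Im (F y)^-1) = - (b * (fun y => ((a * a + b * b) y)^-1)).
  by apply/funext => y; rewrite /a /b /= !fctE; case: (F y) => p q /=.
have n0' := n0; rewrite /a /b in n0'.
split; rewrite ?e1 ?e2.
  apply: (is_derive_eq1 (is_deriveM h1 hV)).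
  rewrite /GRing.scale /= !fctE /a /b.
  move: n0'; case: (F x) d {h1 h2 hN hV} => p q [r s] /= n0'.
  by rewrite !expr2; field.
apply: (is_derive_eq1 (is_deriveN (is_deriveM h2 hV))).
rewrite /GRing.scale /= !fctE /a /b.
move: n0'; case: (F x) d {h1 h2 hN hV} => p q [r s] /= n0'.
by rewrite !expr2; field.
Qed.

Definition ccont F := continuous (fun y => complex.Re (F y)) /\
  continuous (fun y => complex.Im (F y)).

Lemma is_derive_cont (f df : R -> R) : (forall x, is_derive x 1 f (df x)) -> continuous f.
Proof.
move=> h x; apply: differentiable_continuous; apply/derivable1_diffP.
exact: (@ex_derive _ _ _ _ _ _ _ (h x)).
Qed.

Lemma is_cderiv_cont F F' : (forall x, is_cderiv F x (F' x)) -> ccont F.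
Proof. by move=> h; split; apply: is_derive_cont => x; have [] := h x. Qed.

Lemma rFTC (f df : R -> R) : (forall x, is_derive x 1 f (df x)) -> continuous df ->
  \int[lebesgue_measure]_(y in torus) df y = f (2 * pi) - f 0.
Proof.
move=> h cdf; rewrite /Rintegral /torus (@continuous_FTC2 _ df f) //.
- by rewrite mulr_gt0 // pi_gt0.
- exact: continuous_subspaceT.
- have cf := is_derive_cont h; split.
  + by move=> x _; exact: (@ex_derive _ _ _ _ _ _ _ (h x)).
  + exact/cvg_at_right_filter/cf.
  + exact/cvg_at_left_filter/cf.
- by move=> x _; rewrite derive1E; exact: (@derive_val _ _ _ _ _ _ _ (h x)).
Qed.

(** Everything that is integrated explicitly over the torus is the derivative of
    a known function. *)
Lemma cFTC F F' : (forall x, is_cderiv F x (F' x)) -> ccont F' ->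
  torus_int F' = F (2 * pi) - F 0.
Proof.
move=> h [c1 c2]; apply: complex_eq; rewrite ?cReD ?cImD ?cReN ?cImN.
  by apply: (@rFTC (fun y => complex.Re (F y))) => // x; have [] := h x.
by apply: (@rFTC (fun y => complex.Im (F y))) => // x; have [] := h x.
Qed.

(** Periodic functions with n derivatives, all bounded by the same M.
    Derivatives are given by existence, not by an operator, so that products
    and reciprocals need no formula for higher derivatives. *)
Fixpoint Cb (n : nat) (M : R) (g : R -> R[i]) : Prop :=
  [/\ torus_fun g, forall x, cabs (g x) <= M &
    if n is n'.+1 then exists2 g', (forall x, is_cderiv g x (g' x)) & Cb n' M g' else True].

Lemma CbS n M g : Cb n.+1 M g -> Cb n M g.
Proof.
elim: n g => [|n IH] g /= [p b [g' d h]]; first by split.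
by split => //; exists g' => //; exact: IH.
Qed.

Lemma Cb_bound n M g x : Cb n M g -> cabs (g x) <= M.
Proof. by case: n => [|n] []. Qed.

Lemma Cb_per n M g : Cb n M g -> torus_fun g.
Proof. by case: n => [|n] []. Qed.

Lemma CbW n M M' g : M <= M' -> Cb n M g -> Cb n M' g.
Proof.
move=> MM; elim: n g => [|n IH] g /=; move=> [p b h]; split => //.
- by move=> x; apply: le_trans MM.
- by move=> x; apply: le_trans MM.
- by case: h => g' d h; exists g' => //; exact: IH.
Qed.

Lemma Cb_ge0 n M g : Cb n M g -> 0 <= M.
Proof. by move=> h; apply: le_trans (Cb_bound 0 h); exact: cabs_ge0. Qed.

Lemma CbD n M M' g h : Cb n M g -> Cb n M' h -> Cb n (M + M') (fun x => g x + h x).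
Proof.
elim: n g h => [|n IH] g h; move=> [p b e] [p' b' e']; split => //.
- by move=> x; rewrite p p'.
- by move=> x; apply: le_trans (cabsD _ _) _; exact: lerD.
- by move=> x; rewrite p p'.
- by move=> x; apply: le_trans (cabsD _ _) _; exact: lerD.
- case: e e' => g' dg hg [h' dh hh]; exists (fun x => g' x + h' x); last exact: IH.
  by move=> x; exact: is_cderivD.
Qed.

(** Leibniz' rule doubles the number of terms at each derivative, hence the
    constant 2^n. *)
Lemma CbM n M M' g h : Cb n M g -> Cb n M' h ->
  Cb n (2 ^+ n * M * M') (fun x => g x * h x).
Proof.
elim: n g h => [|n IH] g h Hg Hh.
  move: Hg Hh => [p b e] [p' b' e']; split => // x; first by rewrite p p'.
  by rewrite cabsM expr0 mul1r; apply: ler_pM; rewrite ?cabs_ge0.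
have M0 := Cb_ge0 Hg; have M'0 := Cb_ge0 Hh.
have Hg' := CbS Hg; have Hh' := CbS Hh.
move: Hg Hh => [p b [g' dg hg]] [p' b' [h' dh hh]]; split.
- by move=> x; rewrite p p'.
- move=> x; rewrite cabsM; apply: le_trans (ler_pM (cabs_ge0 _) (cabs_ge0 _) (b x) (b' x)) _.
  by rewrite -mulrA ler_peMl ?mulr_ge0 // exprn_ege1 // ler1n.
- exists (fun x => g' x * h x + g x * h' x); first by move=> x; exact: is_cderivM.
  have := CbD (IH _ _ hg Hh') (IH _ _ Hg' hh).
  by congr (Cb _ _ _); rewrite exprS; ring.
Qed.

Lemma CbN n M g : Cb n M g -> Cb n M (fun x => - g x).
Proof.
elim: n g => [|n IH] g; move=> [p b e]; split => //.
- by move=> x; rewrite p.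
- by move=> x; rewrite cabsN.
- by move=> x; rewrite p.
- by move=> x; rewrite cabsN.
- case: e => g' dg hg; exists (fun x => - g' x); last exact: IH.
  move=> x; have := is_cderivZ (-1) (dg x); rewrite mulN1r.
  by under eq_fun do rewrite mulN1r.
Qed.

(** Induction on n through (1/g)' = - g' / g^2.  It is essential that D depends
    on C and c but not on W: this makes all estimates on the reciprocal
    symbol uniform in the frequency and in the spectral parameter. *)
Lemma Cb_inv n (C c : R) : 0 < c -> exists2 D, 0 <= D & forall (W : R) g, 0 < W ->
  Cb n (C * W) g -> (forall x, c * W <= cabs (g x)) ->
  Cb n (D / W) (fun x => (g x)^-1).
Proof.
move=> c0; elim: n => [|n [D D0 IH]].
  exists c^-1; first by rewrite invr_ge0 ltW.
  move=> W g W0 [p b _] lo; split=> // x; first by rewrite p.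
  by rewrite cabsV -invfM lef_pV2 ?posrE ?mulr_gt0 //; apply: lt_le_trans (lo x); exact: mulr_gt0.
exists (c^-1 + D + 2 ^+ n * (2 ^+ n * `|C| * D) * D).
  by rewrite !addr_ge0 ?mulr_ge0 ?exprn_ge0 // invr_ge0 ltW.
move=> W g W0 hg lo.
have hi := IH W g W0 (CbS hg) lo.
have hg0 := Cb_ge0 hg.
have C0 : 0 <= C by move: hg0; rewrite pmulr_lge0.
case: hg => p b [g' dg hg']; split.
- by move=> x; rewrite p.
- move=> x; rewrite cabsV.
  apply: (@le_trans _ _ (c^-1 / W)).
    by rewrite -invfM lef_pV2 ?posrE ?mulr_gt0 //; apply: lt_le_trans (lo x); exact: mulr_gt0.
  rewrite ler_wpM2r ?invr_ge0 ?(ltW W0) // -addrA lerDl.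
  by rewrite addr_ge0 ?mulr_ge0 ?exprn_ge0.
- exists (fun x => - (g' x * (g x)^-1 * (g x)^-1)).
    move=> x; apply: is_cderiv_inv => //; apply/eqP => e.
    by have := lo x; rewrite e cabs0 leNgt mulr_gt0.
  apply/CbN; apply: CbW (CbM (CbM hg' hi) hi).
  rewrite (ger0_norm C0).
  have -> : 2 ^+ n * (2 ^+ n * (C * W) * (D / W)) * (D / W) =
    (2 ^+ n * (2 ^+ n * C * D) * D) / W.
    by field; rewrite gt_eqF.
  rewrite ler_wpM2r ?invr_ge0 ?(ltW W0) // lerDr.
  by rewrite addr_ge0 // invr_ge0 ltW.
Qed.
End Calculus.

(** * Fourier coefficients of functions on the torus *)

Section TorusInt.
Context {R : realType}.
Notation mu := (@lebesgue_measure R).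
Implicit Types (f g h : R -> R[i]) (x : R).

Lemma pi2_gt0 : 0 < 2 * pi :> R.
Proof. by rewrite mulr_gt0 // pi_gt0. Qed.

Lemma torus_meas : measurable (torus : set (measurableTypeR R)).
Proof. exact: measurable_itv. Qed.

Lemma torus_measure : mu torus = (2 * pi)%:E.
Proof. by rewrite /torus lebesgue_measure_itv /= lte_fin pi2_gt0 -EFinB subr0. Qed.

Lemma torus_fin : (mu torus < +oo)%E.
Proof. by rewrite torus_measure ltry. Qed.

Definition cmeas f := measurable_fun setT (fun x => complex.Re (f x)) /\
  measurable_fun setT (fun x => complex.Im (f x)).

Lemma cmeas_cst (c : R[i]) : cmeas (fun=> c).
Proof. by split; exact: measurable_cst. Qed.

Lemma cmeasD f g : cmeas f -> cmeas g -> cmeas (fun x => f x + g x).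
Proof.
move=> [f1 f2] [g1 g2]; split.
  by under eq_fun do rewrite cReD; exact: measurable_funD.
by under eq_fun do rewrite cImD; exact: measurable_funD.
Qed.

Lemma cmeasM f g : cmeas f -> cmeas g -> cmeas (fun x => f x * g x).
Proof.
move=> [f1 f2] [g1 g2]; split.
  by under eq_fun do rewrite cReM; apply: measurable_funB; exact: measurable_funM.
by under eq_fun do rewrite cImM; apply: measurable_funD; exact: measurable_funM.
Qed.

Lemma cmeasZ (c : R[i]) f : cmeas f -> cmeas (fun x => c * f x).
Proof. exact/cmeasM/cmeas_cst. Qed.

Lemma cmeasN f : cmeas f -> cmeas (fun x => - f x).
Proof. by move=> /(cmeasZ (-1)); under eq_fun do rewrite mulN1r. Qed.

Lemma cmeasB f g : cmeas f -> cmeas g -> cmeas (fun x => f x - g x).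
Proof. by move=> hf /cmeasN; exact: cmeasD. Qed.

Lemma cmeas_cont f : ccont f -> cmeas f.
Proof.
by move=> [c1 c2]; split; apply: measurable_realfun.continuous_measurable_fun.
Qed.

Lemma cmeas_sum (I : Type) (s : seq I) (F : I -> R -> R[i]) :
  (forall i, cmeas (F i)) -> cmeas (fun x => \sum_(i <- s) F i x).
Proof.
move=> h; elim: s => [|i s IH].
  by under eq_fun do rewrite big_nil; exact: cmeas_cst.
by under eq_fun do rewrite big_cons; exact: cmeasD.
Qed.

Lemma meas_cabs2 f : cmeas f -> measurable_fun setT (fun x => cabs (f x) ^+ 2).
Proof.
move=> [f1 f2]; under eq_fun do rewrite cabs_sqr !expr2.
by apply: measurable_funD; exact: measurable_funM.
Qed.

Definition rint (f : R -> R) := mu.-integrable torus (EFin \o f).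
Definition cint f := [/\ cmeas f, rint (fun x => complex.Re (f x)) &
  rint (fun x => complex.Im (f x))].

Lemma rint_le (f g : R -> R) : measurable_fun setT f -> rint g ->
  (forall x, `|f x| <= g x) -> rint f.
Proof.
move=> mf ig h; apply: le_integrable ig; first exact: torus_meas.
  by apply/measurable_EFinP; exact: measurable_funTS.
move=> x _ /=; rewrite lee_fin; apply: le_trans (h x) _; exact: ler_norm.
Qed.

Lemma rint_cst (c : R) : rint (fun=> c).
Proof.
apply: measurable_bounded_integrable; [exact: torus_meas|exact: torus_fin| |].
  exact: measurable_cst.
exists `|c|; split; first exact: num_real.
by move=> M cM x _ /=; exact: ltW.
Qed.

Lemma rintD (f g : R -> R) : rint f -> rint g -> rint (fun x => f x + g x).
Proof. by move=> hf hg; have := integrableD torus_meas hf hg. Qed.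

Lemma rintZ (c : R) (f : R -> R) : rint f -> rint (fun x => c * f x).
Proof. by move=> hf; have := integrableZl torus_meas c hf. Qed.

Lemma rint_norm (f : R -> R) : rint f -> rint (fun x => `|f x|).
Proof. by move=> hf; have := integrable_norm hf. Qed.

Lemma cint_le f (g : R -> R) : cmeas f -> rint g -> (forall x, cabs (f x) <= g x) ->
  cint f.
Proof.
move=> mf ig h; split=> //; case: mf => m1 m2; apply: rint_le ig _ => // x.
  by apply: le_trans (h x); exact: normRe_le.
by apply: le_trans (h x); exact: normIm_le.
Qed.

Lemma cint_bounded f M : cmeas f -> (forall x, cabs (f x) <= M) -> cint f.
Proof. by move=> mf h; apply: cint_le mf (rint_cst M) h. Qed.

Lemma cintD f g : cint f -> cint g -> cint (fun x => f x + g x).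
Proof.
move=> [mf f1 f2] [mg g1 g2]; split; first exact: cmeasD.
  by under eq_fun do rewrite cReD; exact: rintD.
by under eq_fun do rewrite cImD; exact: rintD.
Qed.

Lemma cintMb f h M : cint f -> cmeas h -> (forall x, cabs (h x) <= M) ->
  cint (fun x => f x * h x).
Proof.
move=> [mf f1 f2] mh hM.
apply: (@cint_le _ (fun x => M * (`|complex.Re (f x)| + `|complex.Im (f x)|))).
- exact: cmeasM.
- by apply/rintZ/rintD; exact: rint_norm.
- move=> x; rewrite cabsM mulrC; apply: ler_pM; rewrite ?cabs_ge0 //.
  exact: cabs_le.
Qed.

Lemma cintZ (c : R[i]) f : cint f -> cint (fun x => c * f x).
Proof.
move=> hf; have := cintMb hf (cmeas_cst c) (M := cabs c) (fun=> lexx _).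
by under eq_fun do rewrite mulrC.
Qed.

Lemma cintN f : cint f -> cint (fun x => - f x).
Proof. by move=> /(cintZ (-1)); under eq_fun do rewrite mulN1r. Qed.

Lemma cintB f g : cint f -> cint g -> cint (fun x => f x - g x).
Proof. by move=> hf /cintN; exact: cintD. Qed.

Lemma torus_intD f g : cint f -> cint g ->
  torus_int (fun x => f x + g x) = torus_int f + torus_int g.
Proof.
move=> [mf f1 f2] [mg g1 g2]; apply: complex_eq; rewrite ?cReD ?cImD /=.
  by under eq_Rintegral do rewrite cReD; rewrite RintegralD //; exact: torus_meas.
by under eq_Rintegral do rewrite cImD; rewrite RintegralD //; exact: torus_meas.
Qed.

Lemma torus_intZ (c : R[i]) f : cint f ->
  torus_int (fun x => c * f x) = c * torus_int f.
Proof.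
move=> [mf f1 f2]; case: c => a b; have mT := torus_meas.
apply: complex_eq; rewrite ?cReM ?cImM /=.
  under eq_Rintegral do rewrite cReM.
  rewrite RintegralB ?RintegralZl //; exact: rintZ.
under eq_Rintegral do rewrite cImM.
rewrite RintegralD ?RintegralZl //; exact: rintZ.
Qed.

Lemma torus_intN f : cint f -> torus_int (fun x => - f x) = - torus_int f.
Proof.
move=> hf; rewrite -mulN1r -torus_intZ //; congr torus_int.
by apply/funext => x; rewrite mulN1r.
Qed.

Lemma torus_intB f g : cint f -> cint g ->
  torus_int (fun x => f x - g x) = torus_int f - torus_int g.
Proof. by move=> hf hg; rewrite torus_intD ?torus_intN //; exact: cintN. Qed.

Lemma torus_int_le f M : cint f -> (forall x, cabs (f x) <= M) ->
  cabs (torus_int f) <= 4 * pi * M.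
Proof.
move=> [mf f1 f2] hM; have mT := torus_meas.
have key (u : R -> R) : rint u -> (forall x, `|u x| <= M) ->
    `|\int[mu]_(x in torus) u x| <= 2 * pi * M.
  move=> iu hu; apply: le_trans (le_normr_Rintegral mT iu) _.
  have -> : 2 * pi * M = \int[mu]_(x in torus) (cst M x).
      rewrite Rintegral_cst // mulrC; congr (_ * _).
    by rewrite -[LHS]/(fine (2 * pi)%:E) -torus_measure.
  apply: le_Rintegral => //; [exact: rint_norm|exact: rint_cst].
apply: le_trans (cabs_le _) _.
have -> : 4 * pi * M = 2 * pi * M + 2 * pi * M by ring.
apply: lerD; apply: key => // x; apply: le_trans (hM x).
  exact: normRe_le.
exact: normIm_le.
Qed.

Definition expi (k : int) : R -> R[i] := fun y => cis (y * k%:~R).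

Lemma expiD k l y : expi (k + l) y = expi k y * expi l y.
Proof. by rewrite /expi intrD mulrDr cisD. Qed.
Lemma expi0 y : expi 0 y = 1.
Proof. by rewrite /expi mulr0 cis0. Qed.
Lemma cabs_expi k y : cabs (expi k y) = 1.
Proof. exact: cabs_cis. Qed.
Lemma is_cderiv_expi k x : is_cderiv (expi k) x ((0 +i* k%:~R) * expi k x).
Proof. exact: is_cderiv_cis. Qed.
Lemma cmeas_expi k : cmeas (expi k).
Proof. exact/cmeas_cont/is_cderiv_cont/is_cderiv_expi. Qed.

Lemma cis_period (n : nat) (t : R) : cis (t + 2 * pi * n%:R) = cis t.
Proof.
elim: n => [|n IH]; first by rewrite mulr0 addr0.
rewrite -[n.+1%:R]natr1 mulrDr mulr1 addrA -[RHS]IH; move: (t + _) => s.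
by rewrite /cis mulr_natl cosD2pi sinD2pi.
Qed.

Lemma expi_periodic k : torus_fun (expi k).
Proof.
move=> y; rewrite /expi mulrDl; case: (leP 0 k) => k0.
  by rewrite -[k in _ + _ * k%:~R]gez0_abs // cis_period.
rewrite -[LHS](cis_period `|k|%N) natr_absz -addrA -mulrDr -intrD ltr0_norm //.
by rewrite subrr mulr0 addr0.
Qed.

Lemma torus_int_expi k : k != 0 -> torus_int (expi k) = 0.
Proof.
move=> k0; pose c : R[i] := 0 +i* k%:~R.
have c0 : c != 0 by rewrite eq_complex /= eqxx /= intr_eq0.
have h x : is_cderiv (fun y => c^-1 * expi k y) x (expi k x).
  by have := is_cderivZ c^-1 (is_cderiv_expi k x); rewrite mulrA mulVf // mul1r.
rewrite (cFTC h); last exact: is_cderiv_cont (is_cderiv_expi k).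
by rewrite -[2 * pi]add0r expi_periodic subrr.
Qed.

Lemma torus_int_cst (c : R[i]) : torus_int (fun=> c) = (2 * pi)%:C * c.
Proof.
have mT := torus_meas.
apply: complex_eq; rewrite ?cReM ?cImM /= mul0r ?subr0 ?addr0 Rintegral_cst // mulrC;
  by congr (_ * _); rewrite -[RHS]/(fine (2 * pi)%:E) -torus_measure.
Qed.

Definition fcoef (p : int) f : R[i] :=
  ((2 * pi)^-1)%:C * torus_int (fun y => f y * expi (- p) y).

Lemma cint_expi f k : cint f -> cint (fun x => f x * expi k x).
Proof.
by move=> hf; apply: (cintMb (M := 1) hf (cmeas_expi k)) => x; rewrite cabs_expi.
Qed.

Lemma fcoefD p f g : cint f -> cint g -> fcoef p (fun x => f x + g x) = fcoef p f + fcoef p g.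
Proof.
move=> hf hg; rewrite /fcoef -mulrDr -torus_intD; try exact: cint_expi.
by congr (_ * torus_int _); apply/funext => x; rewrite mulrDl.
Qed.

Lemma fcoefZ p (c : R[i]) f : cint f -> fcoef p (fun x => c * f x) = c * fcoef p f.
Proof.
move=> hf; rewrite /fcoef mulrCA -[c * _]torus_intZ; last exact: cint_expi.
by congr (_ * torus_int _); apply/funext => x; rewrite mulrA.
Qed.

Lemma fcoefN p f : cint f -> fcoef p (fun x => - f x) = - fcoef p f.
Proof.
move=> hf; rewrite -mulN1r -fcoefZ //; congr fcoef; apply/funext => x; by rewrite mulN1r.
Qed.

Lemma fcoefB p f g : cint f -> cint g -> fcoef p (fun x => f x - g x) = fcoef p f - fcoef p g.
Proof. by move=> hf hg; rewrite fcoefD ?fcoefN //; exact: cintN. Qed.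

Lemma fcoef_expi p k : fcoef p (expi k) = (p == k)%:R.
Proof.
rewrite /fcoef; under eq_fun do rewrite -expiD.
case: eqP => [->|/eqP pk].
  rewrite subrr; under eq_fun do rewrite expi0.
  by rewrite torus_int_cst mulr1 -rmorphM mulVf ?gt_eqF ?pi2_gt0.
by rewrite torus_int_expi ?mulr0 // subr_eq0 eq_sym.
Qed.

Lemma fcoef_shift p k f : fcoef p (fun x => f x * expi k x) = fcoef (p - k) f.
Proof.
rewrite /fcoef; congr (_ * torus_int _); apply/funext => x.
by rewrite -mulrA -expiD opprB.
Qed.

Lemma cint_sum (I : Type) (s : seq I) (F : I -> R -> R[i]) :
  (forall i, cint (F i)) -> cint (fun x => \sum_(i <- s) F i x).
Proof.
move=> h; elim: s => [|i s IH].
  under eq_fun do rewrite big_nil.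
  by apply: (@cint_bounded _ 0); [exact: cmeas_cst|move=> x; rewrite cabs0].
by under eq_fun do rewrite big_cons; exact: cintD.
Qed.

Lemma fcoef0 p : fcoef p (fun=> 0) = 0.
Proof. by rewrite /fcoef; under eq_fun do rewrite mul0r; rewrite torus_int_cst !mulr0. Qed.

Lemma fcoef_sum p (I : Type) (s : seq I) (F : I -> R -> R[i]) :
  (forall i, cint (F i)) ->
  fcoef p (fun x => \sum_(i <- s) F i x) = \sum_(i <- s) fcoef p (F i).
Proof.
move=> h; elim: s => [|i s IH].
  by under eq_fun do rewrite big_nil; rewrite big_nil fcoef0.
under eq_fun do rewrite big_cons.
by rewrite big_cons fcoefD ?IH //; exact: cint_sum.
Qed.

Lemma fcoef_le p f M : cint f -> (forall x, cabs (f x) <= M) -> cabs (fcoef p f) <= 2 * M.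
Proof.
move=> hf h; rewrite /fcoef cabsM cabs_real gtr0_norm ?invr_gt0 ?pi2_gt0 //.
rewrite ler_pdivrMl ?pi2_gt0 //.
have -> : 2 * pi * (2 * M) = 4 * pi * M by ring.
by apply: torus_int_le; [exact: cint_expi|move=> x; rewrite cabsM cabs_expi mulr1].
Qed.

Lemma Cb_cint n M g : Cb n.+1 M g -> cint g.
Proof.
move=> hg; apply: (@cint_bounded _ M); last by move=> x; exact: Cb_bound hg.
by case: hg => _ _ [g' dg _]; exact/cmeas_cont/is_cderiv_cont/dg.
Qed.

(** Integration by parts: the derivative of g e_(-p) integrates to zero over a
    period. *)
Lemma fcoef_deriv p n M g g' : torus_fun g -> (forall x, is_cderiv g x (g' x)) ->
  Cb n.+1 M g' -> cint g -> fcoef p g' = (0 +i* p%:~R) * fcoef p g.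
Proof.
move=> pg dg hg' ig.
have h x : is_cderiv (fun y => g y * expi (- p) y) x
    (g' x * expi (- p) x - (0 +i* p%:~R) * (g x * expi (- p) x)).
  have := is_cderivM (dg x) (is_cderiv_expi (- p) x).
  congr is_cderiv; congr (_ + _); rewrite mulrCA -mulNr; congr (_ * _).
  by apply: complex_eq; rewrite /= ?oppr0 // mulrNz.
have ig' := Cb_cint hg'.
have : torus_int (fun x => g' x * expi (- p) x - (0 +i* p%:~R) * (g x * expi (- p) x)) = 0.
  rewrite (cFTC h); first by rewrite -[2 * pi]add0r pg expi_periodic subrr.
  case: hg' => _ _ [g'' dg' _].
  apply: is_cderiv_cont => x; apply: is_cderivB; first exact: is_cderivM (dg' x) (is_cderiv_expi _ _).
  by apply: is_cderivZ; exact: is_cderivM (dg x) (is_cderiv_expi _ _).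
rewrite torus_intB ?torus_intZ; try exact: cint_expi; last exact/cintZ/cint_expi.
by move=> /eqP; rewrite subr_eq0 => /eqP e; rewrite /fcoef e mulrCA.
Qed.

(** Integrate by parts n times; for p <> 0 one has 1 + |p| <= 2 |p|. *)
Lemma fcoef_decay n M g p : Cb n.+1 M g -> cabs (fcoef p g) <= 2 ^+ n.+1 * M * jap p ^- n.
Proof.
move=> hg; have M0 := Cb_ge0 hg.
have [->|p0] := eqVneq p 0.
  rewrite /jap normr0 addr0 expr1n invr1 mulr1.
  apply: le_trans (fcoef_le 0 (Cb_cint hg) (fun x => Cb_bound x hg)) _.
  by rewrite ler_wpM2r // exprS ler_peMr // exprn_ege1 // ler1n.
have p1 : 1 <= `|p%:~R : R|.
  by rewrite -intr_norm -[1 in X in X <= _]/(1%:~R) ler_int; lia.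
have {hg} : cabs (fcoef p g) * `|p%:~R| ^+ n <= 2 * M.
  elim: n g hg => [|n IH] g hg.
    by rewrite expr0 mulr1; apply: fcoef_le (Cb_cint hg) (fun x => Cb_bound x hg).
  have ig := Cb_cint hg; case: hg => pg _ [g' dg hg'].
  have := IH _ hg'; rewrite (fcoef_deriv p pg dg hg' ig) cabsM.
  have -> : cabs (0 +i* p%:~R : R[i]) = `|p%:~R|.
    by rewrite /cabs /= expr0n /= add0r sqrtr_sqr.
  by rewrite exprS mulrA [cabs _ * `|_|]mulrC.
have p0' : 0 < `|p%:~R : R| ^+ n by rewrite exprn_gt0 //; lra.
rewrite -ler_pdivlMr // => h; apply: le_trans h _.
have -> : 2 ^+ n.+1 * M * jap p ^- n = 2 * M * (2 ^+ n * jap p ^- n).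
  by rewrite exprS; ring.
rewrite ler_wpM2l ?mulr_ge0 //.
rewrite ler_pdivlMr ?exprn_gt0 ?jap_gt0 // mulrC ler_pdivrMr // -exprMn.
by rewrite lerXn2r ?nnegrE ?jap_ge0 ?mulr_ge0 // /jap; lra.
Qed.
End TorusInt.

(** * Square-integrable functions and Bessel's inequality *)

Section L2theory.
Context {R : realType}.
Notation mu := (@lebesgue_measure R).
Implicit Types (f g h : R -> R[i]) (x : R).

Definition L2m f := cmeas f /\ (L2_sqnorm f < +oo)%E.
Definition sqnorm f : R := \int[mu]_(x in torus) cabs (f x) ^+ 2.

Lemma L2E f : L2 f <-> torus_fun f /\ L2m f.
Proof. by split=> [[p m1 m2 h]|[p [[m1 m2] h]]]; split. Qed.

Lemma L2m_rint f : L2m f -> rint (fun x => cabs (f x) ^+ 2).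
Proof.
move=> [mf h]; apply/integrableP; split.
  by apply/measurable_EFinP; exact: measurable_funTS (meas_cabs2 mf).
under eq_integral => x _ do rewrite /= ger0_norm ?sqr_ge0 //.
exact: h.
Qed.

Lemma rint_L2m f : cmeas f -> rint (fun x => cabs (f x) ^+ 2) -> L2m f.
Proof.
move=> mf /integrableP [_ h]; split=> //; move: h.
by under eq_integral => x _ do rewrite /= ger0_norm ?sqr_ge0 //.
Qed.

Lemma L2_sqnormE f : L2m f -> L2_sqnorm f = (sqnorm f)%:E.
Proof.
move=> /L2m_rint hf; rewrite /sqnorm /Rintegral fineK //.
exact: (integrable_fin_num torus_meas hf).
Qed.

Lemma sqnorm_ge0 f : 0 <= sqnorm f.
Proof. by apply: Rintegral_ge0 => x _; exact: sqr_ge0. Qed.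

Lemma L2m_le f (g : R -> R) : cmeas f -> rint g -> (forall x, cabs (f x) ^+ 2 <= g x) -> L2m f.
Proof.
move=> mf ig h; apply: rint_L2m => //; apply: rint_le ig _; first exact: meas_cabs2.
by move=> x; rewrite ger0_norm ?sqr_ge0.
Qed.

Lemma L2mD f g : L2m f -> L2m g -> L2m (fun x => f x + g x).
Proof.
move=> hf hg; apply: (@L2m_le _ (fun x => 2 * cabs (f x) ^+ 2 + 2 * cabs (g x) ^+ 2)).
- by apply: cmeasD; [case: hf|case: hg].
- by apply: rintD; apply: rintZ; exact: L2m_rint.
- by move=> x; exact: cabsD_sqr.
Qed.

Lemma L2mMb f h M : L2m f -> cmeas h -> (forall x, cabs (h x) <= M) ->
  L2m (fun x => f x * h x).
Proof.
move=> hf mh hM; apply: (@L2m_le _ (fun x => M ^+ 2 * cabs (f x) ^+ 2)).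
- by apply: cmeasM => //; case: hf.
- by apply: rintZ; exact: L2m_rint.
- move=> x; rewrite cabsM exprMn mulrC ler_wpM2r ?sqr_ge0 //.
  by rewrite lerXn2r ?nnegrE ?cabs_ge0 // (le_trans _ (hM x)) // cabs_ge0.
Qed.

Lemma L2mZ (c : R[i]) f : L2m f -> L2m (fun x => c * f x).
Proof.
move=> hf; have := L2mMb hf (cmeas_cst c) (M := cabs c) (fun=> lexx _).
by under eq_fun do rewrite mulrC.
Qed.

Lemma L2mN f : L2m f -> L2m (fun x => - f x).
Proof. by move=> /(L2mZ (-1)); under eq_fun do rewrite mulN1r. Qed.

Lemma L2mB f g : L2m f -> L2m g -> L2m (fun x => f x - g x).
Proof. by move=> hf /L2mN; exact: L2mD. Qed.

Lemma L2m_bounded f M : cmeas f -> (forall x, cabs (f x) <= M) -> L2m f.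
Proof.
move=> mf h; apply: (@L2m_le _ (fun=> M ^+ 2)) => //; first exact: rint_cst.
move=> x; rewrite lerXn2r ?nnegrE ?cabs_ge0 // (le_trans _ (h x)) //.
exact: cabs_ge0.
Qed.

Lemma L2m_cint f : L2m f -> cint f.
Proof.
move=> hf; apply: (@cint_le _ _ (fun x => 1 + cabs (f x) ^+ 2)).
- by case: hf.
- by apply: rintD; [exact: rint_cst|exact: L2m_rint].
- by move=> x; have := cabs_ge0 (f x); nra.
Qed.

Lemma L2m_expi k : L2m (expi k : R -> R[i]).
Proof. by apply: (@L2m_bounded _ 1); [exact: cmeas_expi|move=> x; rewrite cabs_expi]. Qed.

Lemma sqnormD f g : L2m f -> L2m g ->
  sqnorm (fun x => f x + g x) <= 2 * sqnorm f + 2 * sqnorm g.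
Proof.
move=> hf hg; have mT := torus_meas (R := R); rewrite /sqnorm.
have If := L2m_rint hf; have Ig := L2m_rint hg.
rewrite -(RintegralZl 2 mT If) -(RintegralZl 2 mT Ig).
rewrite -(RintegralD mT (rintZ 2 If) (rintZ 2 Ig)).
apply: le_Rintegral => //; first exact: L2m_rint (L2mD hf hg).
  exact: rintD (rintZ 2 If) (rintZ 2 Ig).
by move=> x _; exact: cabsD_sqr.
Qed.

(** Pythagoras' theorem, the cross term being the real part of a multiple of the
    Fourier coefficient. *)
Lemma pyth g k (c : R[i]) : L2m g -> fcoef k g = 0 ->
  sqnorm (fun x => g x + c * expi k x) = sqnorm g + 2 * pi * cabs c ^+ 2.
Proof.
move=> hg hk; have mT := torus_meas (R := R).
pose F := fun x => (conjc c * 2) * (g x * expi (- k) x).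
have iF : cint F by apply/cintZ/cint_expi/L2m_cint.
have F0 : \int[mu]_(x in torus) complex.Re (F x) = 0.
  have : torus_int F = 0.
    rewrite /F torus_intZ; last exact/cint_expi/L2m_cint.
    move: hk => /eqP; rewrite /fcoef mulf_eq0 => /orP[|/eqP->]; last by rewrite mulr0.
    by rewrite eq_complex /= eqxx andbT invr_eq0 gt_eqF // pi2_gt0.
  by move=> /(congr1 (@complex.Re R)).
have e x : cabs (g x + c * expi k x) ^+ 2 =
    (cabs (g x) ^+ 2 + complex.Re (F x)) + cabs c ^+ 2.
  have -> : cabs c ^+ 2 = cabs c ^+ 2 * cabs (expi k x) ^+ 2.
    by rewrite cabs_expi expr1n mulr1.
  rewrite /F !cabs_sqr.
  have -> : expi (- k) x = conjc (expi k x).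
    by rewrite /expi /cis mulrNz mulrN cosN sinN.
  clear F iF F0.
  by case: (g x) c (expi k x) => a b [p q] [r s] /=; ring.
rewrite /sqnorm; under eq_Rintegral do rewrite e.
case: iF => _ i1 _; have i2 := L2m_rint hg.
rewrite (RintegralD mT (rintD i2 i1) (rint_cst _)) (RintegralD mT i2 i1).
rewrite F0 addr0; congr (_ + _); rewrite Rintegral_cst // mulrC; congr (_ * _).
by rewrite -[RHS]/(fine (2 * pi)%:E) -torus_measure.
Qed.

Definition trigp (s : seq int) (c : int -> R[i]) x : R[i] := \sum_(k <- s) c k * expi k x.

Lemma trigp_bound s c x : cabs (trigp s c x) <= \sum_(k <- s) cabs (c k).
Proof.
apply: le_trans (cabs_sum _ _) _; apply: ler_sum => k _.
by rewrite cabsM cabs_expi mulr1.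
Qed.

Lemma cmeas_trigp s c : cmeas (trigp s c).
Proof. by apply: cmeas_sum => k; exact/cmeasZ/cmeas_expi. Qed.

Lemma L2m_trigp s c : L2m (trigp s c).
Proof. by apply: L2m_bounded (trigp_bound s c); exact: cmeas_trigp. Qed.

Lemma trigp_periodic s c : torus_fun (trigp s c).
Proof. by move=> x; apply: eq_bigr => k _; rewrite expi_periodic. Qed.

Lemma fcoef_trigp s c p : uniq s -> fcoef p (trigp s c) = if p \in s then c p else 0.
Proof.
move=> us; rewrite fcoef_sum; last by move=> k; exact/cintZ/L2m_cint/L2m_expi.
have e k : fcoef p (fun x => c k * expi k x) = c k * (p == k)%:R.
  by rewrite fcoefZ ?fcoef_expi //; exact/L2m_cint/L2m_expi.
under eq_bigr => k _ do rewrite e.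
case: ifP => ps.
  rewrite (bigD1_seq p) //= eqxx mulr1 big1 ?addr0 // => k kp.
  by rewrite eq_sym (negPf kp) mulr0.
rewrite big1_seq // => k /andP[_ ks]; case: eqP => [pk|]; last by rewrite mulr0.
by rewrite pk ks in ps.
Qed.

(** The exponentials are orthogonal: add one frequency at a time. *)
Lemma sqnorm_trigp s c : uniq s -> sqnorm (trigp s c) = 2 * pi * \sum_(k <- s) cabs (c k) ^+ 2.
Proof.
elim: s => [|k s IH] /=.
  move=> _; rewrite big_nil mulr0 /sqnorm /trigp.
  under eq_Rintegral do rewrite big_nil cabs0 expr0n.
  by rewrite Rintegral_cst ?mul0r //; exact: torus_meas.
move=> /andP[ks us]; rewrite big_cons mulrDr addrC -IH //.
rewrite -(@pyth _ k (c k) (L2m_trigp s c)); last by rewrite fcoef_trigp // (negPf ks).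
by congr sqnorm; apply/funext => x; rewrite /trigp big_cons addrC.
Qed.

(** Subtract one frequency at a time; each subtraction lowers the squared norm
    by exactly one term. *)
Lemma bessel s f : uniq s -> L2m f ->
  2 * pi * \sum_(k <- s) cabs (fcoef k f) ^+ 2 <= sqnorm f.
Proof.
elim: s f => [|k s IH] f /=; first by rewrite big_nil mulr0 sqnorm_ge0.
move=> /andP[ks us] hf; pose g x := f x - fcoef k f * expi k x.
have ie := cintZ (fcoef k f) (L2m_cint (L2m_expi k)).
have hg : L2m g by apply: L2mB => //; exact/L2mZ/L2m_expi.
have fcg j : fcoef j g = fcoef j f - fcoef k f * (j == k)%:R.
  rewrite /g fcoefB ?fcoefZ ?fcoef_expi //; [exact/L2m_cint/L2m_expi|exact: L2m_cint].
have -> : sqnorm f = sqnorm (fun x => g x + fcoef k f * expi k x).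
  by congr sqnorm; apply/funext => x; rewrite subrK.
rewrite pyth //; last by rewrite fcg eqxx mulr1 subrr.
rewrite big_cons mulrDr addrC lerD2r; apply: le_trans (IH g us hg).
rewrite le_eqVlt; apply/orP; left; apply/eqP; congr (_ * _).
apply: eq_big_seq => j js; rewrite fcg; case: eqP => [jk|]; last by rewrite mulr0 subr0.
by rewrite -jk js in ks.
Qed.

Lemma bessel_l2_le f : L2m f -> l2_le (sqnorm f / (2 * pi)) (fcoef^~ f).
Proof.
move=> hf N; rewrite ler_pdivlMr ?pi2_gt0 // mulrC.
by apply: bessel => //; exact: zrange_uniq.
Qed.
End L2theory.

(** * Fourier coefficients determine a function *)

Section Step.
Context {R : realType}.
Implicit Types (y t : R).

Lemma bernoulli t n : 0 <= t <= 1 -> 1 - n%:R * t <= (1 - t) ^+ n.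
Proof.
move=> /andP[t0 t1]; elim: n => [|n IH]; first by rewrite mul0r subr0 expr0.
rewrite exprS -[n.+1%:R]natr1.
apply: (@le_trans _ _ ((1 - t) * (1 - n%:R * t))).
  have : 0 <= n%:R * t * t by rewrite !mulr_ge0.
  by lra.
by rewrite ler_wpM2l //; lra.
Qed.

Lemma bernoulli_plus t n : 0 <= t -> 1 + n%:R * t <= (1 + t) ^+ n.
Proof.
move=> t0; elim: n => [|n IH]; first by rewrite mul0r addr0 expr0.
rewrite exprS -[n.+1%:R]natr1.
apply: (@le_trans _ _ ((1 + t) * (1 + n%:R * t))).
  have : 0 <= n%:R * t * t by rewrite !mulr_ge0.
  by lra.
by rewrite ler_wpM2l //; lra.
Qed.

(** Polynomials in y that tend boundedly to the indicator function of [0, 1/2)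
    on [0, 1] away from 1/2, as in the elementary proof of the
    Stone-Weierstrass theorem. *)
Definition steppoly n y := (1 - y ^+ n) ^+ (2 ^ n).

Lemma steppoly01 n y : 0 <= y <= 1 -> 0 <= steppoly n y <= 1.
Proof.
move=> /andP[y0 y1]; have h0 : 0 <= y ^+ n by rewrite exprn_ge0.
have h1 : y ^+ n <= 1 by rewrite exprn_ile1.
by rewrite /steppoly exprn_ge0 ?exprn_ile1 //; lra.
Qed.

(** Bernoulli's inequality for (1 - y^n)^(2^n). *)
Lemma steppoly_lo n y : 0 <= y <= 1 -> `|steppoly n y - 1| <= (2 * y) ^+ n.
Proof.
move=> y01; have /andP[h0 h1] := steppoly01 n y01; move: y01 => /andP[y0 y1].
rewrite ler0_norm ?subr_le0 // opprB lerBlDl -lerBlDr exprMn.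
have := @bernoulli (y ^+ n) (2 ^ n); rewrite natrX; apply.
by rewrite exprn_ge0 // exprn_ile1.
Qed.

(** Multiply by (1 + y^n)^(2^n) >= (2 y)^n and use (1 - y^n)(1 + y^n) <= 1. *)
Lemma steppoly_hi n y : 2^-1 < y -> y <= 1 -> `|steppoly n y| <= ((2 * y)^-1) ^+ n.
Proof.
move=> y0 y1; have y01 : 0 <= y <= 1 by apply/andP; split; lra.
have /andP[h0 h1] := steppoly01 n y01; rewrite ger0_norm //.
have t0 : 0 <= y ^+ n by rewrite exprn_ge0 //; lra.
have t1 : y ^+ n <= 1 by rewrite exprn_ile1 //; lra.
rewrite exprVn -[X in _ <= X]mul1r ler_pdivlMr ?exprn_gt0 //; last by lra.
apply: (@le_trans _ _ (steppoly n y * (1 + y ^+ n) ^+ (2 ^ n))).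
  rewrite ler_wpM2l //; apply: le_trans (bernoulli_plus _ t0).
  by rewrite natrX -exprMn lerDr.
rewrite /steppoly -exprMn exprn_ile1 //.
  by rewrite mulr_ge0 //; lra.
by have := sqr_ge0 (y ^+ n); rewrite expr2 => h; lra.
Qed.

Lemma steppoly_cvg_lo y : 0 <= y < 2^-1 -> steppoly n y @[n --> \oo] --> (1 : R).
Proof.
move=> /andP[y0 y1]; apply/cvgrPdist_le => e e0.
have : (2 * y) ^+ n @[n --> \oo] --> (0 : R).
  by apply: cvg_expr; rewrite ger0_norm ?mulr_ge0 //; lra.
move/cvgrPdist_le => /(_ _ e0); apply: filterS => n.
rewrite sub0r normrN => h; rewrite distrC; apply: le_trans (steppoly_lo _ _) _.
  by apply/andP; split; lra.
by apply: le_trans h; exact: ler_norm.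
Qed.

Lemma steppoly_cvg_hi y : 2^-1 < y <= 1 -> steppoly n y @[n --> \oo] --> (0 : R).
Proof.
move=> /andP[y0 y1]; apply/cvgrPdist_le => e e0.
have : ((2 * y)^-1) ^+ n @[n --> \oo] --> (0 : R).
  apply: cvg_expr; rewrite ger0_norm ?invr_ge0 ?invf_lt1 ?mulr_ge0 //; lra.
move/cvgrPdist_le => /(_ _ e0); apply: filterS => n.
rewrite !sub0r !normrN => h; apply: le_trans (steppoly_hi _ y0 y1) _.
by apply: le_trans h; exact: ler_norm.
Qed.
End Step.

Section Uniq.
Context {R : realType}.
Notation mu := (@lebesgue_measure R).
Implicit Types (u p q : R -> R[i]) (x y : R).

Lemma ae_endpoints (s : seq R) : {ae mu, forall x : R, x \notin s}.
Proof.
exists [set` s]; split.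
- exact: countable_measurable (finite_set_countable (finite_seq s)).
- exact: countable_lebesgue_measure0 (finite_set_countable (finite_seq s)).
- by move=> x /= /negP; rewrite negbK.
Qed.

(** Lebesgue's differentiation theorem, for the primitive of v, which vanishes
    identically. *)
Lemma interval_ae0 (v : R -> R) : rint v ->
  (forall y, 0 < y < 2 * pi -> \int[mu]_(x in `[0, y]) v x = 0) ->
  {ae mu, forall x : R, torus x -> v x = 0}.
Proof.
move=> iv h; have mT := torus_meas (R := R).
pose f := v \_ torus.
have locf : locally_integrable setT f by exact: integrable_locally_restrict.
have If : mu.-integrable setT (EFin \o f).
  by move: iv => /(integrable_mkcond _ mT); rewrite restrict_EFin.
have intf y : mu.-integrable [set` Interval (BLeft 0) (BRight y)] (EFin \o f).
  by apply: integrableS If => //; exact: measurable_itv.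
have := FTC1 intf locf; set F := fun y => _.
have F0 y : 0 < y < 2 * pi -> F y = 0.
  move=> y0; rewrite /F -[RHS](h _ y0); apply: eq_Rintegral => x; rewrite inE /= in_itv /= => /andP[x0 xy].
  rewrite /f patchE mem_set //= /torus /= in_itv /= x0 (le_trans xy) //.
  by case/andP: y0 => _ /ltW.
have := ae_endpoints [:: 0; 2 * pi].
apply: filterS2; first exact: (ae_filter_ringOfSetsType mu).
move=> x; rewrite !inE negb_or => /andP[x0 x2] hx.
rewrite /torus /= in_itv /= => /andP[x0' x2'].
have xx : 0 < x < 2 * pi by rewrite !lt_neqAle x0' x2' x2 eq_sym x0.
have [|_] := hx _; first by rewrite lte_fin; case/andP: xx.
rewrite /f patchE mem_set /=; last by rewrite /torus /= in_itv /= x0' x2'.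
move=> <-; rewrite derive1E (@near_eq_derive _ _ _ F (cst 0)) ?derive_cst //.
near=> z; apply: F0; apply/andP; split; near: z.
  by apply: lt_nbhsr; case/andP: xx.
by apply: lt_nbhsl; case/andP: xx.
Unshelve. all: by end_near. Qed.

(** The bounded functions p such that u p has no Fourier coefficient.  They form
    a space stable under multiplication by trigonometric polynomials. *)
Definition annih u p := [/\ cmeas p, exists M, forall x, cabs (p x) <= M &
  forall k, torus_int (fun x => u x * p x * expi k x) = 0].

Lemma annih1 u : (forall j : int, fcoef j u = 0) -> annih u (fun=> 1).
Proof.
move=> h; split; first exact: cmeas_cst.
  by exists 1 => x; rewrite cabs1.
move=> k; under eq_fun do rewrite mulr1.
have /eqP := h (- k); rewrite /fcoef opprK mulf_eq0 => /orP[|/eqP //].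
by rewrite eq_complex /= eqxx andbT invr_eq0 gt_eqF // pi2_gt0.
Qed.

Lemma annih_expi u p j : annih u p -> annih u (fun x => p x * expi j x).
Proof.
move=> [mp [M hM] h]; split; first by apply: cmeasM => //; exact: cmeas_expi.
  by exists M => x; rewrite cabsM cabs_expi mulr1.
move=> k; rewrite -[RHS](h (j + k)); congr torus_int; apply/funext => x.
by rewrite expiD !mulrA.
Qed.

Lemma annih_lin u p q (c : R[i]) : cint u -> annih u p -> annih u q ->
  annih u (fun x => c * p x + q x).
Proof.
move=> iu [mp [M hM] h] [mq [N hN] h'].
have ip k : cint (fun x => u x * p x * expi k x) by apply: cint_expi; exact: cintMb hM.
have iq k : cint (fun x => u x * q x * expi k x) by apply: cint_expi; exact: cintMb hN.
split; first by apply: cmeasD => //; exact: cmeasZ.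
  exists (cabs c * M + N) => x; apply: le_trans (cabsD _ _) _; apply: lerD => //.
  by rewrite cabsM ler_wpM2l ?cabs_ge0.
move=> k; have -> : (fun x => u x * (c * p x + q x) * expi k x) =
    fun x => c * (u x * p x * expi k x) + u x * q x * expi k x.
  by apply/funext => x; ring.
by rewrite torus_intD ?torus_intZ ?h ?h' ?mulr0 ?addr0 //; exact: cintZ.
Qed.

Lemma annih_Y u p (a b c : R[i]) : cint u -> annih u p ->
  annih u (fun x => p x * (a + b * expi 1 x + c * expi (- 1) x)).
Proof.
move=> iu hp; have h1 := annih_expi 1 hp; have h2 := annih_expi (- 1) hp.
have h0 := annih_lin 0 iu hp hp.
have h3 := annih_lin b iu h1 (annih_lin c iu h2 (annih_lin (a - 1) iu hp hp)).
move: h3; congr annih; apply/funext => x; ring.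
Qed.

Lemma annih_steppoly u (a b c : R[i]) n : cint u -> (forall j : int, fcoef j u = 0) ->
  annih u (fun x => (1 - (a + b * expi 1 x + c * expi (- 1) x) ^+ n) ^+ (2 ^ n)).
Proof.
move=> iu hu; set Y := fun x => a + b * expi 1 x + c * expi (- 1) x.
have hY p m : annih u p -> annih u (fun x => p x * Y x ^+ m).
  move=> hp; elim: m => [|m IH]; first by under eq_fun do rewrite expr0 mulr1.
  by under eq_fun do rewrite exprSr mulrA; exact: annih_Y.
elim: (2 ^ n)%N => [|N IH]; first by under eq_fun do rewrite expr0; exact: annih1.
have := annih_lin (-1) iu (hY _ n IH) IH; congr annih; apply/funext => x.
by rewrite exprSr -/(Y x); ring.
Qed.

Lemma cos_arc_in x y : 0 < x -> x < y -> y < 2 * pi -> cos (y / 2) < cos (x - y / 2) :> R.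
Proof.
move=> x0 xy y2; have p0 := pi_gt0 R.
have [h|h] := leP (y / 2) x.
  by rewrite ltr_cos ?in_itv /=; [lra|apply/andP; split; lra|apply/andP; split; lra].
rewrite -[x - _]opprB cosN.
by rewrite ltr_cos ?in_itv /=; [lra|apply/andP; split; lra|apply/andP; split; lra].
Qed.

Lemma cos_arc_out x y : 0 < y -> y < x -> x < 2 * pi -> cos (x - y / 2) < cos (y / 2) :> R.
Proof.
move=> y0 yx x2; have p0 := pi_gt0 R.
have [h|h] := leP (x - y / 2) pi.
  by rewrite ltr_cos ?in_itv /=; [lra|apply/andP; split; lra|apply/andP; split; lra].
have -> : cos (x - y / 2) = cos (2 * pi - (x - y / 2)).
  have -> : 2 * pi - (x - y / 2) = - (x - y / 2) + pi *+ 2 by rewrite mulr2n; ring.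
  by rewrite cosD2pi cosN.
by rewrite ltr_cos ?in_itv /=; [lra|apply/andP; split; lra|apply/andP; split; lra].
Qed.

(** The function Y is affine in cos (x - y/2), maps into [0, 1], and passes
    through 1/2 exactly at the ends of the arc [0, y]; so the polynomials in
    Y tend boundedly to the indicator function of the arc.  Each of them is
    a trigonometric polynomial, hence orthogonal to u. *)
Lemma arc_int0 u y : cint u -> (forall j : int, fcoef j u = 0) -> 0 < y < 2 * pi ->
  \int[mu]_(x in `[0, y]) complex.Re (u x) = 0.
Proof.
move=> iu hu /andP[y0 y2]; have mT := torus_meas (R := R).
pose c := y / 2; pose s : R := cos c.
(* The division by 4 keeps the values between 0 and 1, since the difference of
   two cosines is at most 2 in absolute value. *)
pose Y x : R := (s - cos (x - c)) / 4 + 2^-1.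
have Y01 x : 0 <= Y x <= 1.
  rewrite /Y; have := cos_le1 c; have := cos_geN1 c.
  have := cos_le1 (x - c); have := cos_geN1 (x - c); rewrite -/s => *.
  by apply/andP; split; lra.
have YE x : (Y x)%:C = (s / 4 + 2^-1)%:C + (- 8^-1)%:C * cis (- c) * expi 1 x +
    (- 8^-1)%:C * cis c * expi (- 1) x.
  rewrite -!mulrA /expi -!cisD mulr1 mulrN1z mulrN1.
  by apply: complex_eq; rewrite /= /Y; rewrite (addrC (- c) x) -(opprB x c) cosN ?sinN; field.
have hn n : \int[mu]_(x in torus) (complex.Re (u x) * steppoly n (Y x)) = 0.
  have [_ _ /(_ 0) h] := annih_steppoly (s / 4 + 2^-1)%:C ((- 8^-1)%:C * cis (- c))
    ((- 8^-1)%:C * cis c) n iu hu.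
  have {h} := congr1 (@complex.Re R) h; rewrite /torus_int /= => h.
  rewrite -[RHS]h; apply: eq_Rintegral => x _.
  rewrite -YE expi0 mulr1 -rmorphXn -[1]/(1%:C) -rmorphB -rmorphXn /=.
  by rewrite cReM /= mulr0 subr0.
pose g := (fun x => complex.Re (u x)) \_ `[0, y].
have gE : \int[mu]_(x in `[0, y]) complex.Re (u x) = \int[mu]_(x in torus) g x.
  rewrite /g -Rintegral_mkcondr; congr Rintegral.
  rewrite setIidr // => x /=; rewrite /torus /= !in_itv /= => /andP[-> xy] /=.
  by apply: le_trans xy _; exact: ltW.
rewrite gE /Rintegral.
case: iu => [[mu1 _] iu1 _].
have mY : measurable_fun setT Y.
  have -> : Y = fun x => s / 4 + 2^-1 - 4^-1 * complex.Re (cis (- c) * expi 1 x).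
    apply/funext => x; rewrite /Y /expi -cisD mulr1 /= addrC (addrC (- c)); ring.
  apply: measurable_funB; first exact: measurable_cst.
  apply: measurable_funM; first exact: measurable_cst.
  by have [] := cmeasZ (cis (- c)) (cmeas_expi (R := R) 1).
have mstp n : measurable_fun setT (fun x => steppoly n (Y x)).
  apply: measurable_realfun.measurable_funX; apply: measurable_funB; first exact: measurable_cst.
  exact: measurable_realfun.measurable_funX.
have := @dominated_convergence _ _ _ mu torus mT
  (fun n x => (complex.Re (u x) * steppoly n (Y x))%:E) (fun x => (g x)%:E)
  (fun x => `|complex.Re (u x)|%:E).
case.
- move=> n; apply/measurable_EFinP; apply: measurable_funTS.
  exact: (measurable_funM mu1 (mstp n)).
- apply/measurable_EFinP; apply: measurable_funTS.
  by apply/(measurable_restrictT _ _).1; [exact: measurable_itv|exact: measurable_funTS].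
- have := ae_endpoints [:: 0; y; 2 * pi].
  apply: filterS; first exact: (ae_filter_ringOfSetsType mu).
  move=> x; rewrite !inE !negb_or => /and3P[x0 xy x2].
  rewrite /torus /= in_itv /= => /andP[x0' x2'].
  have {}x0 : 0 < x by rewrite lt_neqAle eq_sym x0.
  have {}x2 : x < 2 * pi by rewrite lt_neqAle x2.
  have /andP[Y0 Y1] := Y01 x.
  apply: cvg_EFin; first by near=> n.
  have [xy'|yx] := ltP x y.
    have -> : g x = complex.Re (u x) * 1.
      by rewrite /g patchE mem_set ?mulr1 //= in_itv /= (ltW x0) (ltW xy').
    apply: cvgM; first exact: cvg_cst.
    apply: steppoly_cvg_lo; rewrite Y0 /=.
    by have := cos_arc_in x0 xy' y2; rewrite /Y /s /c; lra.
  have {}yx : y < x by rewrite lt_neqAle eq_sym xy.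
  have -> : g x = complex.Re (u x) * 0.
    rewrite /g patchE memNset ?mulr0 //= in_itv /= => /andP[_].
    by rewrite leNgt yx.
  apply: cvgM; first exact: cvg_cst.
  apply: steppoly_cvg_hi; rewrite Y1 andbT.
  by have := cos_arc_out y0 yx x2; rewrite /Y /s /c; lra.
- exact: rint_norm iu1.
- apply: aeW => x n _ /=; rewrite lee_fin normrM ler_piMr //.
  have /andP[h0 h1] := steppoly01 n (Y01 x); by rewrite ger0_norm.
move=> ig _ hlim.
have e0 n : (\int[mu]_(x in torus) (complex.Re (u x) * steppoly n (Y x))%:E)%E = 0%E.
  have := hn n; rewrite /Rintegral => h0.
  rewrite -[LHS]fineK ?h0 //; apply: integrable_fin_num => //.
  apply: (@rint_le _ _ (fun x => `|complex.Re (u x)|)); first exact: (measurable_funM mu1 (mstp n)).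
    exact: rint_norm.
  move=> x; rewrite normrM ler_piMr //.
  have /andP[h3 h4] := steppoly01 n (Y01 x); by rewrite ger0_norm.
have : (\int[mu]_(x in torus) (g x)%:E)%E = 0%E.
  move: hlim; under eq_fun => n do rewrite e0.
  by move=> h0; apply/esym; apply: (cvg_unique _ _ h0) => //; exact: cvg_cst.
by move=> ->.
Unshelve. all: by end_near. Qed.

(** The integral of u vanishes over every arc starting at 0, so u vanishes
    almost everywhere by differentiation.  Multiplying by - i exchanges the
    imaginary part with the real one. *)
Theorem fcoef_ae0 u : cint u -> (forall j : int, fcoef j u = 0) ->
  {ae mu, forall x : R, torus x -> u x = 0}.
Proof.
move=> iu hu.
have hre := interval_ae0 (let: And3 _ h _ := iu in h) (fun y => arc_int0 iu hu).
have iu' : cint (fun x => - 'i * u x) by exact: cintZ.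
have hu' j : fcoef j (fun x => - 'i * u x) = 0 by rewrite fcoefZ // hu mulr0.
have e x : complex.Re (- 'i * u x) = complex.Im (u x).
  by case: (u x) => a b /=; ring.
have ii := (let: And3 _ h _ := iu' in h).
have him := interval_ae0 ii (fun y => arc_int0 iu' hu').
move: hre him; apply: filterS2; first exact: (ae_filter_ringOfSetsType mu).
move=> x h1 h2 tx; apply: complex_eq; first exact: h1.
by rewrite -e; exact: h2.
Qed.
End Uniq.

(** * Almost everywhere on the torus and on the line *)

Section Shift.
Context {R : realType}.
Notation mu := (@lebesgue_measure R).

Definition shiftr (c : R) : measurableTypeR R -> measurableTypeR R := fun x => x + c.

Lemma shiftr_meas c : measurable_fun setT (shiftr c).
Proof. by apply: measurable_funD; [exact: measurable_id|exact: measurable_cst]. Qed.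

HB.instance Definition _ c := isMeasurableFun.Build _ _ _ _ (shiftr c) (shiftr_meas c).

(** Lebesgue measure is characterized by its values on intervals, so it is
    invariant under translation. *)
Lemma shift_null (c : R) (A : set (measurableTypeR R)) : measurable A -> mu A = 0%E ->
  mu (shiftr c @^-1` A) = 0%E.
Proof.
move=> mA A0.
have := @lebesgue_measure_unique R (pushforward mu (shiftr c)).
move=> h; rewrite -[RHS]A0; apply/esym; apply: h => //.
move=> X /ocitvP[->|[[a b] /= ab ->]]; first by rewrite !measure0.
rewrite -[RHS]/(mu (shiftr c @^-1` `]a, b])).
have -> : shiftr c @^-1` `]a, b] = `]a - c, b - c]%classic.
  by apply/seteqP; split => x /=; rewrite /shiftr !in_itv /= ltrBlDr lerBrDr.
rewrite !lebesgue_measure_itv /= !lte_fin ltrD2r ab -!EFinB; congr (_%:E); ring.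
Qed.

Lemma periodic_int (T : Type) (f : R -> T) : (forall x, f (x + 2 * pi) = f x) ->
  forall (n : int) x, f (x + 2 * pi * n%:~R) = f x.
Proof.
move=> hp; have hn (n : nat) x : f (x + 2 * pi * n%:R) = f x.
  elim: n x => [|n IH] x; first by rewrite mulr0 addr0.
  by rewrite -[n.+1%:R]natr1 mulrDr mulr1 addrA hp.
move=> n x; case: (leP 0 n) => n0; first by rewrite -[n]gez0_abs //; exact: hn.
rewrite -(hn `|n|%N) natr_absz ltr0_norm // mulrNz mulrN addrK //.
Qed.

Lemma torus_shift (x : R) : exists n : int, torus (x + 2 * pi * n%:~R).
Proof.
pose n := Num.floor (x / (2 * pi)); exists (- n).
rewrite /torus /= in_itv /= mulrNz mulrN subr_ge0 lerBlDr.
have p0 := @pi2_gt0 R; have := floor_itv (x / (2 * pi)).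
rewrite -/n intrD => /andP[h1 h2]; apply/andP; split.
  by rewrite mulrC -ler_pdivlMr.
by rewrite -{1}(mulr1 (2 * pi)) -mulrDr mulrC -ler_pdivrMr // addrC; exact: ltW.
Qed.

(** The line is covered by countably many translates of one period, and the
    exceptional set by the translates of a null set. *)
Lemma periodic_ae (P : set R) : (forall x, P (x + 2 * pi) <-> P x) ->
  {ae mu, forall x : R, torus x -> P x} -> {ae mu, forall x : R, P x}.
Proof.
move=> hP [A [mA A0 sA]].
have hPz := periodic_int (fun x => propext (hP x)).
(* One sequence of shifts: the even indices carry the nonpositive multiples of
   the period and the odd ones the nonnegative. *)
pose c (i : nat) : R := if odd i then 2 * pi * (i./2)%:R else - (2 * pi * (i./2)%:R).
have : mu.-negligible (\bigcup_i (shiftr (c i) @^-1` A)).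
  apply: negligible_bigcup => i; exists (shiftr (c i) @^-1` A); split => //.
    by rewrite -[X in measurable X]setTI; exact: shiftr_meas.
  exact: shift_null.
apply: negligibleS => x /= nPx; have [n hx] := torus_shift x.
have hAx : A (x + 2 * pi * n%:~R) by apply: sA => /= h; apply: nPx; rewrite -(hPz n); exact: h.
case: (leP 0 n) => n0.
  exists (`|n|%N.*2.+1) => //=; rewrite /shiftr /c /= odd_double /= uphalf_double.
  by rewrite natr_absz ger0_norm.
exists (`|n|%N.*2) => //=; rewrite /shiftr /c odd_double doubleK.
by rewrite natr_absz ltr0_norm // mulrNz mulrN opprK.
Qed.
End Shift.

(** * The Riesz-Fischer theorem *)

Lemma sum_zrange_cut (V : zmodType) (F : int -> V) N M : (N <= M)%N ->
\sum_(k <- zrange M) F k - \sum_(k <- zrange N) F k =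
\sum_(k <- zrange M) (if (`|k|%N <= N)%N then 0 else F k).
Proof.
elim: M => [|M IH]; first by rewrite leqn0 => /eqP ->; rewrite subrr big1_seq // => k; rewrite mem_zrange /= => ->.
rewrite leq_eqVlt => /predU1P[->|].
  by rewrite subrr big1_seq // => k; rewrite mem_zrange /= => ->.
rewrite ltnS => NM; rewrite !sum_zrangeS -IH //.
rewrite !ifF; [|by apply/negbTE; lia|by apply/negbTE; lia].
by rewrite addrAC -(addrA (F _)).
Qed.

Section RF.
Context {R : realType}.
Notation mu := (@lebesgue_measure R).
Variables (c : int -> R[i]) (B : R).
Hypothesis cB : l2_le B c.

Let e n := \sum_(k <- zrange n) cabs (c k) ^+ 2.

(** Indices beyond which the tails of the squares are at most 16^-j.  The growth
    condition on the indices makes every frequency enter at some stage. *)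
Lemma l2_tail : exists nn : nat -> nat, [/\
  forall j n m, (nn j <= n)%N -> (n <= m)%N -> e m - e n <= (16 ^+ j)^-1,
  forall j, (nn j <= nn j.+1)%N & forall j, (j <= nn j)%N].
Proof.
have end_ : nondecreasing_seq e.
  apply/nondecreasing_seqP => n; rewrite /e sum_zrangeS.
  have := sqr_ge0 (cabs (c (- n.+1%:Z))); have := sqr_ge0 (cabs (c n.+1)); lra.
have ce : cvgn e.
  by apply: nondecreasing_is_cvgn end_ _; exists B => _ [n _ <-]; exact: cB.
have h j : exists N, forall n, (N <= n)%N -> `|limn e - e n| <= (16 ^+ j)^-1.
  have e0 : 0 < (16 ^+ j)^-1 :> R by rewrite invr_gt0 exprn_gt0.
  have /cvgrPdist_le/(_ _ e0) [N _ hN] := ce.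
  by exists N => n Nn; exact: hN.
have [f hf] := choice h.
exists (fun j => (\max_(i < j.+1) f i + j)%N); split.
- move=> j n m jn nm.
  have fn : (f j <= n)%N.
    apply: leq_trans jn; apply: leq_trans (leq_addr _ _).
    exact: (@leq_bigmax _ (fun i : 'I_j.+1 => f i) ord_max).
  have := hf j n fn; rewrite ger0_norm ?subr_ge0 ?nondecreasing_cvgn_le //.
  by apply: le_trans; rewrite lerD2r nondecreasing_cvgn_le.
- by move=> j; rewrite [in leqRHS]big_ord_recr /= leq_add // leq_maxl.
- by move=> j; rewrite leq_addl.
Qed.

Lemma trigp_zrange_diff N M : (N <= M)%N ->
  sqnorm (fun x => trigp (zrange M) c x - trigp (zrange N) c x) = 2 * pi * (e M - e N).
Proof.
move=> NM; pose c' k := if (`|k|%N <= N)%N then 0 else c k.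
have -> : (fun x => trigp (zrange M) c x - trigp (zrange N) c x) = trigp (zrange M) c'.
  apply/funext => x; rewrite /trigp sum_zrange_cut //; apply: eq_bigr => k _.
  by rewrite /c'; case: ifP => // _; rewrite mul0r.
rewrite sqnorm_trigp ?zrange_uniq //; congr (_ * _); rewrite /e sum_zrange_cut //.
by apply: eq_bigr => k _; rewrite /c'; case: ifP => //; rewrite cabs0 expr0n.
Qed.

(** Partial sums T j over frequencies up to n_j, where the remaining squares sum
    to at most 16^-j, converge almost everywhere.  Indeed G = sum_j 4^j |T
    (j + 1) - T j|^2 has integral at most 4 pi, hence is finite almost
    everywhere, and where it is finite the differences are at most G^(1/2) /
    2^j.  The limit g is set to 0 on the null set where G is infinite;
    elsewhere the same estimate gives |T j - g|^2 <= 16 G / (j + 1)^2, that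
    is, convergence in L^2 with a rate. *)
Theorem riesz_fischer : exists g, [/\ torus_fun g, L2m g, forall p, fcoef p g = c p &
  sqnorm g <= 4 * pi * B].
Proof.
have [nn [htail hmono hge]] := l2_tail.
pose T j := trigp (zrange (nn j)) c.
pose D j x := T j.+1 x - T j x.
have L2D j : L2m (D j) by apply: L2mB; exact: L2m_trigp.
have perT j : torus_fun (T j) by exact: trigp_periodic.
have perD j : torus_fun (D j) by move=> x; rewrite /D (perT j) (perT j.+1).
have p0 := @pi2_gt0 R.
have nsqD j : sqnorm (D j) <= 2 * pi * (16 ^+ j)^-1.
  by rewrite trigp_zrange_diff // ler_wpM2l ?(ltW p0) // htail.
(* The weight 4^j is small against the decay 16^-j of the integrals and yet
   makes the differences geometric. *)
pose h j x : \bar R := (4 ^+ j * cabs (D j x) ^+ 2)%:E.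
have h0 j x : (0 <= h j x)%E by rewrite lee_fin mulr_ge0 ?exprn_ge0 ?cabs_ge0.
have mh j : measurable_fun setT (h j).
  apply/measurable_EFinP; apply: measurable_funM; first exact: measurable_cst.
  by apply: meas_cabs2; case: (L2D j).
pose G x : \bar R := (\sum_(j <oo) h j x)%E.
have mG : measurable_fun setT G by apply: ge0_emeasurable_sum => // j x _ _; exact: h0.
have G0 x : (0 <= G x)%E by apply: nneseries_ge0 => j _ _; exact: h0.
have intG : (\int[mu]_(x in torus) G x <= (4 * pi)%:E)%E.
  have mhT j : measurable_fun torus (h j) by apply: measurable_funTS.
  rewrite (integral_nneseries mu torus_meas mhT (fun j x _ => h0 j x)).
  apply: (@le_trans _ _ (\sum_(j <oo) (2 * pi * 4^-1 ^+ j)%:E)%E).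
    apply: lee_nneseries => j _; first by move=> _; exact: integral_ge0.
    rewrite /h; under eq_integral do rewrite EFinM.
    have mD2 : measurable_fun torus (fun x => (cabs (D j x) ^+ 2)%:E).
      by apply/measurable_EFinP; apply: measurable_funTS; apply: meas_cabs2; case: (L2D j).
    have pD2 x : torus x -> (0 <= (cabs (D j x) ^+ 2)%:E)%E by move=> _; rewrite lee_fin sqr_ge0.
    rewrite (ge0_integralZl_EFin mu torus_meas pD2 mD2) ?exprn_ge0 //.
    rewrite -[X in (_ * X <= _)%E]/(L2_sqnorm (D j)) (L2_sqnormE (L2D j)) -EFinM lee_fin.
    apply: (@le_trans _ _ (4 ^+ j * (2 * pi * (16 ^+ j)^-1))).
      by rewrite ler_wpM2l ?exprn_ge0.
    have -> : 16 = 4 * 4 :> R by ring.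
    rewrite exprMn exprVn le_eqVlt; apply/orP; left; apply/eqP; field.
    by rewrite expf_neq0.
  apply: lime_le.
    by apply: is_cvg_nneseries => j _ _; rewrite lee_fin mulr_ge0 ?exprn_ge0 ?(ltW p0).
  near=> n; rewrite sumEFin lee_fin.
  have -> : \sum_(0 <= i < n) 2 * pi * 4^-1 ^+ i = series (geometric (2 * pi) 4^-1) n by [].
  rewrite geometric_seriesE; last by apply/eqP; lra.
  rewrite /= ler_pdivrMr; last by lra.
  have : 0 <= 4^-1 ^+ n :> R by rewrite exprn_ge0.
  move: (4^-1 ^+ n) p0 => z; nra.
pose E := [set x : R | (G x < +oo)%E].
have mE : measurable (E : set (measurableTypeR R)).
  have -> : E = setT `&` G @^-1` `[0%E, +oo%E[%classic.
    by rewrite setTI; apply/seteqP; split => x; rewrite /E /= in_itv /= G0.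
  by apply: mG => //; exact: emeasurable_itv.
pose T' j x : R[i] := if x \in E then T j x else 0.
have hD j x : E x -> cabs (D j x) <= Num.sqrt (fine (G x)) / 2 ^+ j.
  move=> Ex; have Gf : G x = (fine (G x))%:E by rewrite fineK // ge0_fin_numE.
  have hj : 4 ^+ j * cabs (D j x) ^+ 2 <= fine (G x).
    rewrite -lee_fin -Gf -/(h j x) /G.
    apply: le_trans (nneseries_lim_ge j.+1 _); last by move=> k _ _; exact: h0.
    rewrite big_nat_recr //= leeDr //; exact: sume_ge0.
  have g0 : 0 <= fine (G x) by rewrite fine_ge0.
  rewrite ler_pdivlMr ?exprn_gt0 // mulrC.
  rewrite -(ler_pXn2r (ltn0Sn 1)) ?nnegrE ?mulr_ge0 ?exprn_ge0 ?cabs_ge0 ?sqrtr_ge0 //.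
  rewrite sqr_sqrtr // exprMn -exprM mulnC exprM.
  by have -> : 2 ^+ 2 = 4 :> R by rewrite expr2; ring.
have cau x : E x -> forall i m, (i <= m)%N ->
    cabs (T m x - T i x) <= 2 * Num.sqrt (fine (G x)) / i.+1%:R.
  move=> Ex i m im; set s := Num.sqrt _.
  have s0 : 0 <= s by exact: sqrtr_ge0.
  have : cabs (T m x - T i x) <= 2 * s * ((2 ^+ i)^-1 - (2 ^+ m)^-1).
    elim: m im => [|m IH]; first by rewrite leqn0 => /eqP->; rewrite !subrr mulr0 cabs0.
    rewrite leq_eqVlt => /predU1P[->|]; first by rewrite !subrr mulr0 cabs0.
    rewrite ltnS => /IH hh; rewrite -(subrKA (T m x)) addrC.
    apply: le_trans (cabsD _ _) _; apply: le_trans (lerD hh (hD m x Ex)) _.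
    rewrite -/s exprSr invfM; move: ((2 ^+ m)^-1) ((2 ^+ i)^-1) => a b; lra.
  move=> hh; apply: le_trans hh _; rewrite ler_wpM2l ?mulr_ge0 //.
  apply: le_trans (pow2_archi i); rewrite lerBlDr lerDl invr_ge0.
  by rewrite exprn_ge0.
pose g x : R[i] := limn (fun j => complex.Re (T' j x)) +i* limn (fun j => complex.Im (T' j x)).
have T'E j x : E x -> T' j x = T j x by move=> Ex; rewrite /T' mem_set.
have T'N j x : ~ E x -> T' j x = 0 by move=> Ex; rewrite /T' memNset.
have cau' x : forall i m, (i <= m)%N ->
    cabs (T' m x - T' i x) <= 2 * Num.sqrt (fine (G x)) / i.+1%:R.
  move=> i m im; have [Ex|Ex] := pselect (E x); first by rewrite !T'E //; exact: cau.
  by rewrite !T'N // subrr cabs0 divr_ge0 // mulr_ge0 // sqrtr_ge0.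
have hg x i : cabs (T' i x - g x) <= 2 * (2 * Num.sqrt (fine (G x))) / i.+1%:R.
  exact: (ccauchy_lim (cau' x)).
have perG x : G (x + 2 * pi) = G x.
  by rewrite /G; apply: eq_eseriesr => j _; rewrite /h perD.
have perE x : E (x + 2 * pi) <-> E x by rewrite /E /= perG.
have perT' j x : T' j (x + 2 * pi) = T' j x.
  have [Ex|Ex] := pselect (E x); first by rewrite !T'E // ?perE // (perT j).
  by rewrite !T'N // perE.
have perg : torus_fun g.
  by move=> x; rewrite /g; under eq_fun do rewrite perT'; under [X in _ +i* limn X]eq_fun do rewrite perT'.
have mT' j : cmeas (T' j).
  have [m1 m2] := cmeas_trigp (zrange (nn j)) c; split.
    have -> : (fun x => complex.Re (T' j x)) = (fun x => complex.Re (T j x)) \_ E.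
      by apply/funext => x; rewrite /T' patchE; case: ifP.
    by apply/(measurable_restrictT _ _).1 => //; exact: measurable_funTS.
  have -> : (fun x => complex.Im (T' j x)) = (fun x => complex.Im (T j x)) \_ E.
    by apply/funext => x; rewrite /T' patchE; case: ifP.
  by apply/(measurable_restrictT _ _).1 => //; exact: measurable_funTS.
have mg : cmeas g.
  split.
    apply: (measurable_fun_cvg (h := fun j x => complex.Re (T' j x))) => [j|x _].
      by case: (mT' j).
    apply: (@cauchy_lim _ _ (2 * Num.sqrt (fine (G x)))) => i m im.
    apply: le_trans (cau' x i m im); rewrite -cReN -cReD; exact: normRe_le.
  apply: (measurable_fun_cvg (h := fun j x => complex.Im (T' j x))) => [j|x _].
    by case: (mT' j).
  apply: (@cauchy_lim _ _ (2 * Num.sqrt (fine (G x)))) => i m im.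
  apply: le_trans (cau' x i m im); rewrite -cImN -cImD; exact: normIm_le.
have iG : mu.-integrable torus G.
  apply/integrableP; split; first exact: measurable_funTS.
  under eq_integral => x _ do rewrite gee0_abs //.
  by apply: le_lt_trans intG _; rewrite ltry.
have aeE : {ae mu, forall x : R, torus x -> E x}.
  have := integrable_ae torus_meas iG; apply: filterS.
  by move=> x hx /hx; rewrite /E /= fin_numElt => /andP[].
(* Bounding the square pointwise by G avoids any limit under the integral. *)
have sqle i : (L2_sqnorm (fun x => (g x - T i x)%R) <= (64 * pi / i.+1%:R ^+ 2)%:E)%E.
  pose K : R := 16 / i.+1%:R ^+ 2.
  have K0 : 0 <= K by rewrite divr_ge0 // exprn_ge0.
  apply: (@le_trans _ _ (\int[mu]_(x in torus) (K%:E * G x))%E); last first.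
    have mGT : measurable_fun torus G by apply: measurable_funTS.
    rewrite (ge0_integralZl_EFin mu torus_meas (fun x _ => G0 x) mGT) //.
    apply: le_trans (lee_wpmul2l _ intG) _; first by rewrite lee_fin.
    by rewrite -EFinM lee_fin le_eqVlt; apply/orP; left; apply/eqP; rewrite /K; ring.
  apply: ae_ge0_le_integral.
  - exact: torus_meas.
  - by move=> x _; rewrite lee_fin sqr_ge0.
  - apply/measurable_EFinP; apply: measurable_funTS; apply: meas_cabs2.
    by apply: cmeasB => //; exact: cmeas_trigp.
  - by move=> x _; rewrite mule_ge0 // lee_fin.
  - by apply: measurable_funeM; exact: measurable_funTS.
  - move: aeE; apply: filterS; first exact: (ae_filter_ringOfSetsType mu).
    move=> x hx /hx Ex; have Gf : G x = (fine (G x))%:E by rewrite fineK // ge0_fin_numE.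
    rewrite Gf -EFinM lee_fin cabsC -(T'E i x Ex).
    apply: (@le_trans _ _ ((2 * (2 * Num.sqrt (fine (G x))) / i.+1%:R) ^+ 2)).
      by rewrite lerXn2r ?nnegrE ?cabs_ge0 ?divr_ge0 ?mulr_ge0 ?sqrtr_ge0.
    rewrite !exprMn sqr_sqrtr ?fine_ge0 // exprVn /K.
    by rewrite le_eqVlt; apply/orP; left; apply/eqP; ring.
have L2gT i : L2m (fun x => g x - T i x).
  split; first by apply: cmeasB => //; exact: cmeas_trigp.
  by apply: le_lt_trans (sqle i) _; rewrite ltry.
have nsqgT i : sqnorm (fun x => g x - T i x) <= 64 * pi / i.+1%:R ^+ 2.
  by rewrite -lee_fin -L2_sqnormE.
have L2g : L2m g.
  have := L2mD (L2gT 0%N) (L2m_trigp (zrange (nn 0%N)) c).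
  by under eq_fun do rewrite subrK.
exists g; split => //.
- move=> p; apply: (@eq_archi _ _ _ 6) => N.
  pose i := maxn N `|p|%N.
  have e1 : fcoef p (fun x => g x - T i x) = fcoef p g - c p.
    rewrite fcoefB; [|exact: L2m_cint|exact/L2m_cint/L2m_trigp].
    rewrite fcoef_trigp ?zrange_uniq // mem_zrange ifT //.
    by apply: leq_trans (hge i); rewrite leq_maxr.
  have := l2_le_coef p (bessel_l2_le (L2gT i)); rewrite e1 => h1.
  have h2 : cabs (fcoef p g - c p) ^+ 2 <= (6 / N.+1%:R) ^+ 2.
    apply: le_trans h1 _; rewrite ler_pdivrMr //.
    apply: le_trans (nsqgT i) _.
    have Ni : (i.+1%:R ^+ 2)^-1 <= (N.+1%:R ^+ 2)^-1 :> R.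
      rewrite lef_pV2 ?posrE ?exprn_gt0 ?ltr0n // lerXn2r ?nnegrE //.
      by rewrite ler_nat ltnS leq_maxl.
    have := pi_gt0 R; rewrite expr_div_n => pp.
    apply: (@le_trans _ _ (64 * pi * (N.+1%:R ^+ 2)^-1)).
      by rewrite ler_wpM2l // mulr_ge0 // ltW.
    have : 0 <= (N.+1%:R ^+ 2)^-1 :> R by rewrite invr_ge0 exprn_ge0.
    move: (_^-1) => z z0; nra.
  rewrite -(ler_pXn2r (ltn0Sn 1)) ?nnegrE ?cabs_ge0 // divr_ge0 //.
- rewrite -subr_le0; apply: (@archi0 _ _ (128 * pi)) => i.
  have -> : g = fun x => (g x - T i x) + T i x by apply/funext => x; rewrite subrK.
  rewrite lerBlDr; apply: le_trans (sqnormD (L2gT i) (L2m_trigp _ _)) _.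
  apply: lerD.
    have h1 := nsqgT i.
    have h2 : (i.+1%:R ^+ 2)^-1 <= i.+1%:R^-1 :> R.
      rewrite lef_pV2 ?posrE ?exprn_gt0 ?ltr0n // -natrX ler_nat.
      by rewrite -{1}(expn1 i.+1) leq_pexp2l.
    have := pi_gt0 R; move: h1 h2; move: (_ ^-1) (_ ^-1) => z w; nra.
  rewrite sqnorm_trigp ?zrange_uniq //.
  have -> : 4 * pi * B = 2 * (2 * pi * B) by ring.
  by rewrite ler_wpM2l // ler_wpM2l ?(ltW p0) //; exact: cB.
Unshelve. all: by end_near. Qed.
End RF.

(** * Parseval's inequality and the convolution theorem *)

Section Parseval.
Context {R : realType}.
Notation mu := (@lebesgue_measure R).
Implicit Types f g h : R -> R[i].

Lemma fcoef_inj_torus f g : L2m f -> L2m g ->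
  (forall p : int, fcoef p f = fcoef p g) -> {ae mu, forall x : R, torus x -> f x = g x}.
Proof.
move=> hf hg h.
have hu p : fcoef p (fun x => f x - g x) = 0.
  by rewrite fcoefB ?h ?subrr //; exact: L2m_cint.
have := fcoef_ae0 (L2m_cint (L2mB hf hg)) hu.
apply: filterS; first exact: (ae_filter_ringOfSetsType mu).
by move=> x hx /hx /eqP; rewrite subr_eq0 => /eqP.
Qed.

Lemma fcoef_inj f g : L2 f -> L2 g ->
  (forall p : int, fcoef p f = fcoef p g) -> ae_equal f g.
Proof.
move=> /L2E[pf hf] /L2E[pg hg] h; apply: periodic_ae (fcoef_inj_torus hf hg h).
by move=> x; rewrite pf pg.
Qed.

Lemma sqnorm_ae f g : cmeas f -> cmeas g ->
  {ae mu, forall x : R, torus x -> f x = g x} -> sqnorm f = sqnorm g.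
Proof.
move=> mf mg h; congr fine; apply: ge0_ae_eq_integral.
- exact: torus_meas.
- by apply/measurable_EFinP; apply: measurable_funTS; exact: meas_cabs2.
- by apply/measurable_EFinP; apply: measurable_funTS; exact: meas_cabs2.
- by move=> x _; rewrite lee_fin sqr_ge0.
- by move=> x _; rewrite lee_fin sqr_ge0.
- move: h; apply: filterS; first exact: (ae_filter_ringOfSetsType mu).
  by move=> x hx /hx ->.
Qed.

Lemma ae_torus f g : ae_equal f g -> {ae mu, forall x : R, torus x -> f x = g x}.
Proof.
apply: filterS; first exact: (ae_filter_ringOfSetsType mu).
by move=> x -> _.
Qed.

Lemma fcoef_ae p f g : L2m f -> L2m g -> ae_equal f g -> fcoef p f = fcoef p g.
Proof.
move=> hf hg h; apply/eqP; rewrite -subr_eq0 -fcoefB; try exact: L2m_cint.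
apply/eqP/cabs_eq0.
have hfg := L2mB hf hg.
have := l2_le_coef p (bessel_l2_le hfg).
have -> : sqnorm (fun x => f x - g x) = 0.
  have -> : 0 = sqnorm (fun _ : R => 0 : R[i]).
    rewrite /sqnorm; under eq_Rintegral do rewrite cabs0 expr0n.
    by rewrite Rintegral_cst ?mul0r //; exact: torus_meas.
  apply: sqnorm_ae; [by case: hfg|exact: cmeas_cst|].
  move: (ae_torus h); apply: filterS; first exact: (ae_filter_ringOfSetsType mu).
  by move=> x hx /hx ->; rewrite subrr.
by rewrite mul0r; have := cabs_ge0 (fcoef p (fun x => f x - g x)); nra.
Qed.

(** Riesz-Fischer builds a function with the same coefficients and this norm
    bound; uniqueness identifies it with h.  The constant is twice the
    optimal one, which is harmless. *)
Lemma parseval_le B h : L2m h -> l2_le B (fcoef^~ h) -> sqnorm h <= 4 * pi * B.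
Proof.
move=> hh hB; have [g [_ L2g fcg ng]] := riesz_fischer hB.
rewrite (@sqnorm_ae h g) //; [by case: hh|by case: L2g|].
by apply: fcoef_inj_torus => // p; rewrite fcg.
Qed.

Lemma cmeas_sumZ C (F : int -> R -> R[i]) : (forall k, cmeas (F k)) ->
  (forall x, domw C (F^~ x)) -> cmeas (fun x => sumZ (F^~ x)).
Proof.
move=> mF hd; pose S x := sumZ (F^~ x).
have cau x i m : (i <= m)%N -> cabs (psum (F^~ x) m - psum (F^~ x) i) <= 2 * C / i.+1%:R.
  exact: psum_cauchy.
have hS x : S x = limn (fun N => complex.Re (psum (F^~ x) N)) +i*
    limn (fun N => complex.Im (psum (F^~ x) N)).
  by rewrite /S /sumZ /psum; congr (limn _ +i* limn _);
    apply/funext => N; rewrite sum_zrangeE.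
have mP N : cmeas (fun x => psum (F^~ x) N) by exact: cmeas_sum.
split; (under eq_fun do rewrite -/(S _) hS); rewrite /=.
  apply: (measurable_fun_cvg (h := fun N x => complex.Re (psum (F^~ x) N))) => [N|x _].
    by case: (mP N).
  apply: (@cauchy_lim _ _ (2 * C)) => i m im.
  apply: le_trans (cau x i m im); rewrite -cReN -cReD; exact: normRe_le.
apply: (measurable_fun_cvg (h := fun N x => complex.Im (psum (F^~ x) N))) => [N|x _].
  by case: (mP N).
apply: (@cauchy_lim _ _ (2 * C)) => i m im.
apply: le_trans (cau x i m im); rewrite -cImN -cImD; exact: normIm_le.
Qed.

(** Partial sums approximate the sum uniformly, with an explicit rate. *)
Lemma fcoef_sumZ C (F : int -> R -> R[i]) p : (forall k, cmeas (F k)) ->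
  (forall x, domw C (F^~ x)) ->
  fcoef p (fun x => sumZ (F^~ x)) = sumZ (fun k => fcoef p (F k)).
Proof.
move=> mF hd; have mS := cmeas_sumZ mF hd.
have C0 : 0 <= C := domw_ge0 (hd 0).
have iS : cint (fun x => sumZ (F^~ x)).
  by apply: (@cint_bounded _ _ (4 * C)) => // x; exact: sumZ_le_dom.
have iF k : cint (F k).
  apply: (@cint_bounded _ _ C) => // x; apply: le_trans (hd x k) _.
  by rewrite ler_piMr // wt_le1.
have dfc : domw (2 * C) (fun k => fcoef p (F k)).
  by move=> k; rewrite -mulrA; apply: fcoef_le => // x; exact: hd.
apply/esym; apply: (@sumZ_unique _ _ (2 * (4 * C)) _ _ dfc) => N.
rewrite /psum -fcoef_sum // -fcoefB //; last exact: cint_sum.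
rewrite -(mulrA 2); apply: fcoef_le; last by move=> x; exact: sumZ_tail.
by apply: cintB => //; exact: cint_sum.
Qed.

(** The sum of the Fourier series has the same coefficients as g, so it agrees
    with g almost everywhere. *)
Lemma fourier_series C g : L2m g -> domw C (fcoef^~ g) ->
  {ae mu, forall x : R, torus x -> g x = sumZ (fun k => fcoef k g * expi k x)}.
Proof.
move=> hg hd; pose F k x := fcoef k g * expi k x.
have hdF x : domw C (F^~ x) by move=> k; rewrite /F cabsM cabs_expi mulr1.
have mF k : cmeas (F k) by exact/cmeasZ/cmeas_expi.
apply: fcoef_inj_torus => //.
  apply: (L2m_bounded (M := 4 * C) (cmeas_sumZ mF hdF)) => x; exact: sumZ_le_dom.
move=> p; rewrite (fcoef_sumZ p mF hdF).
have -> : (fun k => fcoef p (F k)) = fun k => (p == k)%:R * fcoef k g.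
  apply/funext => k; rewrite /F fcoefZ ?fcoef_expi 1?mulrC //; exact/L2m_cint/L2m_expi.
by rewrite sumZ_delta.
Qed.

(** Expand b times the k-th exponential in its absolutely convergent Fourier
    series and integrate a times it term by term.  Three derivatives give
    the summable decay. *)
Lemma convolution M M' (a b : R -> R[i]) l k : Cb 3 M a -> Cb 3 M' b ->
  sumZ (fun j => fcoef (l - j) a * fcoef (j - k) b) = fcoef (l - k) (fun x => a x * b x).
Proof.
move=> ha hb; have M0 := Cb_ge0 ha; have M'0 := Cb_ge0 hb.
have ma : cmeas a by case: (Cb_cint ha).
have mb : cmeas b by case: (Cb_cint hb).
pose G x := b x * expi k x.
have mG : cmeas G by apply: cmeasM => //; exact: cmeas_expi.
have bG x : cabs (G x) <= M' by rewrite /G cabsM cabs_expi mulr1; exact: Cb_bound hb.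
have fcG j : fcoef j G = fcoef (j - k) b by exact: fcoef_shift.
have dG : domw (2 ^+ 3 * M' * jap k ^+ 2) (fcoef^~ G).
  move=> j; rewrite fcG; apply: le_trans (fcoef_decay (j - k) hb) _.
  by rewrite -(mulrA _ (jap k ^+ 2)) ler_wpM2l ?mulr_ge0 ?exprn_ge0 // wt_shift.
have hG := fourier_series (L2m_bounded mG bG) dG.
pose F j x := a x * (fcoef j G * expi j x).
have mF j : cmeas (F j) by apply: cmeasM => //; exact/cmeasZ/cmeas_expi.
have hdF x : domw (M * (2 ^+ 3 * M' * jap k ^+ 2)) (F^~ x).
  move=> j; rewrite /F cabsM (cabsM (fcoef j G)) cabs_expi mulr1 -mulrA.
  by apply: ler_pM; rewrite ?cabs_ge0 //; first [exact: dG | exact: Cb_bound ha].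
have e1 : fcoef l (fun x => a x * G x) = fcoef (l - k) (fun x => a x * b x).
  by rewrite -fcoef_shift; congr fcoef; apply/funext => x; rewrite /G mulrA.
rewrite -e1.
have -> : fcoef l (fun x => a x * G x) = fcoef l (fun x => sumZ (F^~ x)).
  rewrite /fcoef; congr (_ * _).
  have mS := cmeas_sumZ mF hdF.
  have ae1 : {ae mu, forall x : R, torus x ->
     a x * G x * expi (- l) x = sumZ (F^~ x) * expi (- l) x}.
    move: hG; apply: filterS; first exact: (ae_filter_ringOfSetsType mu).
    move=> x hx /hx ->; congr (_ * _); rewrite /F.
    rewrite (sumZZ (C := 2 ^+ 3 * M' * jap k ^+ 2)) // => j.
    by rewrite cabsM cabs_expi mulr1.
  have [m1 m2] : cmeas (fun x => a x * G x * expi (- l) x).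
    by apply: cmeasM; [exact: cmeasM|exact: cmeas_expi].
  have [m3 m4] : cmeas (fun x => sumZ (F^~ x) * expi (- l) x).
    by apply: cmeasM => //; exact: cmeas_expi.
  apply: complex_eq; rewrite /torus_int /=; congr fine; apply: ae_eq_integral;
    try exact: torus_meas; try (apply/measurable_EFinP; exact: measurable_funTS);
    (move: ae1; apply: filterS; first exact: (ae_filter_ringOfSetsType mu));
    by move=> x hx /hx ->.
rewrite (fcoef_sumZ l mF hdF); congr sumZ; apply/funext => j.
rewrite -fcG -fcoef_shift mulrC -fcoefZ; last exact/cint_expi/Cb_cint/ha.
by congr fcoef; apply/funext => x; rewrite /F mulrCA.
Qed.
End Parseval.

(** * Smooth periodic functions *)

Section Smooth.
Context {R : realType}.
Implicit Types (f g : R -> R[i]) (x : R).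

(** The sequence D of successive derivatives is given, which converts bounds on
    iterated derivatives into the inductive form. *)
Lemma Cb_seq n M (D : nat -> R -> R[i]) : (forall i, torus_fun (D i)) ->
  (forall i x, is_cderiv (D i) x (D i.+1 x)) ->
  (forall i x, (i <= n)%N -> cabs (D i x) <= M) -> Cb n M (D 0%N).
Proof.
move=> hp hd; have H : forall m i, (forall j x, (j <= m)%N -> cabs (D (i + j)%N x) <= M) ->
    Cb m M (D i).
  elim=> [|m IH] i hb; split => //; try (by move=> x; have := hb 0%N x isT; rewrite addn0).
  exists (D i.+1); first exact: hd.
  by apply: IH => j x jm; have := hb j.+1 x jm; rewrite addnS addSn.
by move=> hb; apply: H => j x jn; rewrite add0n; exact: hb.
Qed.

Lemma derive1_periodic (f : R -> R) (T : R) : (forall x, f (x + T) = f x) ->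
  forall x, derive1 f (x + T) = derive1 f x.
Proof.
by move=> h x; rewrite /derive1; under eq_fun do rewrite /= addrA !h.
Qed.

Lemma derive1n_periodic (f : R -> R) (T : R) n : (forall x, f (x + T) = f x) ->
  forall x, derive1n n f (x + T) = derive1n n f x.
Proof.
move=> h; elim: n => [|n IH] x; first by rewrite derive1n0.
by rewrite derive1nS; exact: derive1_periodic.
Qed.

Lemma cderive_periodic n g : torus_fun g -> torus_fun (cderive n g).
Proof.
move=> h x; rewrite /cderive !derive1n_periodic // => y; by rewrite h.
Qed.

Lemma cderive0 g : cderive 0 g = g.
Proof. by apply/funext => x; rewrite /cderive !derive1n0; case: (g x). Qed.

Lemma is_cderiv_cderive n g x : smooth g -> is_cderiv (cderive n g) x (cderive n.+1 g x).
Proof.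
move=> h; have [h1 h2] := h n x; split; rewrite /cderive /= derive1E.
  exact: derivableP.
exact: derivableP.
Qed.

Lemma smooth_seq (D : nat -> R -> R[i]) : (forall i x, is_cderiv (D i) x (D i.+1 x)) ->
  smooth (D 0%N).
Proof.
move=> hd.
have hre n : derive1n n (fun y => complex.Re (D 0%N y)) = fun y => complex.Re (D n y).
  elim: n => [|n IH]; first by rewrite derive1n0.
  rewrite derive1nS IH; apply/funext => x; rewrite derive1E.
  by have [h _] := hd n x; exact: (@derive_val _ _ _ _ _ _ _ h).
have him n : derive1n n (fun y => complex.Im (D 0%N y)) = fun y => complex.Im (D n y).
  elim: n => [|n IH]; first by rewrite derive1n0.
  rewrite derive1nS IH; apply/funext => x; rewrite derive1E.
  by have [_ h] := hd n x; exact: (@derive_val _ _ _ _ _ _ _ h).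
move=> n x; rewrite hre him; have [h1 h2] := hd n x.
by split; [exact: (@ex_derive _ _ _ _ _ _ _ h1)|exact: (@ex_derive _ _ _ _ _ _ _ h2)].
Qed.

Lemma is_cderiv_sum (I : Type) (s : seq I) (F : I -> R -> R[i]) (d : I -> R[i]) x :
  (forall i, is_cderiv (F i) x (d i)) -> is_cderiv (fun y => \sum_(i <- s) F i y) x (\sum_(i <- s) d i).
Proof.
move=> h; elim: s => [|i s IH].
  by under eq_fun do rewrite big_nil; rewrite big_nil; exact: is_cderiv_cst.
by under eq_fun do rewrite big_cons; rewrite big_cons; exact: is_cderivD.
Qed.

Lemma smooth_trigp s (c : int -> R[i]) : smooth_torus (trigp s c).
Proof.
split; first exact: trigp_periodic.
pose D (n : nat) := trigp s (fun k => c k * (0 +i* k%:~R) ^+ n).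
have -> : trigp s c = D 0%N.
  by apply/funext => x; apply: eq_bigr => k _; rewrite expr0 mulr1.
apply: smooth_seq => n x; rewrite /D /trigp; apply: is_cderiv_sum => k.
rewrite exprSr -!mulrA mulrA -[in X in is_cderiv _ _ X]mulrA mulrA; exact: is_cderivZ (is_cderiv_expi k x).
Qed.

Lemma periodic_bounded (f : R -> R) : (forall x, f (x + 2 * pi) = f x) ->
  continuous f -> exists M, forall x, `|f x| <= M.
Proof.
move=> hp cf; have p0 := @pi2_gt0 R.
have [M hM] : exists M, forall x, x \in `[0, 2 * pi] -> `|f x| <= M.
  have cn : {within `[0, 2 * pi], continuous (fun x => `|f x|)}.
    apply: continuous_subspaceT => x; apply: continuous_comp; first exact: cf.
    exact: norm_continuous.
  have [z _ hz] := EVT_max (ltW p0) cn.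
  by exists `|f z| => x hx; exact: hz.
exists M => x; have [n hx] := torus_shift x.
by rewrite -(periodic_int hp n) hM.
Qed.

Lemma smooth_Cb n g : smooth_torus g -> exists M, Cb n M g.
Proof.
move=> [pg sg].
have hb i : exists M, forall x, cabs (cderive i g x) <= M.
  have [c1 c2] := is_cderiv_cont (fun x => is_cderiv_cderive i x sg).
  have pi_ := cderive_periodic i pg.
  have [M1 h1] := periodic_bounded (fun x => congr1 (@complex.Re R) (pi_ x)) c1.
  have [M2 h2] := periodic_bounded (fun x => congr1 (@complex.Im R) (pi_ x)) c2.
  by exists (M1 + M2) => x; apply: le_trans (cabs_le _) _; apply: lerD; [exact: h1|exact: h2].
have [f hf] := choice hb.
exists (\sum_(i < n.+1) `|f i|); rewrite -[g]cderive0.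
apply: (@Cb_seq n _ (fun i => cderive i g)).
- by move=> i; exact: cderive_periodic.
- by move=> i x; exact: is_cderiv_cderive.
- move=> i x i_n; apply: le_trans (hf i x) _; apply: le_trans (ler_norm _) _.
  have iO : (i < n.+1)%N by [].
  by rewrite (bigD1 (Ordinal iO)) //= lerDl sumr_ge0.
Qed.
End Smooth.

(** * Elliptic symbols with a large spectral parameter *)

Section Symbol.
Context {R : realType}.
Variables (mu rho : R) (Lam : int -> R).
Hypothesis hLam : weight_function mu Lam.
Hypothesis rho_gt0 : 0 < rho.
Variables (m : R) (sigma : R -> int -> R[i]).
Hypothesis hsigma : S_class rho Lam (2 * m) sigma.
Hypothesis hell : strongly_elliptic Lam (2 * m) sigma.

Let Lam0 k : 0 < Lam k. Proof. by case: hLam. Qed.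
Let V k := Lam k `^ (2 * m - rho).

Lemma symbol_Cb n : exists2 C, 0 <= C & forall k, Cb n (C * Lam k `^ (2 * m)) (sigma^~ k).
Proof.
have [hs hd] := hsigma.
have h i : exists C, 0 < C /\ forall x k, cabs (cderive i (sigma^~ k) x) <= C * Lam k `^ (2 * m).
  have [C C0 hC] := hd 0%N i; exists C; split=> // x k.
  by have := hC x k; rewrite /= mulr0 subr0.
have [f hf] := choice h.
exists (\sum_(i < n.+1) f i); first by rewrite sumr_ge0 // => i _; case: (hf i) => /ltW.
move=> k; have [pk sk] := hs k; rewrite -[sigma^~ k]cderive0.
apply: (@Cb_seq _ n _ (fun i => cderive i (sigma^~ k))).
- by move=> i; exact: cderive_periodic.
- by move=> i x; exact: is_cderiv_cderive.
- move=> i x i_n; apply: le_trans ((hf i).2 x k) _; rewrite ler_wpM2r ?powR_ge0 //.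
  have iO : (i < n.+1)%N by [].
  by rewrite (bigD1 (Ordinal iO)) //= lerDl sumr_ge0 // => j _; case: (hf j) => /ltW.
Qed.

(** One difference in the frequency, which gains the factor Lam^-rho. *)
Lemma symbol_diff_Cb n : exists2 C, 0 <= C & forall k,
  Cb n (C * Lam k `^ (2 * m - rho)) (fun x => sigma x (k + 1) - sigma x k).
Proof.
have [hs hd] := hsigma.
have h i : exists C, 0 < C /\ forall x k,
    cabs (cderive i (sigma^~ (k + 1)) x - cderive i (sigma^~ k) x) <= C * Lam k `^ (2 * m - rho).
  have [C C0 hC] := hd 1%N i; exists C; split=> // x k.
  by have := hC x k; rewrite /= mulr1.
have [f hf] := choice h.
exists (\sum_(i < n.+1) f i); first by rewrite sumr_ge0 // => i _; case: (hf i) => /ltW.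
move=> k; have [pk sk] := hs k; have [pk1 sk1] := hs (k + 1).
have -> : (fun x => sigma x (k + 1) - sigma x k) =
    (fun x => cderive 0 (sigma^~ (k + 1)) x - cderive 0 (sigma^~ k) x).
  by rewrite !cderive0.
apply: (@Cb_seq _ n _ (fun i x => cderive i (sigma^~ (k + 1)) x - cderive i (sigma^~ k) x)).
- by move=> i x; rewrite !cderive_periodic.
- by move=> i x; apply: is_cderivB; exact: is_cderiv_cderive.
- move=> i x i_n; apply: le_trans ((hf i).2 x k) _; rewrite ler_wpM2r ?powR_ge0 //.
  have iO : (i < n.+1)%N by [].
  by rewrite (bigD1 (Ordinal iO)) //= lerDl sumr_ge0 // => j _; case: (hf j) => /ltW.
Qed.

Lemma Cb_cst n (c : R[i]) : Cb n (cabs c) (fun=> c).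
Proof.
elim: n c => [|n IH] c; split => //.
exists (fun=> 0); first by move=> x; exact: is_cderiv_cst.
by apply: CbW (IH 0); rewrite cabs0 cabs_ge0.
Qed.

(** For |k| >= K the real parts of sigma and lam add up.  For the finitely many
    other k the symbol is bounded, and lam dominates once it is large. *)
Lemma elliptic_lower : exists2 c, 0 < c & exists2 l1, 0 < l1 &
  forall lam, l1 <= lam -> forall x k,
    c * (Lam k `^ (2 * m) + lam) <= cabs (sigma x k + lam%:C).
Proof.
have [C [K [C0 K0 hCK]]] := hell.
have [C1 C10 hC1] := symbol_Cb 0.
have [KP [MP hP]] := weight_peetre hLam.
have [K' [M' hP']] := peetre_pow (2 * m) Lam0 hP.
have K'1 := peetre_ge1 (fun k => powR_gt0 (2 * m) (Lam0 k)) hP'.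
pose X := K' * Lam 0 `^ (2 * m) * (1 + K) ^+ M'.
have X0 : 0 <= X by rewrite !mulr_ge0 ?powR_ge0 ?exprn_ge0 //; lra.
exists (Num.min C 4^-1); first by rewrite lt_min C0 /=; lra.
exists (2 * (C1 + 1) * X + 1); first by have := mulr_ge0 C10 X0; lra.
move=> lam hlam x k.
have CX := mulr_ge0 C10 X0.
have lam0 : 0 < lam by lra.
apply: le_trans (normRe_le _); apply: le_trans (ler_norm _); rewrite cReD /=.
set c := Num.min C 4^-1.
have cC : c <= C by rewrite /c ge_min lexx.
have c4 : c <= 4^-1 by rewrite /c ge_min lexx orbT.
have L0 : 0 <= Lam k `^ (2 * m) by exact: powR_ge0.
have c0 : 0 < c by rewrite lt_min C0 /=; lra.
have [Kk|kK] := leP K `|k%:~R|.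
  by apply: le_trans (lerD (hCK x k Kk) (lexx _)); nra.
have LX : Lam k `^ (2 * m) <= X.
  apply: le_trans (hP' k 0) _; rewrite subr0 ler_wpM2l ?mulr_ge0 ?powR_ge0 //; first by lra.
  by rewrite lerXn2r ?nnegrE ?jap_ge0 // /jap; lra.
have h1 := Cb_bound x (hC1 k).
have h2 : - (C1 * X) <= complex.Re (sigma x k).
  have := normRe_le (sigma x k); rewrite ler_norml => /andP[h3 _].
  have : C1 * Lam k `^ (2 * m) <= C1 * X by rewrite ler_wpM2l.
  by move: h1 h3 => /=; lra.
have : c * (Lam k `^ (2 * m) + lam) <= 4^-1 * (X + lam).
  by apply: ler_pM; lra.
by lra.
Qed.

(** Where Lam >= d^(-1/rho) the quotient is at most Lam^-rho <= d.  Elsewhere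
    Lam lies between two positive constants, so V is bounded and a large lam
    makes the quotient small. *)
Lemma lower_order_small d : 0 < d -> exists2 l2, 0 < l2 & forall lam, l2 <= lam ->
  forall k, V k * (Lam k `^ (2 * m) + lam)^-1 <= d.
Proof.
move=> d0; have [c c0 hc] := weight_lower hLam.
pose X := d `^ (- rho^-1); have X0 : 0 < X by exact: powR_gt0.
pose s := 2 * m - rho.
exists ((X `^ s + c `^ s) / d + 1).
  by rewrite ltr_wpDl // divr_ge0 ?addr_ge0 ?powR_ge0 // ltW.
move=> lam hlam k.
have hl : (X `^ s + c `^ s) / d <= lam by lra.
have lam0 : 0 < lam.
  by apply: lt_le_trans hlam; rewrite ltr_wpDl // divr_ge0 ?addr_ge0 ?powR_ge0 // ltW.
have L0 : 0 <= Lam k `^ (2 * m) by exact: powR_ge0.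
rewrite ler_pdivrMr; last by lra.
have [XL|LX] := leP X (Lam k).
  have -> : V k = Lam k `^ (- rho) * Lam k `^ (2 * m).
    by rewrite /V addrC powRD // (gt_eqF (Lam0 k)) implybT.
  have h : Lam k `^ (- rho) <= d.
    have -> : d = X `^ (- rho).
      by rewrite /X -powRrM mulrN mulNr opprK mulVf ?gt_eqF // powRr1 // ltW.
    rewrite !powRN lef_pV2 ?posrE ?powR_gt0 //.
    by rewrite ge0_ler_powR ?nnegrE ?(ltW rho_gt0) ?(ltW X0) ?(ltW (Lam0 k)).
  by apply: le_trans (ler_wpM2r L0 h) _; rewrite ler_wpM2l ?(ltW d0) //; lra.
have h : V k <= X `^ s + c `^ s.
  rewrite /V -/s; have [s0|s0] := leP 0 s.
    apply: (@le_trans _ _ (X `^ s)); last by rewrite lerDl powR_ge0.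
    by rewrite ge0_ler_powR ?nnegrE ?(ltW X0) ?(ltW (Lam0 k)) ?(ltW LX).
  apply: (@le_trans _ _ (c `^ s)); last by rewrite lerDr powR_ge0.
  rewrite -(opprK s) !(powRN _ (- s)) lef_pV2 ?posrE ?powR_gt0 //.
  by rewrite ge0_ler_powR ?nnegrE ?oppr_ge0 ?(ltW s0) ?(ltW c0) ?(ltW (Lam0 k)).
apply: le_trans h _; rewrite -ler_pdivrMl // mulrC; apply: le_trans hl _.
by rewrite lerDr.
Qed.

Definition coef (s : R -> int -> R[i]) : int -> int -> R[i] := fun p k => fcoef p (s^~ k).

Lemma coef_decay N C (W : int -> R) s : (forall k, Cb N.+1 (C * W k) (s^~ k)) ->
  decay (2 ^+ N.+1 * C) N W (coef s).
Proof.
by move=> h p k; apply: le_trans (fcoef_decay p (h k)) _; rewrite (mulrA (2 ^+ N.+1)).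
Qed.

(** Everything is uniform in lam except the smallness d of V / W: the constant C
    that bounds the symbol, its reciprocal and their differences is fixed
    first, then d, then lam. *)
Theorem elliptic_invertible : exists lam0, forall lam, lam0 <= lam ->
  exists (W : int -> R) K M c,
  [/\ 0 < c /\ forall k, c <= W k, peetre K M W,
      forall n, exists2 C, 0 <= C & forall k, Cb n (C * W k) (fun x => sigma x k + lam%:C),
      forall B u, l2_le B u ->
        (forall l, kapp (symb_mx (coef (fun x k => sigma x k + lam%:C))) u l = 0) -> forall k, u k = 0 &
      forall B f, l2_le B f -> exists u, exists2 B', l2_le B' (fun k => (W k)%:C * u k) &
        forall l, kapp (symb_mx (coef (fun x k => sigma x k + lam%:C))) u l = f l].
Proof.
have [KP [MP hP]] := weight_peetre hLam.
have [K1 [M1 hP1]] := peetre_pow (2 * m) Lam0 hP.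
have [K2 [M2 hP2]] := peetre_pow (2 * m - rho) Lam0 hP.
have Lp1 := fun k => powR_gt0 (2 * m) (Lam0 k).
have Vp := fun k => powR_gt0 (2 * m - rho) (Lam0 k).
have K11 := peetre_ge1 Lp1 hP1; have K21 := peetre_ge1 Vp hP2.
(* The weights multiplied in the composition error are at worst V / W^2, with
   Peetre exponent 3 M; five more powers leave one for the number of steps and
   the square of wt. *)
pose K := K1 + K2; pose M := (M1 + M2)%N; pose N := (3 * M + 5)%N.
have hPL : peetre K M (fun k => Lam k `^ (2 * m)).
  by apply: peetreW hP1 => //; rewrite /K /M ?leq_addr //; lra.
have hPV : peetre K M V.
  by apply: peetreW hP2 => //; rewrite /K /M ?leq_addl //; lra.
have [c c0 [l1 l10 hlow]] := elliptic_lower.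
have hCa n : exists2 C, 0 <= C & forall lam, 0 <= lam -> forall k,
    Cb n (C * (Lam k `^ (2 * m) + lam)) (fun x => sigma x k + lam%:C).
  have [C C0 hC] := symbol_Cb n; exists (C + 1); first by lra.
  move=> lam lam0 k; apply: CbW (CbD (hC k) (Cb_cst n lam%:C)).
  rewrite cabs_real ger0_norm //; have := Lp1 k; have := mulr_ge0 C0 lam0; lra.
have [Ca Ca0 hCa'] := hCa N.+1.
have [Cd Cd0 hCd] := symbol_diff_Cb N.+1.
have [D D0 hD] := @Cb_inv R N.+1 Ca c c0.
pose Cdb := 2 ^+ N.+1 * (2 ^+ N.+1 * Cd * D) * (D * K * 2 ^+ M).
pose C := 2 ^+ N.+1 * (Ca + Cd + D + Cdb).
have K0 : 0 <= K by rewrite /K; lra.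
have e2 n : 0 <= 2 ^+ n :> R by rewrite exprn_ge0.
have Cdb0 : 0 <= Cdb by rewrite /Cdb !mulr_ge0.
have C0 : 0 <= C by rewrite /C mulr_ge0 // addr_ge0 // addr_ge0 // addr_ge0.
have subC E : E <= Ca + Cd + D + Cdb -> 2 ^+ N.+1 * E <= C.
  by move=> h; rewrite ler_wpM2l.
pose d := (64 * (C * C * (K * (K * K)) + 1))^-1.
have CK0 : 0 <= C * C * (K * (K * K)) by exact: mulr_ge0 (mulr_ge0 C0 C0) (mulr_ge0 K0 (mulr_ge0 K0 K0)).
have d0 : 0 < d by rewrite invr_gt0; lra.
(* The constant 64 is 4 * 16: the factor 4 of the composition error, and the
   bound 1/16 under which the iteration converges. *)
have small : 4 * (C * C * (K * (K * K)) * d) <= 16%:R^-1.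
  have : d * (64 * (C * C * (K * (K * K)) + 1)) = 1 by rewrite mulVf // gt_eqF //; lra.
  by move: (C * C * (K * (K * K))) CK0 (ltW d0) => z z0 d0'; nra.
have [l2 l20 hl2] := lower_order_small d0.
exists (l1 + l2) => lam hlam.
have lam0 : 0 < lam by lra.
have lam_l1 : l1 <= lam by lra.
have lam_l2 : l2 <= lam by lra.
pose W k := Lam k `^ (2 * m) + lam.
have W0 k : 0 < W k by rewrite ltr_wpDl ?powR_ge0.
have lW k : lam <= W k by rewrite lerDr powR_ge0.
have hW : peetre K M W by exact: peetreD_cst (ltW lam0) hPL.
exists W, K, M, lam.
pose sl := fun x k => sigma x k + lam%:C.
have hCW n : exists2 C, 0 <= C & forall k, Cb n (C * W k) (sl^~ k).
  by have [Cn Cn0 h] := hCa n; exists Cn => // k; exact: h (ltW lam0) k.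
pose b x k : R[i] := (sl x k)^-1.
have hb k : Cb N.+1 (D / W k) (b^~ k).
  by apply: hD => //; [exact: hCa' (ltW lam0) k|move=> x; exact: hlow].
have slne x k : sl x k != 0.
  apply/eqP => e; have := hlow lam lam_l1 x k; rewrite -/(sl x k) e cabs0.
  by rewrite leNgt mulr_gt0 // W0.
(* The difference of reciprocals is a product of three factors, of sizes V k,
   1 / W k and 1 / W (k + 1); the last is comparable to 1 / W k by Peetre's
   inequality. *)
have hbd k : Cb N.+1 (Cdb * (V k * ((W k)^-1 * (W k)^-1)))
    (fun x => b x (k + 1) - b x k).
  have -> : (fun x => b x (k + 1) - b x k) =
     fun x => - ((sigma x (k + 1) - sigma x k) * b x k * b x (k + 1)).
    apply/funext => x; rewrite /b.
    have -> : sigma x (k + 1) - sigma x k = sl x (k + 1) - sl x k by rewrite /sl; ring.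
    by field; rewrite !slne.
  apply/CbN; apply: CbW (CbM (CbM (hCd k) (hb k)) (hb (k + 1))).
  have hWk : (W (k + 1))^-1 <= K * (W k)^-1 * 2 ^+ M.
    have := peetreV W0 hW (k + 1) k.
    by rewrite addrAC subrr add0r /jap normr1.
  rewrite -/(V k).
  have Wi : 0 <= (W k)^-1 by rewrite invr_ge0 ltW.
  have V0 : 0 <= V k by exact: powR_ge0.
  apply: (@le_trans _ _ (2 ^+ N.+1 * (2 ^+ N.+1 * (Cd * V k) * (D / W k)) *
      (D * (K * (W k)^-1 * 2 ^+ M)))).
    by rewrite ler_wpM2l ?mulr_ge0 // ler_wpM2l.
  by rewrite le_eqVlt; apply/orP; left; apply/eqP; rewrite /Cdb; ring.
have Cb3 n (Mx : R) (g : R -> R[i]) : (3 <= n)%N -> Cb n Mx g -> Cb 3 Mx g.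
  move=> h; rewrite -(subnKC h); elim: (n - 3)%N => [|j IH]; first by rewrite addn0.
  by rewrite addnS => /CbS.
have N3 : (3 <= N.+1)%N by rewrite ltnS (leq_trans _ (leq_addl _ _)).
have ha k : Cb N.+1 (Ca * W k) (sl^~ k) by exact: hCa' (ltW lam0) k.
have cia k : cint (sl^~ k) by exact: Cb_cint (ha k).
have cib k : cint (b^~ k) by exact: Cb_cint (hb k).
have jN p : 0 <= jap p ^- N :> R by rewrite invr_ge0 exprn_ge0 ?jap_ge0.
have da : decay C N W (coef sl).
  move=> p k; apply: le_trans (coef_decay ha p k) _.
  by rewrite ler_wpM2r // ler_wpM2r ?(ltW (W0 k)) // subC //; lra.
have db : decay C N (fun k => (W k)^-1) (coef b).
  move=> p k; apply: le_trans (@coef_decay N D (fun k => (W k)^-1) b hb p k) _.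
  by rewrite ler_wpM2r // ler_wpM2r ?invr_ge0 ?(ltW (W0 k)) // subC //; lra.
have dda p k : cabs (coef sl p (k + 1) - coef sl p k) <= C * V k * jap p ^- N.
  rewrite /coef -fcoefB //.
  have -> : (fun x => sl x (k + 1) - sl x k) = fun x => sigma x (k + 1) - sigma x k.
    by apply/funext => x; rewrite /sl; ring.
  apply: le_trans (fcoef_decay p (hCd k)) _; rewrite mulrA.
  by rewrite ler_wpM2r // ler_wpM2r ?powR_ge0 // subC //; lra.
have ddb p k : cabs (coef b p (k + 1) - coef b p k) <=
    C * (V k * ((W k)^-1 * (W k)^-1)) * jap p ^- N.
  rewrite /coef -fcoefB //.
  apply: le_trans (fcoef_decay p (hbd k)) _; rewrite mulrA.
  rewrite ler_wpM2r // ler_wpM2r ?mulr_ge0 ?powR_ge0 ?invr_ge0 ?(ltW (W0 k)) // subC //; lra.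
have conv1 k : fcoef k (fun _ : R => 1) = (k == 0)%:R :> R[i].
  by rewrite -fcoef_expi; congr fcoef; apply/funext => x; rewrite expi0.
have cab l k : sumZ (fun j => coef sl (l - j) k * coef b (j - k) k) = (l == k)%:R.
  rewrite (convolution l k (Cb3 _ _ _ N3 (ha k)) (Cb3 _ _ _ N3 (hb k))).
  have -> : (fun x => sl x k * b x k) = fun=> 1.
    by apply/funext => x; rewrite /b mulfV.
  by rewrite conv1 subr_eq0.
have cba l k : sumZ (fun j => coef b (l - j) k * coef sl (j - k) k) = (l == k)%:R.
  rewrite (convolution l k (Cb3 _ _ _ N3 (hb k)) (Cb3 _ _ _ N3 (ha k))).
  have -> : (fun x => b x k * sl x k) = fun=> 1.
    by apply/funext => x; rewrite /b mulVf.
  by rewrite conv1 subr_eq0.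
have [inj solve] := parametrix W0 Vp C0 (leqnn N) lam0 lW hW hPV da db dda ddb
  (hl2 lam lam_l2) small cab cba.
by split.
Qed.
End Symbol.

(** * The maximal and the minimal operator *)

Section Operators.
Context {R : realType}.
Notation mu := (@lebesgue_measure R).
Variables (s : R -> int -> R[i]) (W : int -> R) (K : R) (M : nat).
Hypothesis W0 : forall k, 0 < W k.
Hypothesis hW : peetre K M W.
Hypothesis hs : forall n, exists2 C, 0 <= C & forall k, Cb n (C * W k) (s^~ k).

Let a := coef s.

(** The rows of the matrix are summable, with a constant that may grow with the
    row: enough for the matrix to act on bounded sequences. *)
Lemma coef_row : exists C, forall l k, cabs (symb_mx a l k) <= C * W l * wt (l - k).
Proof.
have [C C0 hC] := hs (M + 4).+1.
have C0' : 0 <= 2 ^+ (M + 4).+1 * C by rewrite mulr_ge0 ?exprn_ge0.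
have K0 : 0 <= K by have := peetre_ge1 W0 hW; lra.
exists (2 ^+ (M + 4).+1 * C * K) => l k.
apply: le_trans (decay_row W0 C0' (leqnn _) hW (coef_decay hC) l k) _.
by rewrite ler_wpM2l ?wt_sqr_le // mulr_ge0 ?mulr_ge0 // ltW.
Qed.

(** The maximal operator, described by Fourier coefficients, so that its
    closedness becomes a property of the rows of a matrix. *)
Definition max_op : @op_graph R := fun u f =>
  [/\ L2 u, L2 f & forall l, fcoef l f = kapp (symb_mx a) (fcoef^~ u) l].

(** Bessel's inequality bounds each coefficient of a difference by its norm, so
    convergence in L^2 implies uniform convergence of the coefficients. *)
Lemma L2_cvg_fcoef (u_ : nat -> R -> R[i]) u : (forall n, L2 (u_ n)) -> L2 u -> L2_cvg u_ u ->
  forall e, 0 < e -> exists N, forall n, (N <= n)%N -> forall p, cabs (fcoef p (u_ n) - fcoef p u) <= e.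
Proof.
move=> hu_ hu hc e e0; have p0 := @pi2_gt0 R.
have h n : L2m (fun x => u_ n x - u x) by apply: L2mB; [case/L2E: (hu_ n)|case/L2E: hu].
have ee : 0 < 2 * pi * e ^+ 2 by rewrite mulr_gt0 ?exprn_gt0.
have : sqnorm (fun x => u_ n x - u x) @[n --> \oo] --> (0 : R).
  move: hc; rewrite /L2_cvg; under eq_fun do rewrite L2_sqnormE //.
  by move/fine_cvgP => [].
move/cvgrPdist_le => /(_ _ ee)[N _ hN]; exists N => n Nn p.
have := hN n Nn; rewrite sub0r normrN ger0_norm ?sqnorm_ge0 // => h1.
have := l2_le_coef p (bessel_l2_le (h n)).
rewrite fcoefB; try (apply: L2m_cint; by [case/L2E: (hu_ n)|case/L2E: hu]).
move=> h2; rewrite -(ler_pXn2r (ltn0Sn 1)) ?nnegrE ?cabs_ge0 ?(ltW e0) //.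
by apply: le_trans h2 _; rewrite ler_pdivrMr // mulrC.
Qed.

Lemma fcoef_bounded (u : R -> R[i]) : L2m u -> exists B, forall p, cabs (fcoef p u) <= B.
Proof.
by move=> h; exists (1 + sqnorm u / (2 * pi)) => p; exact: l2_le_bounded p (bessel_l2_le h).
Qed.

Lemma L2_lin (c : R[i]) (u v : R -> R[i]) : L2 u -> L2 v -> L2 (fun x => c * u x + v x).
Proof.
move=> /L2E[pu hu] /L2E[pv hv]; apply/L2E; split; first by move=> x; rewrite pu pv.
by apply: L2mD => //; exact: L2mZ.
Qed.

Lemma L2_0 : @L2 R (fun=> 0).
Proof.
apply/L2E; split; first by [].
by apply: (L2m_bounded (M := 0)); [exact: cmeas_cst|move=> x; rewrite cabs0].
Qed.

Lemma max_op_linear : linear_operator max_op.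
Proof.
have [C hC] := coef_row.
have cL2 (u : R -> R[i]) : L2 u -> L2m u by case/L2E.
have iL2 (u : R -> R[i]) : L2 u -> cint u by case/L2E => _ /L2m_cint.
split.
- by move=> u f [].
- move=> u f u' f' [hu hf h] hu' hf' eu ef; split; [exact: hu'|exact: hf'|move=> l].
  rewrite -(fcoef_ae l (cL2 _ hf) (cL2 _ hf') ef) h; congr (kapp _ _ l).
  by apply/funext => k; exact: fcoef_ae (cL2 _ hu) (cL2 _ hu') eu.
- move=> u f f' [_ hf h] [_ hf' h']; apply: fcoef_inj => // p; by rewrite h h'.
- split; try exact: L2_0.
  move=> l; rewrite fcoef0 /kapp.
  have -> : (fun k => symb_mx a l k * @fcoef R k (fun=> 0)) = fun=> 0.
    by apply/funext => k; rewrite fcoef0 mulr0.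
  by rewrite (@sumZ_fin _ _ 0) // /psum big1_eq.
- move=> c u f v g [hu hf h] [hv hg h']; split; try exact: L2_lin.
  move=> l; have [Bu hBu] := fcoef_bounded (cL2 _ hu); have [Bv hBv] := fcoef_bounded (cL2 _ hv).
  have d1 := row_dom (hC l) hBu; have d2 := row_dom (hC l) hBv.
  rewrite fcoefD ?fcoefZ ?h ?h' //; [|exact: iL2|exact/cintZ/iL2|exact: iL2].
  rewrite /kapp -(sumZZ c d1) -(sumZD (domwZ c d1) d2); congr sumZ; apply/funext => k.
  rewrite fcoefD ?fcoefZ; [ring|exact: iL2|exact/cintZ/iL2|exact: iL2].
Qed.

(** Each row of the matrix is summable, so it passes to the limit along
    uniformly convergent coefficients. *)
Lemma max_op_closed : closed_operator max_op.
Proof.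
split; first exact: max_op_linear.
have [C hC] := coef_row.
move=> u_ f_ u f hA hu hf cu cf; split=> // l.
have hu_ n : L2 (u_ n) by case: (hA n).
have hf_ n : L2 (f_ n) by case: (hA n).
have C0 : 0 <= C * W l.
  by have := hC l l; rewrite subrr /wt /jap normr0 addr0 expr1n invr1 mulr1; apply/le_trans/cabs_ge0.
apply/eqP; rewrite -subr_eq0; apply/eqP/cabs_eq0/ler_addgt0Pr => e e0; rewrite add0r.
pose e' := e / (1 + 4 * (C * W l)).
have e'0 : 0 < e' by rewrite divr_gt0 //; lra.
have [N1 h1] := L2_cvg_fcoef hu_ hu cu e'0; have [N2 h2] := L2_cvg_fcoef hf_ hf cf e'0.
pose n := maxn N1 N2.
have {}h1 := h1 n (leq_maxl _ _); have {}h2 := h2 n (leq_maxr _ _) l.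
have [_ _ /(_ l) hn] := hA n.
have [Bu hBu] : exists B, forall p, cabs (fcoef p u) <= B by apply: fcoef_bounded; case/L2E: hu.
have [Bn hBn] : exists B, forall p, cabs (fcoef p (u_ n)) <= B.
  by apply: fcoef_bounded; case/L2E: (hu_ n).
have d1 := row_dom (hC l) hBu; have d2 := row_dom (hC l) hBn.
have h3 : cabs (kapp (symb_mx a) (fcoef^~ (u_ n)) l - kapp (symb_mx a) (fcoef^~ u) l) <= 4 * (C * W l) * e'.
  rewrite /kapp -(sumZB d2 d1); under eq_fun => k do rewrite -mulrBr.
  exact: row_le.
have -> : fcoef l f - kapp (symb_mx a) (fcoef^~ u) l =
    (kapp (symb_mx a) (fcoef^~ (u_ n)) l - kapp (symb_mx a) (fcoef^~ u) l) - (fcoef l (f_ n) - fcoef l f).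
  by rewrite hn [RHS]addrC opprB subrKA.
apply: le_trans (cabsB _ _) _; apply: le_trans (lerD h3 h2) _.
have -> : e = e' * (1 + 4 * (C * W l)) by rewrite /e' divfK // gt_eqF //; lra.
by rewrite le_eqVlt; apply/orP; left; apply/eqP; ring.
Qed.

Lemma psdo_dom (phi : R -> R[i]) : smooth_torus phi ->
  exists D, forall x, domw D (fun k => s x k * (fcoef k phi * expi k x)).
Proof.
move=> hphi; have [C C0 hC] := hs 0.
have [D hD] := smooth_Cb (M + 2).+1 hphi.
have D0 := Cb_ge0 hD; have K0 : 0 <= K by have := peetre_ge1 W0 hW; lra.
exists (C * (K * W 0) * (2 ^+ (M + 2).+1 * D)) => x k.
rewrite cabsM (cabsM (fcoef k phi)) cabs_expi mulr1.
have h1 : cabs (s x k) <= C * (K * W 0 * jap k ^+ M).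
  apply: le_trans (Cb_bound x (hC k)) _; rewrite ler_wpM2l //.
  by have := hW k 0; rewrite subr0.
have h2 := fcoef_decay k hD.
apply: le_trans (ler_pM (cabs_ge0 _) (cabs_ge0 _) h1 h2) _.
rewrite /wt exprD le_eqVlt; apply/orP; left; apply/eqP; field.
by rewrite ?expf_neq0 ?jap_neq0.
Qed.

Lemma psdoE (phi : R -> R[i]) : smooth_torus phi ->
  psdo s phi = fun x => sumZ (fun k => s x k * (fcoef k phi * expi k x)).
Proof.
move=> hphi; apply/funext => x; have [D hD] := psdo_dom hphi.
have iphi : cint phi by have [D' hD'] := smooth_Cb 1 hphi; exact: Cb_cint hD'.
have p0 := @pi2_gt0 R.
have e k : torus_int (fun y => cis ((x - y) * k%:~R) * s x k * phi y) =
    (2 * pi)%:C * (s x k * (fcoef k phi * expi k x)).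
  have -> : (fun y => cis ((x - y) * k%:~R) * s x k * phi y) =
      fun y => (s x k * expi k x) * (phi y * expi (- k) y).
    apply/funext => y.
    have -> : cis ((x - y) * k%:~R) = expi k x * expi (- k) y.
      by rewrite /expi -cisD mulrNz mulrN -mulrBl.
    ring.
  rewrite torus_intZ; last exact: cint_expi.
  rewrite /fcoef; set t := torus_int _; set c := ((2 * pi)^-1)%:C.
  have : (2 * pi)%:C * c = 1 by rewrite /c -rmorphM mulfV ?gt_eqF.
  by move=> h; rewrite -(mul1r (s x k * expi k x * t)) -h; ring.
rewrite /psdo; under eq_fun do rewrite e.
rewrite (sumZZ _ (hD x)) mulrA -rmorphM mulVf ?gt_eqF //.
by rewrite mul1r.
Qed.

(** The defining series converges absolutely and uniformly because the
    coefficients of a smooth function decay faster than any power, so its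
    Fourier coefficients may be computed term by term. *)
Lemma psdo_max (phi : R -> R[i]) : smooth_torus phi -> max_op phi (psdo s phi).
Proof.
move=> hphi; have [D hD] := psdo_dom hphi.
have [D' hD'] := smooth_Cb 1 hphi; have iphi := Cb_cint hD'.
have [pphi _] := hphi; have [C C0 hC] := hs 1.
pose F k x := s x k * (fcoef k phi * expi k x).
have is_ k : cint (s^~ k) by exact: Cb_cint (hC k).
have ms k : cmeas (s^~ k) by case: (is_ k).
have mF k : cmeas (F k) by apply: cmeasM => //; exact/cmeasZ/cmeas_expi.
rewrite (psdoE hphi); split.
- apply/L2E; split=> //; apply: (L2m_bounded (M := D')); first by case: iphi.
  by move=> x; exact: Cb_bound hD'.
- apply/L2E; split.
    move=> x; congr sumZ; apply/funext => k.
    by rewrite expi_periodic (Cb_per (hC k)).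
  apply: (L2m_bounded (M := 4 * D)); first exact: cmeas_sumZ mF hD.
  by move=> x; exact: sumZ_le_dom.
- move=> l; rewrite (fcoef_sumZ l mF hD) /kapp; congr sumZ; apply/funext => k.
  rewrite /symb_mx /a /coef -fcoef_shift mulrC -fcoefZ; last exact/cint_expi/is_.
  by congr fcoef; apply/funext => x; rewrite /F mulrCA.
Qed.

(** The smallest closed extension is the intersection of all closed extensions;
    there is at least one, the maximal operator, which makes the
    intersection single-valued. *)
Definition min_op : @op_graph R := fun u f => [/\ L2 u, L2 f &
  forall B, closed_operator B -> extends_psdo s B -> B u f].

Lemma min_op_minimal : minimal_operator s min_op.
Proof.
have B0 := max_op_closed; have E0 : extends_psdo s max_op by move=> phi; exact: psdo_max.
split.
- split.
    split.
    + by move=> u f [].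
    + move=> u f u' f' [hu hf h] hu' hf' eu ef; split=> // B cB eB.
      have [[_ h2 _ _ _] _] := cB; exact: h2 (h B cB eB) hu' hf' eu ef.
    + move=> u f f' [_ _ h] [_ _ h']; have [[_ _ h3 _ _] _] := B0.
      exact: h3 (h _ B0 E0) (h' _ B0 E0).
    + by split; [exact: L2_0|exact: L2_0|move=> B [[_ _ _ h4 _] _] _].
    + move=> c u f v g [hu hf h] [hv hg h']; split; try exact: L2_lin.
      move=> B cB eB; have [[_ _ _ _ h5] _] := cB.
      exact: h5 (h B cB eB) (h' B cB eB).
  move=> u_ f_ u f hA hu hf cu cf; split=> // B cB eB.
  have [_ hcl] := cB; apply: (hcl u_ f_) => // n.
  by have [_ _ h] := hA n; exact: h.
- move=> phi hphi; have [h1 h2 _] := E0 phi hphi; split=> // B _ eB; exact: eB.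
- by move=> B cB eB u f [_ _ h]; exact: h.
Qed.

(** A minimal operator is contained in every closed extension. *)
Lemma strong_solution_max u f : strong_solution s f u -> max_op u f.
Proof.
move=> [A [_ _ hmin] hA]; apply: hmin hA; first exact: max_op_closed.
by move=> phi; exact: psdo_max.
Qed.

(** The norm in the definition of convergence is extended-valued; on
    square-integrable functions the real-valued one can be used. *)
Lemma L2_cvgP (w : nat -> R -> R[i]) u : (forall n, L2m (fun x => w n x - u x)) ->
  (forall e, 0 < e -> exists N, forall n, (N <= n)%N ->
     sqnorm (fun x => w n x - u x) <= e) -> L2_cvg w u.
Proof.
move=> hw h; rewrite /L2_cvg; under eq_fun do rewrite L2_sqnormE //.
apply: cvg_EFin; first by near=> n.
apply/cvgrPdist_le => e e0; have [N hN] := h e e0.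
exists N => // n Nn; rewrite sub0r normrN ger0_norm ?sqnorm_ge0 //; exact: hN.
Unshelve. all: by end_near. Qed.

Definition cut (n : nat) (g : int -> R[i]) k := if (`|k|%N <= n)%N then 0 else g k.

Lemma l2_le_cut B (g : int -> R[i]) : l2_le B g -> forall e, 0 < e ->
  exists N, forall n, (N <= n)%N -> l2_le e (cut n g).
Proof.
move=> hg e e0; have [nn [ht _ _]] := l2_tail hg.
pose j := Num.bound e^-1.
have hj : (16 ^+ j)^-1 <= e.
  have h : e^-1 < j%:R by apply: archi_boundP; rewrite invr_ge0 ltW.
  rewrite -[e]invrK lef_pV2 ?posrE ?invr_gt0 ?exprn_gt0 //.
  apply: le_trans (ltW h) _; rewrite -natrX ler_nat.
  by apply: leq_trans (ltnW (ltn_expl j (isT : (1 < 2)%N))) _; rewrite leq_exp2r // ; case: j {h}.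
exists (nn j) => n jn N; apply: le_trans hj.
apply: le_trans (ht j n (maxn n N) jn (leq_maxl _ _)).
have pos (F : int -> R) N1 N2 : (N1 <= N2)%N -> (forall k, 0 <= F k) ->
    \sum_(k <- zrange N1) F k <= \sum_(k <- zrange N2) F k.
  move=> N12 F0; rewrite -subr_ge0 sum_zrange_cut // sumr_ge0 // => k _.
  by case: ifP.
rewrite sum_zrange_cut ?leq_maxl //.
have -> : \sum_(k <- zrange (maxn n N)) (if (`|k|%N <= n)%N then 0 else cabs (g k) ^+ 2) =
    \sum_(k <- zrange (maxn n N)) cabs (cut n g k) ^+ 2.
  by apply: eq_bigr => k _; rewrite /cut; case: ifP; rewrite // cabs0 expr0n.
by apply: pos; [exact: leq_maxr|move=> k; exact: sqr_ge0].
Qed.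
End Operators.

(** * Unique solvability *)

Section Solve.
Context {R : realType}.
Variables (s : R -> int -> R[i]) (W : int -> R) (K c : R) (M : nat).
Hypothesis c0 : 0 < c.
Hypothesis cW : forall k, c <= W k.
Hypothesis hW : peetre K M W.
Hypothesis hs : forall n, exists2 C, 0 <= C & forall k, Cb n (C * W k) (s^~ k).

Let W0 k : 0 < W k. Proof. exact: lt_le_trans c0 (cW k). Qed.

(** The truncated Fourier series u_n of u are smooth and tend to u in L^2.
    Their images tend to f as well: the coefficients of the difference are
    the matrix applied to the tail of those of u, and the matrix is bounded
    on the sequences g with W g square summable, where the tail tends to
    zero. *)
Lemma min_op_of_coef (u f : R -> R[i]) B : L2 u -> L2 f ->
  l2_le B (fun k => (W k)%:C * fcoef k u) ->
  (forall l, kapp (symb_mx (coef s)) (fcoef^~ u) l = fcoef l f) -> min_op s u f.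
Proof.
move=> hu hf hWu huf.
have [[_ hcl] hext _] := min_op_minimal W0 hW hs.
have L2mu : L2m u by case/L2E: hu.
have L2mf : L2m f by case/L2E: hf.
pose un n := trigp (zrange n) (fcoef^~ u).
have sun n : smooth_torus (un n) by exact: smooth_trigp.
have hmax n := psdo_max W0 hW hs (sun n).
have fcun n k : fcoef k (un n) = if (`|k|%N <= n)%N then fcoef k u else 0.
  by rewrite /un fcoef_trigp ?zrange_uniq // mem_zrange.
have cutu n k : fcoef k (un n) - fcoef k u = - cut n (fcoef^~ u) k.
  by rewrite fcun /cut; case: ifP => _; rewrite ?subrr ?oppr0 // sub0r.
have L2un n : L2m (un n) by exact: L2m_trigp.
have L2pn n : L2m (psdo s (un n)) by case: (hmax n) => _ /L2E[].
have p0 := pi_gt0 R.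
apply: (hcl un (fun n => psdo s (un n)) u f _ hu hf).
- by move=> n; exact: hext.
- apply: L2_cvgP => [n|e e0]; first exact: L2mB.
  have e'0 : 0 < e * c ^+ 2 / (4 * pi) by rewrite !mulr_gt0 ?invr_gt0 ?mulr_gt0 ?exprn_gt0.
  have [N hN] := l2_le_cut hWu e'0; exists N => n Nn.
  have h : l2_le (c^-1 ^+ 2 * (e * c ^+ 2 / (4 * pi))) (fcoef^~ (fun x => un n x - u x)).
    apply: l2_leZ (hN n Nn); first by rewrite invr_ge0 ltW.
    move=> k; rewrite fcoefB ?cutu; try exact: L2m_cint.
    rewrite cabsN /cut; case: ifP => _; first by rewrite cabs0 mulr0.
    rewrite cabsM cabs_real (gtr0_norm (W0 k)) mulrA ler_peMl ?cabs_ge0 //.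
    by rewrite mulrC ler_pdivlMr // mul1r.
  apply: le_trans (parseval_le (L2mB (L2un n) L2mu) h) _.
  rewrite le_eqVlt; apply/orP; left; apply/eqP.
  by move: (@pi R) p0 => p pp; field; rewrite !gt_eqF.
- have [C C0 hC] := hs (M + 4).+1.
  have C0' : 0 <= 2 ^+ (M + 4).+1 * C by rewrite mulr_ge0 ?exprn_ge0.
  have dec := coef_decay hC.
  apply: (@L2_cvgP R (fun n => psdo s (un n)) f) => [n|e e0]; first exact: L2mB.
  (* The norm of the matrix from the weighted to the unweighted sequences, by
     Schur's test; the added 1 keeps it positive. *)
  pose C1 := 2 * (16 * (2 ^+ (M + 4).+1 * C) ^+ 2) + 1.
  have C10 : 0 < C1 by rewrite ltr_wpDl // !mulr_ge0 ?exprn_ge0.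
  have e'0 : 0 < e / (C1 * (4 * pi)) by rewrite divr_gt0 // !mulr_gt0.
  have [N hN] := l2_le_cut hWu e'0; exists N => n Nn.
  have [row hrow] := coef_row W0 hW hs.
  have hB := fun k => l2_le_bounded k (bessel_l2_le L2mu).
  have hB' := fun k => l2_le_bounded k (bessel_l2_le (L2un n)).
  have e1 l : fcoef l (fun x => psdo s (un n) x - f x) =
      - kapp (symb_mx (coef s)) (cut n (fcoef^~ u)) l.
    rewrite fcoefB; try exact: L2m_cint.
    have [_ _ ->] := hmax n; rewrite -huf /kapp.
    rewrite -(sumZB (row_dom (hrow l) hB') (row_dom (hrow l) hB)).
    have dcut : domw (row * W l * (1 + sqnorm u / (2 * pi)) * jap l ^+ 2)
        (fun k => symb_mx (coef s) l k * cut n (fcoef^~ u) k).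
      apply: (row_dom (hrow l)) => k; rewrite /cut; case: ifP => _ //.
      by rewrite cabs0; apply: le_trans (hB 0); exact: cabs_ge0.
    rewrite -(sumZN dcut); congr sumZ; apply/funext => k.
    by rewrite -mulrBr cutu mulrN.
  have hcutW : l2_le (e / (C1 * (4 * pi))) (fun k => (W k)%:C * cut n (fcoef^~ u) k).
    apply: l2_le_le (hN n Nn) => k; rewrite /cut; case: ifP => _ //.
    by rewrite mulr0.
  have h : l2_le (2 * (16 * (2 ^+ (M + 4).+1 * C) ^+ 2 * (e / (C1 * (4 * pi)))))
      (fcoef^~ (fun x => psdo s (un n) x - f x)).
    have := l2_leN (decay_kapp_l2 W0 C0' (leqnn _) dec hcutW).
    by apply: l2_le_le => l; rewrite e1.
  apply: le_trans (parseval_le (L2mB (L2pn n) L2mf) h) _.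
  have -> : 4 * pi * (2 * (16 * (2 ^+ (M + 4).+1 * C) ^+ 2 * (e / (C1 * (4 * pi))))) =
      (C1 - 1) / C1 * e.
    rewrite /C1; move: (@pi R) p0 C10 => p pp C10'; field; rewrite !gt_eqF //.
  rewrite ler_piMl ?(ltW e0) // ler_pdivrMr // mul1r; lra.
Qed.
End Solve.

Theorem theorem6p4 (R : realType) (mu rho : R) (Lam : int -> R)
    (hLam : weight_function mu Lam) (hrho : 0 < rho <= mu^-1)
    (m : R) (hm : 0 < m) (sigma : R -> int -> R[i])
    (hsigma : M_class rho Lam (2 * m) sigma)
    (hell : strongly_elliptic Lam (2 * m) sigma) :
  forall f : R -> R[i], L2 f ->
    exists lam0 : R, forall lam : R, lam0 <= lam ->
      exists u : R -> R[i],
        strong_solution (fun x k => sigma x k + lam%:C) f u /\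
        forall v : R -> R[i],
          strong_solution (fun x k => sigma x k + lam%:C) f v -> ae_equal u v.
Proof.
move=> f hf; have /andP[rho0 _] := hrho.
have hS : S_class rho Lam (2 * m) sigma.
  have [_ /(_ 0%N isT)] := hsigma; congr (S_class _ _ _ _).
  by apply/funext => x; apply/funext => k; rewrite expr0 mul1r.
have [lam0 hlam0] := elliptic_invertible hLam rho0 hS hell.
exists lam0 => lam /hlam0 [W [K [M [c [[c0 cW] hW hs inj solve]]]]].
have W0 k : 0 < W k by exact: lt_le_trans c0 (cW k).
pose s := fun x k => sigma x k + lam%:C.
have L2mf : L2m f by case/L2E: hf.
have [uh [B hB huh]] := solve _ _ (bessel_l2_le L2mf).
have hul2 : l2_le (c^-1 ^+ 2 * B) uh.
  apply: l2_leZ hB; first by rewrite invr_ge0 ltW.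
  move=> k; rewrite cabsM cabs_real (gtr0_norm (W0 k)) mulrA ler_peMl ?cabs_ge0 //.
  by rewrite mulrC ler_pdivlMr // mul1r.
have [u [pu L2mu fcu _]] := riesz_fischer hul2.
have hu : L2 u by apply/L2E.
have uhE : uh = fcoef^~ u by apply/funext => p; rewrite fcu.
have sol : strong_solution s f u.
  exists (min_op s); first exact: min_op_minimal W0 hW hs.
  apply: (min_op_of_coef c0 cW hW hs hu hf (B := B)).
    by move: hB; rewrite uhE.
  by move: huh; rewrite uhE.
exists u; split=> // v hv.
have [_ hv2 hvf] := strong_solution_max W0 hW hs hv.
have [_ _ huf] := strong_solution_max W0 hW hs sol.
have {}hv2 : L2 v by have [? ? ?] := strong_solution_max W0 hW hs hv.
have L2mv : L2m v by case/L2E: hv2.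
have bu := fun k => l2_le_bounded k (bessel_l2_le L2mu).
have bv := fun k => l2_le_bounded k (bessel_l2_le L2mv).
apply: fcoef_inj => // p; apply/eqP; rewrite -subr_eq0; apply/eqP.
apply: (inj _ (fun k => fcoef k u - fcoef k v)).
  exact: l2_leD (bessel_l2_le L2mu) (l2_leN (bessel_l2_le L2mv)).
move=> l; have [row hrow] := coef_row W0 hW hs.
rewrite /kapp; under eq_fun do rewrite mulrBr.
rewrite (sumZB (row_dom (hrow l) bu) (row_dom (hrow l) bv)).
by rewrite -[X in X - _]/(kapp _ (fcoef^~ u) l) -[X in _ - X]/(kapp _ (fcoef^~ v) l) -huf -hvf subrr.
Qed.
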